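(* Let $\ell$ be a positive integer. For integers $0\le j\le m$ and real $x$ define $$z_\ell(m,j)(x)=2\,\mathrm{Re}\int_0^\infty(\ell+iu)^{m-j}\zeta(2\ell+1-j,\ell+iu)\log\left(1+\frac{u^2}{(x-\ell)^2}\right)du,$$ $$Z_\ell(m,j)(x)=2\,\mathrm{Re}\int_0^\infty\left(\ell+\tfrac12+iu\right)^{m-j}\zeta\!\left(2\ell+2-j,\ell+\tfrac12+iu\right)\log\left(1+\frac{u^2}{(x-\ell-\frac12)^2}\right)du.$$ Then for $x>\ell$, $$\sum_{j=0}^{2\ell-1}(-1)^{j-1}\sum_{m=j}^{2\ell-1}\binom{m}{j}s(2\ell,m+1)\,z_\ell(m,j)(x)=-\frac{\pi}{\ell}\left(\log(x-\ell)+H_{2\ell-1}-\frac{d^{2\ell-1}}{dx^{2\ell-1}}\left\{\binom{x-1}{2\ell-1}\psi(x-\ell)\right\}\right),$$ and for $x>\ell+\frac12$, $$\sum_{j=0}^{2\ell}(-1)^{j}\sum_{m=j}^{2\ell}\binom{m}{j}s(2\ell+1,m+1)\,Z_\ell(m,j)(x)=-\frac{2\pi}{2\ell+1}\left(\log\left(x-\ell-\tfrac12\right)+H_{2\ell}-\frac{d^{2\ell}}{dx^{2\ell}}\left\{\binom{x-1}{2\ell}\psi(x-\ell)\right\}\right).$$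
   Context: $\zeta(s,w)=\sum_{n\ge0}(n+w)^{-s}$ is the Hurwitz zeta function; $s(n,k)$ are the (signed) Stirling numbers of the first kind, defined by $x(x-1)\cdots(x-n+1)=\sum_k s(n,k)x^k$; $H_n$ is the $n$-th harmonic number; $\psi=\Gamma'/\Gamma$ is the digamma function; $\binom{x}{n}=\frac{x(x-1)\cdots(x-n+1)}{n!}$. *)

(* Defs.v *)
From Stdlib Require Import Reals ZArith List.
From Coquelicot Require Import Coquelicot.
Open Scope R_scope.

Fixpoint Cpown (z : C) (n : nat) : C :=
  match n with O => RtoC 1 | S k => Cmult z (Cpown z k) end.

(* Hurwitz zeta  zeta(s,w) = sum_{n>=0} (n+w)^{-s}, for a natural exponent s
   (here always s >= 2, where the series converges absolutely for Re w > 0);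
   the complex series is summed componentwise. *)
Definition hurwitz_term (s : nat) (w : C) (n : nat) : C :=
  Cinv (Cpown (Cplus (RtoC (INR n)) w) s).
Definition hurwitz_zeta (s : nat) (w : C) : C :=
  (Series (fun n => Re (hurwitz_term s w n)),
   Series (fun n => Im (hurwitz_term s w n))).

Definition Gamma (x : R) : R :=
  RInt_gen (fun t => Rpower t (x - 1) * exp (- t)) (at_right 0) (Rbar_locally p_infty).
Definition digamma (x : R) : R := Derive Gamma x / Gamma x.

Fixpoint harmonic (n : nat) : R :=
  match n with O => 0 | S k => harmonic k + / INR (S k) end.

Fixpoint falling (x : R) (n : nat) : R :=
  match n with O => 1 | S k => falling x k * (x - INR k) end.
Definition gbinom (x : R) (n : nat) : R := falling x n / INR (fact n).

(* ---------- signed Stirling numbers of the first kind ----------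
   s(n,k) = coefficient of x^k in x(x-1)...(x-n+1).  We compute the
   coefficient list (constant term first) of this product literally:
   ff_coeffs (n+1) = (x - n) * ff_coeffs n. *)
Fixpoint scal_list (c : Z) (p : list Z) : list Z :=
  match p with nil => nil | a :: q => (c * a)%Z :: scal_list c q end.
Fixpoint add_list (p q : list Z) : list Z :=
  match p, q with
  | nil, _ => q
  | _, nil => p
  | a :: p', b :: q' => (a + b)%Z :: add_list p' q'
  end.
Definition mul_x_minus (c : Z) (p : list Z) : list Z :=
  add_list (0%Z :: p) (scal_list (- c) p).
Fixpoint ff_coeffs (n : nat) : list Z :=
  match n with
  | O => 1%Z :: nil
  | S k => mul_x_minus (Z.of_nat k) (ff_coeffs k)
  end.
Definition stirling1 (n k : nat) : R := IZR (nth k (ff_coeffs n) 0%Z).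

(* ---------- the integrals z_l(m,j)(x) and Z_l(m,j)(x) ----------
   2 Re \int_0^\infty F(u) du is taken as 2 \int_0^\infty Re F(u) du
   (improper integral; the imaginary part alone need not converge). *)
Definition z_int (l m j : nat) (x : R) : R :=
  2 * RInt_gen
        (fun u => Re (Cmult (Cpown (INR l, u) (m - j))
                            (hurwitz_zeta (2 * l + 1 - j) (INR l, u)))
                  * ln (1 + u ^ 2 / (x - INR l) ^ 2))
        (at_point 0) (Rbar_locally p_infty).

Definition Z_int (l m j : nat) (x : R) : R :=
  2 * RInt_gen
        (fun u => Re (Cmult (Cpown (INR l + / 2, u) (m - j))
                            (hurwitz_zeta (2 * l + 2 - j) (INR l + / 2, u)))
                  * ln (1 + u ^ 2 / (x - INR l - / 2) ^ 2))
        (at_point 0) (Rbar_locally p_infty).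

Definition sum_range (a b : nat) (f : nat -> R) : R :=
  sum_n_m f a b.

(* Main.v *)
Require Import Defs.
From Stdlib Require Import Reals ZArith List Lra Lia.
From Coquelicot Require Import Coquelicot.
Open Scope R_scope.

(** Put N = 2l or 2l+1, K = N - 1, w = a + iu with a = N/2, and y = x - a.  The polynomial
    sum_m s(N,m+1) t^m is (t-1)...(t-K), so the binomial theorem applied to
    w - (w+n) = -n turns the double sum of zeta values into
    (-1)^K sum_n q_n (w+n)^(-N-1) with q_n = (n+1)...(n+K).

    Every integral is reduced to  int_0^oo b/(b^2+u^2) ln(1+u^2/y^2) du = pi ln(1+b/y)
    (differentiate in 1/y) and its b-derivatives
    int_0^oo Re (b+iu)^(-k-1) ln(1+u^2/y^2) du = -(pi/k) (b+y)^(-k).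
    Sum and integral cannot be exchanged naively, since sum_n q_n (n+x)^(-N) diverges; the
    tail n >= M is therefore replaced by int_M^oo t^K (t+w)^(-N-1) dt, which has a closed form,
    with an error O(1/(M^2+u^2)).  This gives, up to the factor 2 pi/N, the limit of
    ln((M+x)/y) - sum_(1<=k<=K) (1/k) (M/(M+x))^k - sum_(n<M) q_n (n+x)^(-N).

    The derivative of the binomial times digamma is the same limit without the harmonic number
    and ln y: Wendel's inequality for Gamma gives psi(v) = lim (ln M - sum_(n<M) 1/(v+n)),
    which may be differentiated termwise, and multiplication by a linear factor v - c turns the
    termwise formula for one polynomial into that for the next. *)

(** Only real parts can be integrated separately: for m = K the zeta term behaves like a multiple of
    1/w, whose imaginary part decays like 1/u and is not integrable against the logarithm, while its
    real part a/(a^2+u^2) is. Every interchange of a derivative with an integral or a limit uses one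
    device: a uniform bound on the second derivative makes the first-order Taylor remainder O(h^2),
    and such a bound survives integration against a majorant and passage to pointwise limits. The
    error O(1/(M^2+u^2)) is small enough because its integral against the logarithm is at most a
    constant times ln(1+(a+M)/y)/(a+M), which tends to 0. The argument x - l of psi, against the
    shift x in the sums, costs nothing: (x-1)...(x-K) vanishes at the positive integers up to K,
    which cancels the first l poles. *)

(** * Improper integrals *)

Definition convex_set (D : R -> Prop) : Prop :=
  forall a b t, D a -> D b -> Rmin a b <= t <= Rmax a b -> D t.

Lemma convex_ge0 : convex_set (fun t => 0 <= t).
Proof.
  intros a b t Ha Hb [H _]. apply Rle_trans with (2 := H).
  now apply Rmin_glb.
Qed.

Lemma convex_gt0 : convex_set (fun t => 0 < t).
Proof.
  intros a b t Ha Hb [H _]. apply Rlt_le_trans with (2 := H).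
  now apply Rmin_glb_lt.
Qed.

Lemma at_point_ge0 : at_point 0 (fun t => 0 <= t).
Proof. exact (Rle_refl 0). Qed.

Lemma p_infty_gt (c : R) : Rbar_locally p_infty (fun t => c < t).
Proof. now exists c. Qed.

Lemma p_infty_ge0 : Rbar_locally p_infty (fun t => 0 <= t).
Proof. exists 0. intros; now apply Rlt_le. Qed.

Lemma at_right_gt0 : at_right 0 (fun t => 0 < t).
Proof. now exists (mkposreal 1 Rlt_0_1). Qed.

Lemma is_RInt_gen_antiderivative (Fa Fb : (R -> Prop) -> Prop)
  {FFa : ProperFilter Fa} {FFb : ProperFilter Fb} (D : R -> Prop) (f F : R -> R) (la lb : R) :
  convex_set D -> Fa D -> Fb D ->
  (forall t, D t -> is_derive F t (f t)) ->
  (forall t, D t -> continuous f t) ->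
  filterlim F Fa (locally la) -> filterlim F Fb (locally lb) ->
  is_RInt_gen f Fa Fb (lb - la).
Proof.
  intros HD Da Db HF Hf Hla Hlb.
  apply (filterlimi_lim_ext_loc (fun ab => F (snd ab) - F (fst ab))).
  { exists D D; [exact Da|exact Db|]. intros a b Pa Pb. simpl.
    apply (is_RInt_derive F); intros t Ht; [apply HF|apply Hf]; exact (HD a b t Pa Pb Ht). }
  assert (H1 : filterlim (fun ab : R * R => F (fst ab)) (filter_prod Fa Fb) (locally la)).
  { apply (filterlim_comp _ _ _ fst F _ Fa); [apply filterlim_fst|exact Hla]. }
  assert (H2 : filterlim (fun ab : R * R => F (snd ab)) (filter_prod Fa Fb) (locally lb)).
  { apply (filterlim_comp _ _ _ snd F _ Fb); [apply filterlim_snd|exact Hlb]. }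
  assert (H3 : filterlim (fun ab : R * R => opp (F (fst ab))) (filter_prod Fa Fb) (locally (opp la))).
  { apply (filterlim_comp _ _ _ _ opp _ _ _ H1). apply (filterlim_opp la). }
  exact (filterlim_comp_2 _ _ plus H2 H3 (filterlim_plus lb (opp la))).
Qed.

(** Cauchy criterion: moving the endpoints changes the integral of [f] by at most the change of [G],
    and [G] converges along both filters. Giving the majorant through an antiderivative [G] with
    limits makes one lemma serve both ends of the Gamma integral and the half-line. *)
Lemma ex_RInt_gen_dominated (Fa Fb : (R -> Prop) -> Prop)
  {FFa : ProperFilter Fa} {FFb : ProperFilter Fb} (D : R -> Prop) (f g G : R -> R) (la lb : R) :
  convex_set D -> Fa D -> Fb D ->
  (forall t, D t -> is_derive G t (g t)) ->
  (forall t, D t -> continuous g t) ->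
  (forall t, D t -> continuous f t) ->
  (forall t, D t -> Rabs (f t) <= g t) ->
  filterlim G Fa (locally la) -> filterlim G Fb (locally lb) ->
  ex_RInt_gen f Fa Fb.
Proof.
  intros HD Da Db HG Hg Hf Hfg Hla Hlb.
  assert (Ei : forall a b, D a -> D b -> ex_RInt f a b).
  { intros a b Pa Pb. apply (@ex_RInt_continuous R_CompleteNormedModule). intros t Ht. apply Hf. exact (HD a b t Pa Pb Ht). }
  assert (Bi : forall a b, D a -> D b -> Rabs (RInt f a b) <= Rabs (G b - G a)).
  { assert (Bi' : forall a b, a <= b -> D a -> D b -> Rabs (RInt f a b) <= Rabs (G b - G a)).
    { intros a b Hab Pa Pb.
      assert (HDt : forall t, a <= t <= b -> D t).
      { intros t Ht. apply (HD a b t Pa Pb). rewrite Rmin_left, Rmax_right; lra. }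
      assert (Hi : is_RInt g a b (G b - G a)).
      { apply (is_RInt_derive G); intros t Ht; [apply HG|apply Hg]; exact (HD a b t Pa Pb Ht). }
      apply Rle_trans with (G b - G a); [|apply Rle_abs].
      apply (norm_RInt_le f g a b (RInt f a b) (G b - G a)); trivial.
      - intros t Ht. apply Hfg, HDt, Ht.
      - apply (@RInt_correct R_CompleteNormedModule). now apply Ei. }
    intros a b Pa Pb. destruct (Rle_dec a b) as [H|H]; [now apply Bi'|].
    rewrite <- (opp_RInt_swap f) by now apply Ei.
    change (Rabs (- RInt f b a) <= Rabs (G b - G a)).
    rewrite Rabs_Ropp, Rabs_minus_sym. apply Bi'; trivial; lra. }
  assert (HC : exists y : R, filterlim (fun ab : R * R => RInt f (fst ab) (snd ab))
                 (filter_prod Fa Fb) (locally y)).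
  { apply (proj1 (filterlim_locally_cauchy (U := R_CompleteSpace) (fun ab : R * R => RInt f (fst ab) (snd ab)))).
    intros eps.
    (* Four values of [G] intervene, two near [la] and two near [lb]. *)
    assert (He : 0 < eps / 4) by (destruct eps; simpl; lra).
    set (e4 := mkposreal _ He).
    assert (Qa : Fa (fun t => D t /\ ball la e4 (G t))).
    { apply filter_and; trivial. apply Hla. now exists e4. }
    assert (Qb : Fb (fun t => D t /\ ball lb e4 (G t))).
    { apply filter_and; trivial. apply Hlb. now exists e4. }
    exists (fun ab => (D (fst ab) /\ ball la e4 (G (fst ab))) /\ (D (snd ab) /\ ball lb e4 (G (snd ab)))).
    split.
    - eapply Filter_prod; [exact Qa|exact Qb|]. intros x y H1 H2. simpl. tauto.
    - intros [a b] [a' b'] [[Pa Ba] [Pb Bb]] [[Pa' Ba'] [Pb' Bb']]. simpl in *.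
      change (Rabs (RInt f a' b' - RInt f a b) < eps).
      change (Rabs (G a - la) < eps / 4) in Ba. change (Rabs (G a' - la) < eps / 4) in Ba'.
      change (Rabs (G b - lb) < eps / 4) in Bb. change (Rabs (G b' - lb) < eps / 4) in Bb'.
      assert (E : RInt f a' b' - RInt f a b = RInt f a' a + RInt f b b').
      { rewrite <- (RInt_Chasles f a' a b') by (apply Ei; trivial).
        rewrite <- (RInt_Chasles f a b b') by (apply Ei; trivial).
        unfold plus; simpl. ring. }
      rewrite E. apply Rle_lt_trans with (1 := Rabs_triang _ _).
      generalize (Bi a' a Pa' Pa) (Bi b b' Pb Pb').
      revert Ba Ba' Bb Bb'. unfold Rabs.
      repeat (destruct Rcase_abs); lra. }
  destruct HC as [y Hy]. exists y.
  apply (filterlimi_lim_ext_loc (fun ab => RInt f (fst ab) (snd ab))); [|exact Hy].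
  exists D D; [exact Da|exact Db|]. intros a b Pa Pb. simpl.
  apply (@RInt_correct R_CompleteNormedModule). now apply Ei.
Qed.

(** * Integrals over the half-line *)

Definition int0 (f : R -> R) : R := RInt_gen f (at_point 0) (Rbar_locally p_infty).
Definition is_int0 (f : R -> R) (v : R) : Prop := is_RInt_gen f (at_point 0) (Rbar_locally p_infty) v.
Definition ex_int0 (f : R -> R) : Prop := exists v, is_int0 f v.

Lemma is_int0_unique f v : is_int0 f v -> int0 f = v.
Proof. intros H. apply (is_RInt_gen_unique f v H). Qed.

Lemma int0_correct f : ex_int0 f -> is_int0 f (int0 f).
Proof. intros [v Hv]. now rewrite (is_int0_unique f v Hv). Qed.

Lemma filter_prod_ge0 (P : R * R -> Prop) :
  (forall b, 0 < b -> P (0, b)) -> filter_prod (at_point 0) (Rbar_locally p_infty) P.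
Proof.
  intros H. exists (fun a => a = 0) (fun b => 0 < b).
  - reflexivity.
  - apply p_infty_gt.
  - intros a b Ha Hb. rewrite Ha. now apply H.
Qed.

Lemma is_int0_ext (f g : R -> R) v :
  (forall u, 0 < u -> f u = g u) -> is_int0 f v -> is_int0 g v.
Proof.
  intros H. apply is_RInt_gen_ext. apply filter_prod_ge0. intros b Hb x; simpl.
  rewrite Rmin_left, Rmax_right by lra. intros Hx. apply H. lra.
Qed.

Lemma is_int0_plus f g a b : is_int0 f a -> is_int0 g b -> is_int0 (fun u => f u + g u) (a + b).
Proof. exact (is_RInt_gen_plus f g a b). Qed.

Lemma is_int0_minus f g a b : is_int0 f a -> is_int0 g b -> is_int0 (fun u => f u - g u) (a - b).
Proof. exact (is_RInt_gen_minus f g a b). Qed.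

Lemma is_int0_scal k f a : is_int0 f a -> is_int0 (fun u => k * f u) (k * a).
Proof. exact (is_RInt_gen_scal f k a). Qed.

Lemma is_int0_zero : is_int0 (fun _ => 0) 0.
Proof.
  cut (is_int0 (fun _ => 0) (0 - 0)). { now rewrite Rminus_0_r. }
  apply (is_RInt_gen_antiderivative _ _ (fun t => 0 <= t) (fun _ => 0) (fun _ => 0)).
  - apply convex_ge0.
  - apply at_point_ge0.
  - apply p_infty_ge0.
  - intros; apply @is_derive_const.
  - intros; apply continuous_const.
  - exact (filterlim_const 0).
  - exact (filterlim_const 0).
Qed.

Lemma is_int0_Rabs_le (f g : R -> R) a b :
  (forall u, 0 <= u -> Rabs (f u) <= g u) -> is_int0 f a -> is_int0 g b -> Rabs a <= b.
Proof.
  intros H Ha Hb.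
  apply (RInt_gen_norm (Fa := at_point 0) (Fb := Rbar_locally p_infty) f g a b); trivial.
  - apply filter_prod_ge0. simpl. intros; lra.
  - apply filter_prod_ge0. simpl. intros b0 Hb0 x Hx. apply H. lra.
Qed.

(* [logk s u = O(sqrt (1 + u))], so this dominates [f u * logk s u] whenever [f u = O((1 + u)^(-2))]. *)
Definition majorant (u : R) : R := / ((1 + u) * sqrt (1 + u)).

Lemma continuous_majorant u : 0 <= u -> continuous majorant u.
Proof.
  intros Hu. apply (ex_derive_continuous majorant). unfold majorant.
  assert (0 < sqrt (1 + u)) by (apply sqrt_lt_R0; lra).
  auto_derive. split; [lra|]. split; [|trivial].
  apply Rgt_not_eq, Rmult_lt_0_compat; lra.
Qed.

Lemma is_derive_majorant u : 0 <= u -> is_derive (fun t => - 2 / sqrt (1 + t)) u (majorant u).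
Proof.
  intros Hu. assert (Hs : 0 < sqrt (1 + u)) by (apply sqrt_lt_R0; lra).
  auto_derive. { split; [lra|]. split; [lra|trivial]. }
  unfold majorant.
  replace ((1 + u) * sqrt (1 + u)) with (sqrt (1 + u) * sqrt (1 + u) * sqrt (1 + u)).
  2: { rewrite sqrt_def by lra. ring. }
  field. lra.
Qed.

Lemma majorant_lim : filterlim (fun t => - 2 / sqrt (1 + t)) (Rbar_locally p_infty) (locally 0).
Proof.
  apply filterlim_locally. intros [eps He]. exists ((2 / eps) ^ 2). intros x Hx.
  assert (H2 : 0 < 2 / eps) by (apply Rdiv_lt_0_compat; lra).
  assert (Hx2 : 2 / eps < sqrt (1 + x)).
  { rewrite <- (sqrt_pow2 (2 / eps)) by lra. apply sqrt_lt_1; nra. }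
  change (Rabs (- 2 / sqrt (1 + x) - 0) < eps).
  replace (- 2 / sqrt (1 + x) - 0) with (- (2 / sqrt (1 + x))) by (field; lra).
  rewrite Rabs_Ropp, Rabs_pos_eq by (apply Rlt_le, Rdiv_lt_0_compat; lra).
  apply (Rmult_lt_reg_r (sqrt (1 + x))); [lra|].
  replace (2 / sqrt (1 + x) * sqrt (1 + x)) with (eps * (2 / eps)) by (field; lra).
  apply Rmult_lt_compat_l; lra.
Qed.

Lemma is_int0_majorant : is_int0 majorant 2.
Proof.
  replace 2 with (0 - (- 2 / sqrt (1 + 0))).
  2: { rewrite Rplus_0_r, sqrt_1. field. }
  apply (is_RInt_gen_antiderivative _ _ (fun t => 0 <= t) majorant (fun t => - 2 / sqrt (1 + t))).
  - apply convex_ge0.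
  - apply at_point_ge0.
  - apply p_infty_ge0.
  - apply is_derive_majorant.
  - apply continuous_majorant.
  - intros P [e He]. apply He. apply ball_center.
  - apply majorant_lim.
Qed.

Lemma ex_int0_dominated (f : R -> R) (K : R) :
  (forall u, 0 <= u -> continuous f u) ->
  (forall u, 0 <= u -> Rabs (f u) <= K * majorant u) -> ex_int0 f.
Proof.
  intros Hf Hb.
  apply (ex_RInt_gen_dominated _ _ (fun t => 0 <= t) f (fun t => K * majorant t)
           (fun t => K * (- 2 / sqrt (1 + t))) (K * (- 2 / sqrt (1 + 0))) (K * 0)); trivial.
  - apply convex_ge0.
  - apply at_point_ge0.
  - apply p_infty_ge0.
  - intros t Ht. apply (is_derive_scal (fun t => - 2 / sqrt (1 + t)) t K). now apply is_derive_majorant.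
  - intros t Ht. apply (continuous_scal_r K majorant). now apply continuous_majorant.
  - intros P [e He]. apply He. apply ball_center.
  - eapply filterlim_comp; [apply majorant_lim|apply (filterlim_scal_r K 0)].
Qed.

Lemma int0_dominated (f : R -> R) (K v : R) :
  (forall u, 0 <= u -> Rabs (f u) <= K * majorant u) -> is_int0 f v -> Rabs v <= K * 2.
Proof.
  intros Hb Hv. apply (is_int0_Rabs_le f (fun u => K * majorant u)); trivial.
  apply is_int0_scal, is_int0_majorant.
Qed.

(** * Logarithmic integrals *)

(** The mean value theorem, applied to [f] and then to [f1]. The constant is not sharp, but the
    bound depends only on [B], so it can be integrated over a parameter or passed to a limit;
    [is_derive_quadratic] then recovers the derivative. *)
Lemma quadratic_remainder (f f1 f2 : R -> R) (x h B : R) :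
  (forall t, Rabs (t - x) <= Rabs h -> is_derive f t (f1 t)) ->
  (forall t, Rabs (t - x) <= Rabs h -> is_derive f1 t (f2 t)) ->
  (forall t, Rabs (t - x) <= Rabs h -> Rabs (f2 t) <= B) ->
  Rabs (f (x + h) - f x - h * f1 x) <= B * h ^ 2.
Proof.
  intros H1 H2 HB.
  assert (E : x + h - x = h) by ring.
  destruct (MVT_cor4 f f1 x (Rabs h) H1 (x + h)) as [c [Ec Hc]]; [rewrite E; lra|].
  rewrite E in Ec, Hc.
  destruct (MVT_cor4 f1 f2 x (Rabs h) H2 c) as [d [Ed Hd]]; [lra|].
  replace (f (x + h) - f x - h * f1 x) with (f2 d * ((c - x) * h)) by (rewrite Ec; replace (f1 c) with (f1 x + f2 d * (c - x)) by lra; ring).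
  rewrite Rabs_mult.
  apply Rmult_le_compat; try apply Rabs_pos.
  - apply HB. lra.
  - rewrite Rabs_mult, <- (pow2_abs h). simpl. rewrite Rmult_1_r.
    apply Rmult_le_compat_r; [apply Rabs_pos|lra].
Qed.

Lemma is_derive_quadratic (f : R -> R) (x l B d : R) :
  0 < d ->
  (forall h, Rabs h <= d -> Rabs (f (x + h) - f x - h * l) <= B * h ^ 2) ->
  is_derive f x l.
Proof.
  intros Hd H. apply is_derive_Reals. intros eps Heps.
  assert (HB : 0 < Rabs B + 1) by (generalize (Rabs_pos B); lra).
  assert (Hm : 0 < Rmin d (eps / (Rabs B + 1))).
  { apply Rmin_glb_lt; [lra|]. apply Rdiv_lt_0_compat; lra. }
  exists (mkposreal _ Hm). simpl. intros h Hh0 Hh.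
  assert (Hh1 : Rabs h <= d) by (apply Rlt_le, Rlt_le_trans with (1 := Hh), Rmin_l).
  assert (Hh2 : Rabs h < eps / (Rabs B + 1)) by (apply Rlt_le_trans with (1 := Hh), Rmin_r).
  assert (Hah : 0 < Rabs h) by (now apply Rabs_pos_lt).
  replace ((f (x + h) - f x) / h - l) with ((f (x + h) - f x - h * l) / h) by (field; trivial).
  unfold Rdiv. rewrite Rabs_mult, Rabs_inv.
  apply (Rmult_lt_reg_r (Rabs h)); trivial.
  rewrite Rmult_assoc, Rinv_l, Rmult_1_r by lra.
  apply Rle_lt_trans with (1 := H h Hh1).
  apply Rle_lt_trans with ((Rabs B + 1) * (Rabs h * Rabs h)).
  - rewrite <- Rabs_mult. replace (h * h) with (h ^ 2) by ring. rewrite (Rabs_pos_eq (h ^ 2)) by apply pow2_ge_0.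
    apply Rmult_le_compat_r; [apply pow2_ge_0|]. generalize (Rle_abs B); lra.
  - rewrite <- Rmult_assoc. apply Rmult_lt_compat_r; trivial.
    apply (Rmult_lt_compat_l (Rabs B + 1)) in Hh2; trivial.
    replace ((Rabs B + 1) * (eps / (Rabs B + 1))) with eps in Hh2 by (field; lra). lra.
Qed.

(** Differentiation under the integral sign: the Taylor remainder of the integrand is at most
    [K * majorant u * h ^ 2], and integrating this gives a quadratic remainder for [I]. *)
Lemma is_derive_int0 (phi phi1 phi2 : R -> R -> R) (I : R -> R) (J s K d : R) :
  0 < d ->
  (forall t u, Rabs (t - s) <= d -> 0 <= u -> is_derive (fun t => phi t u) t (phi1 t u)) ->
  (forall t u, Rabs (t - s) <= d -> 0 <= u -> is_derive (fun t => phi1 t u) t (phi2 t u)) ->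
  (forall t u, Rabs (t - s) <= d -> 0 <= u -> Rabs (phi2 t u) <= K * majorant u) ->
  (forall t, Rabs (t - s) <= d -> is_int0 (phi t) (I t)) ->
  is_int0 (phi1 s) J ->
  is_derive I s J.
Proof.
  intros Hd H1 H2 HK HI HJ.
  apply (is_derive_quadratic I s J (K * 2) d Hd). intros h Hh.
  apply (is_int0_Rabs_le (fun u => phi (s + h) u - phi s u - h * phi1 s u)
           (fun u => (K * majorant u) * h ^ 2)).
  - intros u Hu.
    apply (quadratic_remainder (fun t => phi t u) (fun t => phi1 t u) (fun t => phi2 t u));
      intros t Ht; [apply H1|apply H2|apply HK]; trivial; lra.
  - apply is_int0_minus; [apply is_int0_minus|].
    + apply HI. now replace (s + h - s) with h by ring.
    + apply HI. rewrite Rminus_diag, Rabs_R0. lra.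
    + now apply is_int0_scal.
  - replace (K * 2 * h ^ 2) with (h ^ 2 * (K * 2)) by ring.
    eapply is_int0_ext; [|apply is_int0_scal, is_int0_scal, is_int0_majorant].
    intros u _. simpl. ring.
Qed.

(** [s] stands for 1/y. In this parameter the kernel vanishes at s = 0, which supplies the constant
    of integration when differentiating in [s]. *)
Definition logk (s u : R) : R := ln (1 + (s * u) ^ 2).

Lemma logk_pos s u : 0 <= logk s u.
Proof.
  unfold logk. rewrite <- ln_1. generalize (pow2_ge_0 (s * u)); intros H.
  apply ln_le; lra.
Qed.

Lemma ln_le_sub1 x : 0 < x -> ln x <= x - 1.
Proof.
  intros Hx. generalize (exp_ineq1_le (ln x)). rewrite exp_ln by trivial. lra.
Qed.

Lemma ln_ge_1_sub_inv x : 0 < x -> 1 - / x <= ln x.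
Proof.
  intros Hx. generalize (ln_le_sub1 (/ x) (Rinv_0_lt_compat _ Hx)). rewrite ln_Rinv by trivial. lra.
Qed.

(** With r = sqrt(su), 1 + r^4 <= (1 + r)^4 and ln(1 + r) <= r. Growth of order sqrt(u) leaves
    (1+u)^(-3/2) after multiplication by a kernel O((1+u)^(-2)), and the factor sqrt(s) gives the
    decay as s tends to 0. *)
Lemma logk_bound s u : 0 <= s -> 0 <= u -> logk s u <= 4 * sqrt s * sqrt (1 + u).
Proof.
  intros Hs Hu. set (r := sqrt (s * u)).
  assert (Hr : 0 <= r) by apply sqrt_pos.
  assert (Er : r * r = s * u) by (apply sqrt_def, Rmult_le_pos; lra).
  apply Rle_trans with (4 * r).
  - unfold logk. rewrite <- Er.
    apply Rle_trans with (ln ((1 + r) ^ 4)).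
    + apply ln_le; [generalize (pow2_ge_0 (r * r)); lra|].
      assert (0 <= r * r) by nra. assert (0 <= r * r * r) by nra. simpl. nra.
    + rewrite Rcomplements.ln_pow by lra. simpl INR.
      generalize (ln_le_sub1 (1 + r)); lra.
  - unfold r. rewrite sqrt_mult by lra. rewrite Rmult_assoc.
    apply Rmult_le_compat_l; [lra|].
    apply Rmult_le_compat_l; [apply sqrt_pos|]. apply sqrt_le_1; lra.
Qed.

Lemma mul_logk_dominated (s A u v : R) :
  0 <= s -> 0 <= u -> Rabs v <= A / (1 + u) ^ 2 -> Rabs (v * logk s u) <= A * (4 * sqrt s) * majorant u.
Proof.
  intros Hs Hu Hv.
  assert (H1 : 0 < sqrt (1 + u)) by (apply sqrt_lt_R0; lra).
  rewrite Rabs_mult, (Rabs_pos_eq (logk s u)) by apply logk_pos.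
  apply Rle_trans with (A / (1 + u) ^ 2 * (4 * sqrt s * sqrt (1 + u))).
  - apply Rmult_le_compat; trivial; [apply Rabs_pos|apply logk_pos|now apply logk_bound].
  - apply Req_le. unfold majorant.
    assert (E : sqrt (1 + u) / (1 + u) ^ 2 = / ((1 + u) * sqrt (1 + u))).
    { assert (Q : sqrt (1 + u) * sqrt (1 + u) = 1 + u) by (apply sqrt_def; lra).
      apply (Rmult_eq_reg_r ((1 + u) * sqrt (1 + u) * (1 + u))); [|apply Rgt_not_eq; apply Rmult_lt_0_compat; [apply Rmult_lt_0_compat|]; lra].
      transitivity (sqrt (1 + u) * sqrt (1 + u)); [field; lra|rewrite Q; field; split; lra]. }
    rewrite <- E. field. lra.
Qed.

Lemma continuous_logk s u : continuous (logk s) u.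
Proof.
  apply (ex_derive_continuous (logk s)). unfold logk. auto_derive.
  generalize (pow2_ge_0 (s * u)); simpl; lra.
Qed.

Lemma ex_int0_mul_logk (f : R -> R) (s A : R) :
  0 <= s -> (forall u, 0 <= u -> continuous f u) ->
  (forall u, 0 <= u -> Rabs (f u) <= A / (1 + u) ^ 2) ->
  ex_int0 (fun u => f u * logk s u).
Proof.
  intros Hs Hf HA. apply (ex_int0_dominated _ (A * (4 * sqrt s))).
  - intros u Hu. apply (continuous_mult f (logk s)); [now apply Hf|apply continuous_logk].
  - intros u Hu. now apply mul_logk_dominated; [| |apply HA].
Qed.

Lemma atan_lim_p_infty : filterlim atan (Rbar_locally p_infty) (locally (PI / 2)).
Proof.
  apply filterlim_ext_loc with (fun u => PI / 2 - atan (/ u)).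
  - exists 0. intros u Hu. rewrite atan_inv by trivial. ring.
  - assert (Hinv : is_lim (fun u => / u) p_infty 0).
    { apply (is_lim_inv (fun u => u) p_infty p_infty); [apply is_lim_id|discriminate]. }
    assert (Hc : continuous (fun v => PI / 2 - atan v) 0).
    { apply (ex_derive_continuous (fun v => PI / 2 - atan v)). auto_derive. trivial. }
    pose proof (filterlim_comp _ _ _ _ _ _ _ _ Hinv Hc) as H. cbv beta in H.
    rewrite atan_0, Rminus_0_r in H. exact H.
Qed.

Lemma atan_lim_p (c : R) : 0 < c ->
  filterlim (fun u => atan (c * u)) (Rbar_locally p_infty) (locally (PI / 2)).
Proof.
  intros Hc. apply (filterlim_comp _ _ _ (fun u => c * u) atan _ (Rbar_locally p_infty)).
  - intros P [M HM]. exists (M / c). intros x Hx. apply HM.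
    apply (Rmult_lt_compat_l c) in Hx; trivial.
    now replace (c * (M / c)) with M in Hx by (field; lra).
  - exact atan_lim_p_infty.
Qed.

(** The integrand is the s-derivative of [b / (b ^ 2 + u ^ 2) * logk s u]. Away from b s = 1,
    partial fractions give a combination of atan(su) and atan(u/b) as antiderivative. *)
Lemma lorentz_log_kernel_integral (b s : R) : 0 < b -> 0 < s ->
  is_int0 (fun u => b / (b ^ 2 + u ^ 2) * (2 * s * u ^ 2 / (1 + (s * u) ^ 2))) (PI * b / (1 + b * s)).
Proof.
  intros Hb Hs.
  assert (P1 : forall u, 0 < b ^ 2 + u ^ 2) by (intros u; generalize (pow2_ge_0 u) (pow_lt b 2 Hb); lra).
  assert (P2 : forall u, 0 < 1 + (s * u) ^ 2) by (intros u; generalize (pow2_ge_0 (s * u)); lra).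
  assert (Hbs : 0 < b * s) by nra.
  assert (Hc : forall t, 0 <= t -> continuous (fun u => b / (b ^ 2 + u ^ 2) * (2 * s * u ^ 2 / (1 + (s * u) ^ 2))) t).
  { intros t _. apply (ex_derive_continuous (fun u => b / (b ^ 2 + u ^ 2) * (2 * s * u ^ 2 / (1 + (s * u) ^ 2)))).
    generalize (P1 t) (P2 t); intros h1 h2; simpl in h1, h2. auto_derive. split; [lra|]. split; [lra|trivial]. }
  assert (L1 : filterlim (fun u => atan (s * u)) (Rbar_locally p_infty) (locally (PI / 2))) by now apply atan_lim_p.
  assert (L2 : filterlim (fun u => atan (/ b * u)) (Rbar_locally p_infty) (locally (PI / 2))).
  { apply atan_lim_p. now apply Rinv_0_lt_compat. }
  destruct (Req_dec (b * s) 1) as [E|E].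
  - (* The two quadratic factors of the denominator are proportional: no partial fractions. *)
    assert (Es : s = / b) by (apply (Rmult_eq_reg_l b); [rewrite E; field|]; lra).
    replace (PI * b / (1 + b * s)) with (b * (PI / 2) - b ^ 2 * 0 - 0) by (rewrite E; field).
    apply (is_RInt_gen_antiderivative _ _ (fun t => 0 <= t) _
             (fun u => b * atan (/ b * u) - b ^ 2 * (u / (b ^ 2 + u ^ 2)))); trivial.
    + apply convex_ge0.
    + apply at_point_ge0.
    + apply p_infty_ge0.
    + intros t _. generalize (P1 t) (P2 t); intros h1 h2. rewrite Es in h2 |- *. auto_derive.
      { simpl in h1. repeat split; lra. }
      field. simpl in h1. nra.
    + intros P [e He]. apply He.
      replace (b * atan (/ b * 0) - b ^ 2 * (0 / (b ^ 2 + 0 ^ 2))) with 0 by (rewrite Rmult_0_r, atan_0; field; simpl; nra).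
      apply ball_center.
    + assert (L3 : is_lim (fun u => u / (b ^ 2 + u ^ 2)) p_infty 0).
      { apply (is_lim_le_le_loc (fun _ => 0) (fun u => / u)).
        - exists 0. intros u Hu. generalize (P1 u); intros h1. split.
          + apply Rlt_le, Rdiv_lt_0_compat; lra.
          + apply (Rmult_le_reg_r (u * (b ^ 2 + u ^ 2))); [nra|].
            replace (u / (b ^ 2 + u ^ 2) * (u * (b ^ 2 + u ^ 2))) with (u ^ 2) by (field; lra).
            replace (/ u * (u * (b ^ 2 + u ^ 2))) with (b ^ 2 + u ^ 2) by (field; lra).
            generalize (pow2_ge_0 b); lra.
        - apply is_lim_const.
        - apply (is_lim_inv (fun u => u) p_infty p_infty); [apply is_lim_id|discriminate]. }
      assert (L4 : is_lim (fun u => b * atan (/ b * u) - b ^ 2 * (u / (b ^ 2 + u ^ 2))) p_infty (b * (PI / 2) - b ^ 2 * 0)).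
      { apply is_lim_minus'; [apply (is_lim_scal_l _ b p_infty (PI / 2)), L2|apply (is_lim_scal_l _ (b ^ 2) p_infty 0), L3]. }
      exact L4.
  - assert (E2 : 1 - b ^ 2 * s ^ 2 <> 0).
    { intros H. assert ((1 - b * s) * (1 + b * s) = 0) by (rewrite <- H; ring).
      apply Rmult_integral in H0. destruct H0; lra. }
    set (c := 2 * b * s / (1 - b ^ 2 * s ^ 2)).
    replace (PI * b / (1 + b * s)) with (c * (PI / 2 / s - b * (PI / 2)) - 0).
    2: { unfold c. field. repeat split; try lra; nra. }
    apply (is_RInt_gen_antiderivative _ _ (fun t => 0 <= t) _
             (fun u => c * (atan (s * u) / s - b * atan (/ b * u)))); trivial.
    + apply convex_ge0.
    + apply at_point_ge0.
    + apply p_infty_ge0.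
    + intros t _. generalize (P1 t) (P2 t); intros h1 h2. auto_derive; [trivial|].
      unfold c. field. repeat split; try lra; try nra.
    + intros P [e He]. apply He.
      replace (c * (atan (s * 0) / s - b * atan (/ b * 0))) with 0 by (rewrite !Rmult_0_r, atan_0; field; lra).
      apply ball_center.
    + assert (L4 : is_lim (fun u => c * (atan (s * u) / s - b * atan (/ b * u))) p_infty (c * (PI / 2 / s - b * (PI / 2)))).
      { apply (is_lim_scal_l _ c p_infty (PI / 2 / s - b * (PI / 2))).
        apply is_lim_minus'; [apply (is_lim_scal_r _ (/ s) p_infty (PI / 2)), L1|apply (is_lim_scal_l _ b p_infty (PI / 2)), L2]. }
      exact L4.
Qed.

Lemma one_plus_le (b u : R) : 0 < b -> 0 <= u -> 1 + u <= (1 + / b) * (b + u).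
Proof.
  intros Hb Hu. assert (0 < / b) by now apply Rinv_0_lt_compat.
  replace ((1 + / b) * (b + u)) with (1 + u + b + / b * u) by (field; lra). nra.
Qed.

(** Combine 1 + u <= (1 + 1/b)(b + u) with (b + u)^2 <= 2(b^2 + u^2). *)
Lemma lorentz_bound (b u : R) : 0 < b -> 0 <= u -> / (b ^ 2 + u ^ 2) <= 2 * (1 + / b) ^ 2 / (1 + u) ^ 2.
Proof.
  intros Hb Hu. assert (Hi : 0 < / b) by now apply Rinv_0_lt_compat.
  generalize (one_plus_le b u Hb Hu). set (k := 1 + / b). intros Hk.
  assert (Hk1 : 1 < k) by (unfold k; lra).
  assert (Hp : 0 < b ^ 2 + u ^ 2) by nra.
  assert (Hq : 0 < (1 + u) ^ 2) by nra.
  apply (Rmult_le_reg_r ((b ^ 2 + u ^ 2) * (1 + u) ^ 2)); [now apply Rmult_lt_0_compat|].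
  replace (/ (b ^ 2 + u ^ 2) * ((b ^ 2 + u ^ 2) * (1 + u) ^ 2)) with ((1 + u) ^ 2) by (field; lra).
  replace (2 * k ^ 2 / (1 + u) ^ 2 * ((b ^ 2 + u ^ 2) * (1 + u) ^ 2)) with (k ^ 2 * (2 * (b ^ 2 + u ^ 2))) by (field; lra).
  apply Rle_trans with ((k * (b + u)) ^ 2).
  - apply pow_incr. lra.
  - rewrite Rpow_mult_distr. apply Rmult_le_compat_l; [apply pow2_ge_0|].
    generalize (pow2_ge_0 (b - u)). lra.
Qed.

Lemma continuous_lorentz (b u : R) : 0 < b -> continuous (fun u => b / (b ^ 2 + u ^ 2)) u.
Proof.
  intros Hb. apply (ex_derive_continuous (fun u => b / (b ^ 2 + u ^ 2))).
  auto_derive. nra.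
Qed.

Lemma ex_lorentz_logk (b s : R) : 0 < b -> 0 <= s ->
  ex_int0 (fun u => b / (b ^ 2 + u ^ 2) * logk s u).
Proof.
  intros Hb Hs. apply (ex_int0_mul_logk _ s (b * (2 * (1 + / b) ^ 2))); trivial.
  - intros u _. now apply continuous_lorentz.
  - intros u Hu. rewrite Rabs_pos_eq.
    + unfold Rdiv. rewrite Rmult_assoc. apply Rmult_le_compat_l; [lra|]. now apply lorentz_bound.
    + apply Rlt_le, Rdiv_lt_0_compat; nra.
Qed.

Definition lorentz_log (b s : R) : R := int0 (fun u => b / (b ^ 2 + u ^ 2) * logk s u).

(** The derivative in [s] is computed only for s > 0; this bound gives the limit 0 as s tends to 0
    and so fixes the constant of integration. *)
Lemma lorentz_log_small (b s : R) : 0 < b -> 0 <= s ->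
  Rabs (lorentz_log b s) <= b * (2 * (1 + / b) ^ 2) * 8 * sqrt s.
Proof.
  intros Hb Hs.
  replace (b * (2 * (1 + / b) ^ 2) * 8 * sqrt s) with (b * (2 * (1 + / b) ^ 2) * (4 * sqrt s) * 2) by ring.
  eapply int0_dominated; [|apply int0_correct, ex_lorentz_logk; trivial].
  intros u Hu. apply mul_logk_dominated; trivial.
  rewrite Rabs_pos_eq.
  - unfold Rdiv. rewrite Rmult_assoc. apply Rmult_le_compat_l; [lra|]. now apply lorentz_bound.
  - apply Rlt_le, Rdiv_lt_0_compat; nra.
Qed.

Lemma is_derive_lorentz_log (b s : R) : 0 < b -> 0 < s ->
  is_derive (lorentz_log b) s (PI * b / (1 + b * s)).
Proof.
  intros Hb Hs.
  apply (is_derive_int0 (fun s u => b / (b ^ 2 + u ^ 2) * logk s u)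
     (fun s u => b / (b ^ 2 + u ^ 2) * (2 * s * u ^ 2 / (1 + (s * u) ^ 2)))
     (fun s u => b / (b ^ 2 + u ^ 2) * (2 * u ^ 2 * (1 - (s * u) ^ 2) / (1 + (s * u) ^ 2) ^ 2))
     (lorentz_log b) _ s (b * (2 * (1 + / b) ^ 2) * (2 / (s / 2) ^ 2)) (s / 2)); try lra.
  - intros t u Ht Hu. unfold logk.
    assert (P2 : 0 < 1 + (t * u) ^ 2) by (generalize (pow2_ge_0 (t * u)); lra).
    assert (P1 : 0 < b ^ 2 + u ^ 2) by nra.
    auto_derive. { simpl in P2. lra. } field. simpl in P1, P2. lra.
  - intros t u Ht Hu.
    assert (P2 : 0 < 1 + (t * u) ^ 2) by (generalize (pow2_ge_0 (t * u)); lra).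
    assert (P1 : 0 < b ^ 2 + u ^ 2) by nra.
    auto_derive. { simpl in P1, P2. repeat split; lra. } field. simpl in P1, P2. lra.
  - intros t u Ht Hu. apply Rabs_le_between in Ht.
    assert (P2 : 0 < 1 + (t * u) ^ 2) by (generalize (pow2_ge_0 (t * u)); lra).
    assert (P1 : 0 < b ^ 2 + u ^ 2) by nra.
    rewrite Rabs_mult, Rabs_pos_eq by (apply Rlt_le, Rdiv_lt_0_compat; lra).
    (* The radius s/2 keeps t >= s/2, so that u^2 / (1 + (tu)^2) <= 1/t^2 <= 1/(s/2)^2. *)
    assert (Hq : Rabs (2 * u ^ 2 * (1 - (t * u) ^ 2) / (1 + (t * u) ^ 2) ^ 2) <= 2 / (s / 2) ^ 2).
    { assert (Hst : (s / 2) ^ 2 <= t ^ 2) by (apply pow_incr; lra).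
      assert (Hs2 : 0 < (s / 2) ^ 2) by (apply pow_lt; lra).
      unfold Rdiv at 1. rewrite Rabs_mult, (Rabs_pos_eq (/ _)) by (apply Rlt_le, Rinv_0_lt_compat, pow_lt; lra).
      rewrite Rabs_mult, (Rabs_pos_eq (2 * u ^ 2)) by (generalize (pow2_ge_0 u); lra).
      apply Rle_trans with (2 * u ^ 2 * (1 + (t * u) ^ 2) * / (1 + (t * u) ^ 2) ^ 2).
      - apply Rmult_le_compat_r; [apply Rlt_le, Rinv_0_lt_compat, pow_lt; lra|].
        apply Rmult_le_compat_l; [generalize (pow2_ge_0 u); lra|].
        generalize (pow2_ge_0 (t * u)); intros. apply Rabs_le_between. lra.
      - apply (Rmult_le_reg_r ((1 + (t * u) ^ 2) * (s / 2) ^ 2)); [nra|].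
        replace (2 * u ^ 2 * (1 + (t * u) ^ 2) * / (1 + (t * u) ^ 2) ^ 2 * ((1 + (t * u) ^ 2) * (s / 2) ^ 2))
          with (2 * (u ^ 2 * (s / 2) ^ 2)) by (field; lra).
        replace (2 / (s / 2) ^ 2 * ((1 + (t * u) ^ 2) * (s / 2) ^ 2)) with (2 * (1 + u ^ 2 * t ^ 2)) by (field; lra).
        generalize (Rmult_le_compat_l (u ^ 2) _ _ (pow2_ge_0 u) Hst). lra. }
    apply Rle_trans with (b / (b ^ 2 + u ^ 2) * (2 / (s / 2) ^ 2)).
    + apply Rmult_le_compat_l; trivial. apply Rlt_le, Rdiv_lt_0_compat; lra.
    + assert (Hm : / (b ^ 2 + u ^ 2) <= 2 * (1 + / b) ^ 2 * majorant u).
      { apply Rle_trans with (1 := lorentz_bound b u Hb Hu).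
        apply Rmult_le_compat_l; [generalize (pow2_ge_0 (1 + / b)); lra|].
        unfold majorant. assert (1 <= sqrt (1 + u)) by (rewrite <- sqrt_1 at 1; apply sqrt_le_1; lra).
        assert (sqrt (1 + u) * sqrt (1 + u) = 1 + u) by (apply sqrt_def; lra).
        apply Rinv_le_contravar; [nra|]. simpl. rewrite Rmult_1_r. apply Rmult_le_compat_l; nra. }
      unfold Rdiv.
      replace (b * (2 * (1 + / b) ^ 2) * (2 * / (s * / 2) ^ 2) * majorant u) with
        (b * (2 * (1 + / b) ^ 2 * majorant u) * (2 * / (s * / 2) ^ 2)) by ring.
      apply Rmult_le_compat_r.
      { apply Rmult_le_pos; [lra|]. apply Rlt_le, Rinv_0_lt_compat, pow_lt; lra. }
      apply Rmult_le_compat_l; lra.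
  - intros t Ht. apply Rabs_le_between in Ht. apply int0_correct, ex_lorentz_logk; lra.
  - now apply lorentz_log_kernel_integral.
Qed.

(** The difference of the two sides has derivative 0 on s > 0, hence is constant there, and it tends
    to 0 at 0. *)
Lemma lorentz_logE (b s : R) : 0 < b -> 0 < s -> lorentz_log b s = PI * ln (1 + b * s).
Proof.
  intros Hb Hs.
  set (d := fun t => lorentz_log b t - PI * ln (1 + b * t)).
  assert (Hd : forall t, 0 < t -> is_derive d t 0).
  { intros t Ht. unfold d.
    replace 0 with (PI * b / (1 + b * t) - PI * (b / (1 + b * t))) by (field; nra).
    apply (is_derive_minus (lorentz_log b) (fun t => PI * ln (1 + b * t))).
    - now apply is_derive_lorentz_log.
    - auto_derive; [nra|]. field. nra. }
  assert (Hc : forall t, 0 < t -> t < s -> d s = d t).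
  { intros t Ht Hts.
    destruct (MVT_gen d t s (fun _ => 0)) as [c [_ E]].
    - intros z Hz. rewrite Rmin_left in Hz by lra. apply Hd. lra.
    - intros z Hz. rewrite Rmin_left in Hz by lra.
      apply continuity_pt_filterlim. apply (ex_derive_continuous d). exists 0. apply Hd. lra.
    - lra. }
  set (A := b * (2 * (1 + / b) ^ 2) * 8).
  assert (HA : 0 <= A) by (unfold A; assert (0 <= (1 + / b) ^ 2) by apply pow2_ge_0; nra).
  assert (Hd0 : d s = 0).
  (* If [d s] were nonzero, some small t would satisfy A sqrt(t) + PI b t < |d s|, although this
     quantity bounds |d t| = |d s|. The two signs are refuted in parallel. *)
  { apply Rle_antisym; apply Rnot_lt_le; intros H.
    all: assert (Hl : is_lim (fun t => A * sqrt t + PI * (b * t)) 0 (A * sqrt 0 + PI * (b * 0))).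
    1, 3: apply (is_lim_continuity (fun t => A * sqrt t + PI * (b * t)));
      apply continuity_pt_plus;
      [apply continuity_pt_mult; [apply continuity_pt_const; now intros ? ?|apply continuity_pt_sqrt; lra]
      |apply continuity_pt_filterlim; apply (ex_derive_continuous (fun t => PI * (b * t))); auto_derive; trivial].
    all: rewrite sqrt_0, !Rmult_0_r, Rplus_0_r in Hl.
    all: apply is_lim_spec in Hl.
    all: assert (He : 0 < Rabs (d s)) by (apply Rabs_pos_lt; lra).
    all: destruct (Hl (mkposreal _ He)) as [del Hdel]; simpl in Hdel.
    all: set (t := Rmin (del / 2) (s / 2)).
    all: assert (Ht : 0 < t) by (apply Rmin_glb_lt; [destruct del; simpl; lra|lra]).
    all: assert (Ht1 : t <= del / 2) by apply Rmin_l.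
    all: assert (Ht2 : t <= s / 2) by apply Rmin_r.
    all: assert (Hb1 : Rabs (d t) <= A * sqrt t + PI * (b * t)).
    1, 3: unfold d; apply Rle_trans with (1 := Rabs_triang _ _); apply Rplus_le_compat;
       [apply lorentz_log_small; lra|];
       rewrite Rabs_Ropp, Rabs_mult, Rabs_pos_eq by (generalize PI_RGT_0; lra);
       apply Rmult_le_compat_l; [generalize PI_RGT_0; lra|];
       assert (0 < b * t) by nra;
       rewrite Rabs_pos_eq by (rewrite <- ln_1; apply ln_le; lra);
       generalize (ln_le_sub1 (1 + b * t)); lra.
    all: rewrite <- (Hc t) in Hb1 by lra.
    all: assert (Hb2 : Rabs (A * sqrt t + PI * (b * t) - 0) < Rabs (d s)).
    1, 3: apply Hdel; [change (Rabs (t - 0) < del); rewrite Rminus_0_r, Rabs_pos_eq by lra; destruct del; simpl in *; lra|lra].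
    all: rewrite Rminus_0_r in Hb2; generalize (Rle_abs (A * sqrt t + PI * (b * t))); lra. }
  unfold d in Hd0. lra.
Qed.

(** * Inverse powers of b + iu and their logarithmic integrals *)

Lemma Cpair_neq0 (b u : R) : 0 < b -> (b, u) <> RtoC 0.
Proof. intros Hb H. injection H. lra. Qed.

Lemma Cmod_pair_lower (b u : R) : 0 < b -> (b + Rabs u) / 2 <= Cmod (b, u).
Proof.
  intros Hb. generalize (Rmax_Cmod (b, u)). simpl.
  generalize (Rmax_l (Rabs b) (Rabs u)) (Rmax_r (Rabs b) (Rabs u)).
  rewrite (Rabs_pos_eq b) by lra. lra.
Qed.

Lemma Cmod_pair_upper (b u : R) : 0 < b -> Cmod (b, u) <= b + Rabs u.
Proof.
  intros Hb. unfold Cmod; simpl fst; simpl snd. generalize (Rabs_pos u); intros Hu.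
  rewrite <- (sqrt_pow2 (b + Rabs u)) by lra. apply sqrt_le_1_alt.
  rewrite <- (pow2_abs u). nra.
Qed.

Lemma Cmod_inv_pair (b u : R) : 0 < b -> Cmod (/ (b, u))%C <= 2 / (b + Rabs u).
Proof.
  intros Hb. generalize (Rabs_pos u); intros Hu.
  rewrite Cmod_inv by now apply Cpair_neq0.
  replace (2 / (b + Rabs u)) with (/ ((b + Rabs u) / 2)) by (field; lra).
  apply Rinv_le_contravar; [lra|now apply Cmod_pair_lower].
Qed.

(** The components are treated together because the product rule in the induction step mixes real
    and imaginary parts. *)
Lemma is_derive_Cinv_pow (u : R) (k : nat) (b : R) : 0 < b ->
  is_derive (fun b => Re ((/ (b, u)) ^ k)%C) b (- INR k * Re ((/ (b, u)) ^ S k)%C) /\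
  is_derive (fun b => Im ((/ (b, u)) ^ k)%C) b (- INR k * Im ((/ (b, u)) ^ S k)%C).
Proof.
  intros Hb.
  assert (P : 0 < b ^ 2 + u ^ 2) by nra.
  assert (D1 : is_derive (fun b => Re (/ (b, u))%C) b (- Re ((/ (b, u)) * (/ (b, u)))%C)).
  { unfold Cinv, Cmult, Re, Im; simpl fst; simpl snd. auto_derive; [simpl in P; lra|].
    field. simpl in P; lra. }
  assert (D2 : is_derive (fun b => Im (/ (b, u))%C) b (- Im ((/ (b, u)) * (/ (b, u)))%C)).
  { unfold Cinv, Cmult, Re, Im; simpl fst; simpl snd. auto_derive; [simpl in P; lra|].
    field. simpl in P; lra. }
  induction k as [|k [IH1 IH2]].
  - simpl. replace (-0) with 0 by ring. rewrite !Rmult_0_l.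
    split; apply @is_derive_const.
  - rewrite S_INR.
    assert (ER : forall x y : C, Re (x * y) = Re x * Re y - Im x * Im y) by (intros [? ?] [? ?]; reflexivity).
    assert (EI : forall x y : C, Im (x * y) = Re x * Im y + Im x * Re y) by (intros [? ?] [? ?]; reflexivity).
    split.
    + apply is_derive_ext with (fun b => Re (/ (b, u))%C * Re ((/ (b, u)) ^ k)%C - Im (/ (b, u))%C * Im ((/ (b, u)) ^ k)%C).
      { intros t. simpl Cpow. now rewrite ER. }
      match goal with |- is_derive _ _ ?v => replace v with
        ((- Re ((/ (b, u)) * (/ (b, u)))%C * Re ((/ (b, u)) ^ k)%C + Re (/ (b, u))%C * (- INR k * Re ((/ (b, u)) ^ S k)%C))
       - (- Im ((/ (b, u)) * (/ (b, u)))%C * Im ((/ (b, u)) ^ k)%C + Im (/ (b, u))%C * (- INR k * Im ((/ (b, u)) ^ S k)%C))) end.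
      2: { simpl Cpow. rewrite ?ER, ?EI, ?ER. ring. }
      apply (is_derive_minus (fun b => Re (/ (b, u))%C * Re ((/ (b, u)) ^ k)%C) (fun b => Im (/ (b, u))%C * Im ((/ (b, u)) ^ k)%C)).
      * apply (is_derive_mult (fun b => Re (/ (b, u))%C) (fun b => Re ((/ (b, u)) ^ k)%C)); trivial. exact Rmult_comm.
      * apply (is_derive_mult (fun b => Im (/ (b, u))%C) (fun b => Im ((/ (b, u)) ^ k)%C)); trivial. exact Rmult_comm.
    + apply is_derive_ext with (fun b => Re (/ (b, u))%C * Im ((/ (b, u)) ^ k)%C + Im (/ (b, u))%C * Re ((/ (b, u)) ^ k)%C).
      { intros t. simpl Cpow. now rewrite EI. }
      match goal with |- is_derive _ _ ?v => replace v with
        ((- Re ((/ (b, u)) * (/ (b, u)))%C * Im ((/ (b, u)) ^ k)%C + Re (/ (b, u))%C * (- INR k * Im ((/ (b, u)) ^ S k)%C))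
       + (- Im ((/ (b, u)) * (/ (b, u)))%C * Re ((/ (b, u)) ^ k)%C + Im (/ (b, u))%C * (- INR k * Re ((/ (b, u)) ^ S k)%C))) end.
      2: { simpl Cpow. rewrite ?ER, ?EI, ?ER. ring. }
      apply (is_derive_plus (fun b => Re (/ (b, u))%C * Im ((/ (b, u)) ^ k)%C) (fun b => Im (/ (b, u))%C * Re ((/ (b, u)) ^ k)%C)).
      * apply (is_derive_mult (fun b => Re (/ (b, u))%C) (fun b => Im ((/ (b, u)) ^ k)%C)); trivial. exact Rmult_comm.
      * apply (is_derive_mult (fun b => Im (/ (b, u))%C) (fun b => Re ((/ (b, u)) ^ k)%C)); trivial. exact Rmult_comm.
Qed.

Lemma Cpow_sub_le (x y : C) (B : R) (k : nat) :
  Cmod x <= B -> Cmod y <= B -> Cmod (x ^ S k - y ^ S k)%C <= INR (S k) * B ^ k * Cmod (x - y)%C.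
Proof.
  intros Hx Hy.
  assert (HB : 0 <= B) by (generalize (Cmod_ge_0 x); lra).
  induction k as [|k IH].
  - simpl. rewrite !Cmult_1_r. lra.
  - replace (x ^ S (S k) - y ^ S (S k))%C with (x * (x ^ S k - y ^ S k) + (x - y) * y ^ S k)%C by (simpl; ring).
    apply Rle_trans with (1 := Cmod_triangle _ _). rewrite !Cmod_mult, Cmod_pow.
    apply Rle_trans with (B * (INR (S k) * B ^ k * Cmod (x - y)) + Cmod (x - y) * B ^ S k).
    + apply Rplus_le_compat.
      * apply Rmult_le_compat; trivial; apply Cmod_ge_0.
      * apply Rmult_le_compat_l; [apply Cmod_ge_0|]. apply pow_incr. split; [apply Cmod_ge_0|trivial].
    + apply Req_le. rewrite !S_INR. simpl. ring.
Qed.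

Lemma lipschitz_continuous (f : R -> R) (u L : R) :
  (forall t, Rabs (f t - f u) <= L * Rabs (t - u)) -> continuous f u.
Proof.
  intros H. apply filterlim_locally. intros [eps He].
  assert (HL : 0 < Rabs L + 1) by (generalize (Rabs_pos L); lra).
  assert (Hd : 0 < eps / (Rabs L + 1)) by now apply Rdiv_lt_0_compat.
  exists (mkposreal _ Hd). intros t Ht.
  change (Rabs (t - u) < eps / (Rabs L + 1)) in Ht. change (Rabs (f t - f u) < eps).
  apply Rle_lt_trans with (1 := H t).
  apply Rle_lt_trans with ((Rabs L + 1) * Rabs (t - u)).
  - apply Rmult_le_compat_r; [apply Rabs_pos|]. generalize (Rle_abs L); lra.
  - replace eps with ((Rabs L + 1) * (eps / (Rabs L + 1))) by (field; lra).
    now apply Rmult_lt_compat_l.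
Qed.

Lemma Cinv_sub (x y : C) : x <> RtoC 0 -> y <> RtoC 0 -> (/ x - / y = (y - x) * (/ x * / y))%C.
Proof. intros; field; split; trivial. Qed.

Lemma Cinv_pow_lipschitz (b t u : R) (k : nat) : 0 < b ->
  Cmod ((/ (b, t)) ^ k - (/ (b, u)) ^ k)%C <= INR k * (2 / b) ^ S k * Rabs (t - u).
Proof.
  intros Hb.
  assert (Hq : forall z, Cmod (/ (b, z))%C <= 2 / b).
  { intros z. apply Rle_trans with (1 := Cmod_inv_pair b z Hb). generalize (Rabs_pos z); intros.
    apply Rmult_le_compat_l; [lra|]. apply Rinv_le_contravar; lra. }
  assert (Hb2 : 0 <= 2 / b) by (apply Rlt_le, Rdiv_lt_0_compat; lra).
  destruct k as [|k].
  - replace ((/ (b, t)) ^ 0 - (/ (b, u)) ^ 0)%C with (RtoC 0) by (simpl; ring).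
    rewrite Cmod_0. simpl. rewrite !Rmult_0_l. lra.
  - apply Rle_trans with (1 := Cpow_sub_le _ _ (2 / b) k (Hq t) (Hq u)).
    rewrite Cinv_sub by now apply Cpair_neq0.
    rewrite !Cmod_mult.
    replace ((b, u) - (b, t))%C with (- (Ci * RtoC (t - u)))%C by (apply injective_projections; simpl; ring).
    rewrite Cmod_opp, Cmod_mult, Cmod_Ci, Cmod_R.
    replace (INR (S k) * (2 / b) ^ S (S k) * Rabs (t - u)) with
      (INR (S k) * (2 / b) ^ k * (1 * Rabs (t - u) * (2 / b * (2 / b)))) by (simpl; ring).
    apply Rmult_le_compat_l; [apply Rmult_le_pos; [apply pos_INR|apply pow_le; trivial]|].
    apply Rmult_le_compat_l; [rewrite Rmult_1_l; apply Rabs_pos|].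
    apply Rmult_le_compat; trivial; apply Cmod_ge_0.
Qed.

Lemma continuous_Re_Cinv_pow (b u : R) (k : nat) : 0 < b -> continuous (fun u => Re ((/ (b, u)) ^ k)%C) u.
Proof.
  intros Hb. apply (lipschitz_continuous _ u (INR k * (2 / b) ^ S k)). intros t.
  apply Rle_trans with (2 := Cinv_pow_lipschitz b t u k Hb).
  apply Rle_trans with (2 := re_le_Cmod _). apply Req_le. f_equal.
Qed.

(** Two of the factors supply the decay (1+u)^(-2); the other [k] are only bounded. The lower bound
    [beta] makes the estimate uniform in [b], as differentiation in [b] requires. *)
Lemma Cinv_pow_bound (beta b u : R) (k : nat) : 0 < beta <= b -> 0 <= u ->
  Cmod ((/ (b, u)) ^ (2 + k))%C <= (2 / beta) ^ k * (4 * (1 + / beta) ^ 2) / (1 + u) ^ 2.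
Proof.
  intros [Hbeta Hb] Hu. rewrite Cmod_pow, pow_add.
  assert (Hq := Cmod_inv_pair b u ltac:(lra)). rewrite (Rabs_pos_eq u Hu) in Hq.
  assert (H1 : Cmod (/ (b, u))%C <= 2 * (1 + / beta) / (1 + u)).
  { apply Rle_trans with (1 := Hq).
    apply (Rmult_le_reg_r ((b + u) * (1 + u))); [nra|].
    replace (2 / (b + u) * ((b + u) * (1 + u))) with (2 * (1 + u)) by (field; lra).
    replace (2 * (1 + / beta) / (1 + u) * ((b + u) * (1 + u))) with (2 * ((1 + / beta) * (b + u))) by (field; lra).
    apply Rmult_le_compat_l; [lra|].
    apply Rle_trans with (1 := one_plus_le beta u Hbeta Hu).
    apply Rmult_le_compat_l; [|lra]. generalize (Rinv_0_lt_compat _ Hbeta); lra. }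
  assert (H2 : Cmod (/ (b, u))%C <= 2 / beta).
  { apply Rle_trans with (1 := Hq). apply Rmult_le_compat_l; [lra|]. apply Rinv_le_contravar; lra. }
  replace ((2 / beta) ^ k * (4 * (1 + / beta) ^ 2) / (1 + u) ^ 2) with
    ((2 * (1 + / beta) / (1 + u)) ^ 2 * (2 / beta) ^ k) by (field; lra).
  apply Rmult_le_compat; try (apply pow_le, Cmod_ge_0); apply pow_incr; split; trivial; apply Cmod_ge_0.
Qed.

Lemma ex_Cinv_pow_logk (b s : R) (k : nat) : 0 < b -> 0 <= s ->
  ex_int0 (fun u => Re ((/ (b, u)) ^ (2 + k))%C * logk s u).
Proof.
  intros Hb Hs. apply (ex_int0_mul_logk _ s ((2 / b) ^ k * (4 * (1 + / b) ^ 2))); trivial.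
  - intros u _. now apply continuous_Re_Cinv_pow.
  - intros u Hu. apply Rle_trans with (1 := re_le_Cmod _). apply Cinv_pow_bound; lra.
Qed.

Lemma Re_Cinv_pair (b u : R) : Re ((/ (b, u)) ^ 1)%C = b / (b ^ 2 + u ^ 2).
Proof. simpl Cpow. rewrite Cmult_1_r. reflexivity. Qed.

(** The exponent is [S k], so that k = 0 is the kernel b/(b^2+u^2) of [lorentz_log] and each [k]
    arises from the previous one by differentiation in [b]. *)
Definition power_log (k : nat) (b s : R) : R := int0 (fun u => Re ((/ (b, u)) ^ S k)%C * logk s u).

Lemma is_power_log (k : nat) (b s : R) : 0 < b -> 0 <= s ->
  is_int0 (fun u => Re ((/ (b, u)) ^ S k)%C * logk s u) (power_log k b s).
Proof.
  intros Hb Hs. apply int0_correct. destruct k as [|k].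
  - destruct (ex_lorentz_logk b s Hb Hs) as [v Hv]. exists v.
    eapply is_int0_ext; [|exact Hv]. intros u _. cbv beta. now rewrite Re_Cinv_pair.
  - now apply ex_Cinv_pow_logk.
Qed.

Lemma is_derive_power_log (k : nat) (b s : R) : 0 < b -> 0 <= s ->
  is_derive (fun b => power_log k b s) b (- INR (S k) * power_log (S k) b s).
Proof.
  intros Hb Hs.
  apply (is_derive_int0 (fun b u => Re ((/ (b, u)) ^ S k)%C * logk s u)
     (fun b u => - INR (S k) * (Re ((/ (b, u)) ^ S (S k))%C * logk s u))
     (fun b u => INR (S k) * INR (S (S k)) * (Re ((/ (b, u)) ^ (2 + S k))%C * logk s u))
     _ _ b (INR (S k) * INR (S (S k)) * ((2 / (b / 2)) ^ S k * (4 * (1 + / (b / 2)) ^ 2) * (4 * sqrt s))) (b / 2)); try lra.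
  - intros t u Ht Hu. apply Rabs_le_between in Ht.
    rewrite <- Rmult_assoc.
    apply (is_derive_ext (fun t => logk s u * Re ((/ (t, u)) ^ S k)%C)); [intros; apply Rmult_comm|].
    rewrite (Rmult_comm _ (logk s u)).
    apply (is_derive_scal (fun t => Re ((/ (t, u)) ^ S k)%C)). apply is_derive_Cinv_pow. lra.
  - intros t u Ht Hu. apply Rabs_le_between in Ht.
    apply (is_derive_ext (fun t => - INR (S k) * logk s u * Re ((/ (t, u)) ^ S (S k))%C)); [intros v; match goal with |- @eq _ ?a ?b => change (@eq R a b) end; rewrite Rmult_assoc; f_equal; apply Rmult_comm|].
    replace (INR (S k) * INR (S (S k)) * (Re ((/ (t, u)) ^ (2 + S k))%C * logk s u)) with
      (- INR (S k) * logk s u * (- INR (S (S k)) * Re ((/ (t, u)) ^ S (S (S k)))%C)) by (change (2 + S k)%nat with (S (S (S k))); generalize (INR (S k)) (INR (S (S k))); intros; ring).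
    apply (is_derive_scal (fun t => Re ((/ (t, u)) ^ S (S k))%C)). apply is_derive_Cinv_pow. lra.
  - intros t u Ht Hu. apply Rabs_le_between in Ht.
    rewrite Rabs_mult, Rabs_pos_eq by (apply Rmult_le_pos; apply pos_INR).
    rewrite (Rmult_assoc (INR (S k) * INR (S (S k)))). apply Rmult_le_compat_l; [apply Rmult_le_pos; apply pos_INR|].
    apply mul_logk_dominated; trivial.
    apply Rle_trans with (1 := re_le_Cmod _). apply Cinv_pow_bound; lra.
  - intros t Ht. apply Rabs_le_between in Ht. apply is_power_log; lra.
  - apply is_int0_scal. now apply is_power_log.
Qed.

Lemma power_log0 (b s : R) : 0 < b -> 0 < s -> power_log 0 b s = PI * ln (1 + b * s).
Proof.
  intros Hb Hs. rewrite <- lorentz_logE by trivial. apply is_int0_unique.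
  eapply is_int0_ext; [|apply int0_correct, ex_lorentz_logk; [exact Hb|apply Rlt_le, Hs]].
  intros u _. cbv beta. now rewrite Re_Cinv_pair.
Qed.

(** Uniqueness of derivatives: the derivative of a closed form at level [k] must agree with the one
    computed under the integral sign, and the factor -(k+1) cancels. *)
Lemma power_log_derive_step (k : nat) (s : R) (F dF : R -> R) :
  0 < s -> (forall b, 0 < b -> power_log k b s = F b) ->
  (forall b, 0 < b -> is_derive F b (- INR (S k) * dF b)) ->
  forall b, 0 < b -> power_log (S k) b s = dF b.
Proof.
  intros Hs HF HdF b Hb.
  assert (D : is_derive (fun b => power_log k b s) b (- INR (S k) * dF b)).
  { apply (is_derive_ext_loc F); [|now apply HdF].
    exists (mkposreal b Hb). intros t Ht. change (Rabs (t - b) < b) in Ht. apply Rabs_lt_between in Ht.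
    symmetry. apply HF. lra. }
  apply is_derive_unique in D.
  generalize (is_derive_unique _ _ _ (is_derive_power_log k b s Hb (Rlt_le _ _ Hs))). rewrite D.
  intros E. apply Rmult_eq_reg_l in E; [now symmetry|]. rewrite S_INR. generalize (pos_INR k). lra.
Qed.

Lemma power_logE (k : nat) (b y : R) : 0 < b -> 0 < y ->
  power_log (S k) b (/ y) = - (PI / INR (S k)) * / (b + y) ^ S k.
Proof.
  intros Hb Hy. assert (Hs : 0 < / y) by now apply Rinv_0_lt_compat.
  revert b Hb. induction k as [|k IH].
  - apply (power_log_derive_step 0 (/ y) (fun b => PI * ln (1 + b * / y))); trivial.
    + intros b Hb. now apply power_log0.
    + intros b Hb. auto_derive; [nra|]. simpl. field. repeat split; nra.
  - apply (power_log_derive_step (S k) (/ y) _ (fun b => - (PI / INR (S (S k))) * / (b + y) ^ S (S k)) Hs IH).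
    intros b Hb. assert (N1 := not_0_INR (S k) ltac:(lia)). assert (N2 := not_0_INR (S (S k)) ltac:(lia)).
    assert (N3 : (b + y) ^ k <> 0) by (apply pow_nonzero; lra).
    auto_derive.
    + apply (pow_nonzero (b + y) (S k)); lra.
    + 
      change (match k with O => 1 | S _ => INR k + 1 end) with (INR (S k)) in *.
      change (pow (b + y) (S k)) with ((b + y) * (b + y) ^ k). simpl pow.
      generalize dependent (INR (S k)). generalize dependent (INR (S (S k))). intros.
      field. repeat split; trivial; lra.
Qed.

(** * Series and componentwise limits of complex sequences *)

Fixpoint rsum (f : nat -> R) (M : nat) : R :=
  match M with O => 0 | S k => rsum f k + f k end.

Fixpoint csum (f : nat -> C) (M : nat) : C :=
  match M with O => RtoC 0 | S k => (csum f k + f k)%C end.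

Lemma rsum_sum_n f M : rsum f (S M) = sum_n f M.
Proof.
  induction M as [|M IH].
  - rewrite sum_O. simpl. ring.
  - rewrite sum_Sn, <- IH. reflexivity.
Qed.

Lemma Re_csum f M : Re (csum f M) = rsum (fun n => Re (f n)) M.
Proof. induction M as [|M IH]; simpl; [reflexivity|]. now rewrite <- IH. Qed.

Lemma Im_csum f M : Im (csum f M) = rsum (fun n => Im (f n)) M.
Proof. induction M as [|M IH]; simpl; [reflexivity|]. now rewrite <- IH. Qed.

Lemma rsum_ext f g M : (forall n, f n = g n) -> rsum f M = rsum g M.
Proof. intros H. induction M as [|M IH]; simpl; [reflexivity|]. now rewrite IH, H. Qed.

Lemma csum_ext f g M : (forall n, f n = g n) -> csum f M = csum g M.
Proof. intros H. induction M as [|M IH]; simpl; [reflexivity|]. now rewrite IH, H. Qed.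

Lemma rsum_telescope (x tau : nat -> R) M :
  (forall n, x n <= tau n - tau (S n)) -> rsum x M <= tau 0%nat - tau M.
Proof.
  intros H. induction M as [|M IH]; simpl; [lra|]. generalize (H M); lra.
Qed.

Lemma rsum_nonneg_cvg (x : nat -> R) (B : R) :
  (forall n, 0 <= x n) -> (forall M, rsum x M <= B) -> ex_finite_lim_seq (rsum x).
Proof.
  intros Hx HB. apply (ex_finite_lim_seq_incr _ B); trivial.
  intros n. simpl. generalize (Hx n); lra.
Qed.

Lemma is_series_rsum (x : nat -> R) (v : R) : is_series x v <-> is_lim_seq (rsum x) v.
Proof.
  split.
  - intros H. apply is_lim_seq_incr_1. apply is_lim_seq_ext with (sum_n x); [|exact H].
    intros n. symmetry. apply rsum_sum_n.
  - intros H. apply is_lim_seq_incr_1 in H. apply is_lim_seq_ext with (2 := H).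
    intros n. apply rsum_sum_n.
Qed.

Lemma rsum_abs_cvg (x : nat -> R) (B : R) :
  (forall M, rsum (fun n => Rabs (x n)) M <= B) -> is_lim_seq (rsum x) (Series x).
Proof.
  intros HB. apply is_series_rsum, Series_correct, ex_series_Rabs.
  destruct (rsum_nonneg_cvg (fun n => Rabs (x n)) B) as [v Hv]; trivial.
  { intros; apply Rabs_pos. }
  exists v. now apply is_series_rsum.
Qed.

(** Since (c+1)/c <= 1 + 1/a, 1/c^2 is at most (1 + 1/a) times 1/c - 1/(c+1). Such telescoping
    differences take the place of integral comparison in all series bounds. *)
Lemma inv_sq_telescope (a c : R) : 0 < a <= c ->
  / c ^ 2 <= (1 + / a) * / c - (1 + / a) * / (c + 1).
Proof.
  intros [Ha Hc].
  replace ((1 + / a) * / c - (1 + / a) * / (c + 1)) with ((1 + / a) / (c * (c + 1))) by (field; lra).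
  apply (Rmult_le_reg_r (c ^ 2 * (c + 1))); [nra|].
  replace (/ c ^ 2 * (c ^ 2 * (c + 1))) with (c + 1) by (field; lra).
  replace ((1 + / a) / (c * (c + 1)) * (c ^ 2 * (c + 1))) with (c + c / a) by (field; lra).
  assert (1 <= c / a) by (apply (Rmult_le_reg_r a); [lra|]; replace (c / a * a) with c by (field; lra); lra). lra.
Qed.

Lemma inv_cube_telescope (a c : R) : 0 < a <= c ->
  / c ^ 3 <= (1 + / a) ^ 2 * / c ^ 2 - (1 + / a) ^ 2 * / (c + 1) ^ 2.
Proof.
  intros [Ha Hc].
  assert (H1 : c + 1 <= (1 + / a) * c).
  { replace ((1 + / a) * c) with (c + c / a) by (field; lra).
    assert (1 <= c / a) by (apply (Rmult_le_reg_r a); [lra|]; replace (c / a * a) with c by (field; lra); lra). lra. }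
  set (k := 1 + / a) in *.
  replace (k ^ 2 * / c ^ 2 - k ^ 2 * / (c + 1) ^ 2) with (k ^ 2 * (2 * c + 1) / (c ^ 2 * (c + 1) ^ 2)) by (field; lra).
  apply (Rmult_le_reg_r (c ^ 3 * (c + 1) ^ 2)). { apply Rmult_lt_0_compat; apply pow_lt; lra. }
  replace (/ c ^ 3 * (c ^ 3 * (c + 1) ^ 2)) with ((c + 1) ^ 2) by (field; lra).
  replace (k ^ 2 * (2 * c + 1) / (c ^ 2 * (c + 1) ^ 2) * (c ^ 3 * (c + 1) ^ 2)) with (k ^ 2 * (c * (2 * c + 1))) by (field; lra).
  apply Rle_trans with ((k * c) ^ 2).
  - apply pow_incr; lra.
  - rewrite Rpow_mult_distr. apply Rmult_le_compat_l; [apply pow2_ge_0|]. nra.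
Qed.

Lemma rsum_inv_sq (a : R) (M : nat) : 0 < a -> rsum (fun n => / (a + INR n) ^ 2) M <= (1 + / a) * / a.
Proof.
  intros Ha. assert (Hi : 0 < / a) by now apply Rinv_0_lt_compat.
  apply Rle_trans with ((1 + / a) * / (a + INR 0) - (1 + / a) * / (a + INR M)).
  - apply (rsum_telescope _ (fun n => (1 + / a) * / (a + INR n))). intros n.
    rewrite S_INR, <- Rplus_assoc. apply inv_sq_telescope. generalize (pos_INR n); lra.
  - simpl INR. rewrite Rplus_0_r.
    assert (0 < / (a + INR M)) by (apply Rinv_0_lt_compat; generalize (pos_INR M); lra). nra.
Qed.

Lemma inv_pow_le (a c : R) (i j : nat) : 0 < a <= c -> / c ^ (i + j) <= / a ^ i * / c ^ j.
Proof.
  intros [Ha Hc]. rewrite pow_add, Rinv_mult.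
  apply Rmult_le_compat_r; [apply Rlt_le, Rinv_0_lt_compat, pow_lt; lra|].
  apply Rinv_le_contravar; [now apply pow_lt|]. apply pow_incr; lra.
Qed.

Lemma rsum_le f g M : (forall n, f n <= g n) -> rsum f M <= rsum g M.
Proof. intros H. induction M as [|M IH]; simpl; [lra|]. generalize (H M); lra. Qed.

Lemma rsum_scal k f M : rsum (fun n => k * f n) M = k * rsum f M.
Proof. induction M as [|M IH]; simpl; [ring|]. rewrite IH; ring. Qed.

(** Componentwise, to match [hurwitz_zeta], which sums the real and imaginary parts separately. *)
Definition Clim (F : nat -> C) (z : C) : Prop :=
  is_lim_seq (fun n => Re (F n)) (Re z) /\ is_lim_seq (fun n => Im (F n)) (Im z).

Lemma Clim_ext F G z : (forall n, F n = G n) -> Clim F z -> Clim G z.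
Proof.
  intros H [H1 H2]. split; [apply is_lim_seq_ext with (2 := H1)|apply is_lim_seq_ext with (2 := H2)];
    intros n; now rewrite H.
Qed.

Lemma Clim_const z : Clim (fun _ => z) z.
Proof. split; apply is_lim_seq_const. Qed.

Lemma Clim_plus F G z w : Clim F z -> Clim G w -> Clim (fun n => F n + G n)%C (z + w)%C.
Proof.
  intros [H1 H2] [H3 H4]. split; [exact (is_lim_seq_plus' _ _ _ _ H1 H3)|exact (is_lim_seq_plus' _ _ _ _ H2 H4)].
Qed.

Lemma Clim_mult F G z w : Clim F z -> Clim G w -> Clim (fun n => F n * G n)%C (z * w)%C.
Proof.
  intros [H1 H2] [H3 H4].
  split; [apply (is_lim_seq_minus' (fun n => Re (F n) * Re (G n)) (fun n => Im (F n) * Im (G n)))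
         |apply (is_lim_seq_plus' (fun n => Re (F n) * Im (G n)) (fun n => Im (F n) * Re (G n)))];
    apply is_lim_seq_mult'; trivial.
Qed.

Lemma Cmod_le_Re_Im (z : C) : Cmod z <= Rabs (Re z) + Rabs (Im z).
Proof.
  generalize (Rabs_pos (Re z)) (Rabs_pos (Im z)); intros H1 H2.
  rewrite <- (sqrt_pow2 (Rabs (Re z) + Rabs (Im z))) by lra.
  apply sqrt_le_1_alt. change (fst z) with (Re z). change (snd z) with (Im z).
  rewrite <- (pow2_abs (Re z)), <- (pow2_abs (Im z)). nra.
Qed.

Lemma im_le_Cmod (z : C) : Rabs (Im z) <= Cmod z.
Proof. generalize (Rmax_Cmod z) (Rmax_r (Rabs (fst z)) (Rabs (snd z))). unfold Im. lra. Qed.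

Lemma is_lim_seq_Rabs_le (f : nat -> R) (v B : R) (M : nat) :
  (forall n, (M <= n)%nat -> Rabs (f n) <= B) -> is_lim_seq f v -> Rabs v <= B.
Proof.
  intros H Hv. apply is_lim_seq_abs in Hv.
  apply (is_lim_seq_le_loc (fun n => Rabs (f n)) (fun _ => B) (Rbar_abs v) B) in Hv; trivial.
  - exists M. exact H.
  - apply is_lim_seq_const.
Qed.

(** The factor 2 comes from bounding each component of the limit by [B] and adding; constants are
    never sharp in what follows. *)
Lemma Clim_Cmod_le F z B M : (forall n, (M <= n)%nat -> Cmod (F n) <= B) -> Clim F z -> Cmod z <= 2 * B.
Proof.
  intros H [H1 H2]. apply Rle_trans with (1 := Cmod_le_Re_Im z).
  assert (Rabs (Re z) <= B).
  { eapply is_lim_seq_Rabs_le; [|exact H1]. intros n Hn. apply Rle_trans with (2 := H n Hn). apply re_le_Cmod. }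
  assert (Rabs (Im z) <= B).
  { eapply is_lim_seq_Rabs_le; [|exact H2]. intros n Hn. apply Rle_trans with (2 := H n Hn). apply im_le_Cmod. }
  lra.
Qed.

(** Increments dominated by decrements of a nonnegative [tau] keep every later term within [tau M]
    of [F M]. This turns a local comparison of a sum with an integral into an error bound for the
    whole tail. *)
Lemma Clim_telescope (F : nat -> C) (z : C) (tau : nat -> R) (M : nat) :
  (forall n, 0 <= tau n) ->
  (forall n, Cmod (F (S n) - F n)%C <= tau n - tau (S n)) ->
  Clim F z -> Cmod (z - F M)%C <= 2 * tau M.
Proof.
  intros Ht HF Hz.
  assert (Hd : forall k, Cmod (F (M + k)%nat - F M)%C <= tau M - tau (M + k)%nat).
  { induction k as [|k IH].
    - rewrite Nat.add_0_r. replace (F M - F M)%C with (RtoC 0) by ring. rewrite Cmod_0. lra.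
    - rewrite Nat.add_succ_r.
      replace (F (S (M + k)) - F M)%C with ((F (S (M + k)) - F (M + k)%nat) + (F (M + k)%nat - F M))%C by ring.
      apply Rle_trans with (1 := Cmod_triangle _ _). generalize (HF (M + k)%nat); lra. }
  apply (Clim_Cmod_le (fun n => F n + - F M)%C (z - F M)%C (tau M) M).
  - intros n Hn. replace n with (M + (n - M))%nat by lia.
    apply Rle_trans with (1 := Hd (n - M)%nat). generalize (Ht (M + (n - M))%nat). lra.
  - apply Clim_plus; [exact Hz|apply Clim_const].
Qed.

Lemma Clim_Cmod0 (F : nat -> C) (b : nat -> R) :
  (forall n, Cmod (F n) <= b n) -> is_lim_seq b 0 -> Clim F (RtoC 0).
Proof.
  intros H Hb. split; apply is_lim_seq_abs_0; apply (is_lim_seq_le_le (fun _ => 0) _ b); trivial;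
    try apply is_lim_seq_const; intros n; split; try apply Rabs_pos; apply Rle_trans with (2 := H n).
  - apply re_le_Cmod.
  - apply im_le_Cmod.
Qed.

(** * The Hurwitz zeta function on a vertical line *)

Lemma Cpown_pow (z : C) (n : nat) : Cpown z n = (z ^ n)%C.
Proof. induction n as [|n IH]; simpl; [reflexivity|]. now rewrite IH. Qed.

Lemma hurwitz_termE (s n : nat) (a u : R) : 0 < a ->
  hurwitz_term s (a, u) n = ((/ ((a + INR n)%R, u)) ^ s)%C.
Proof.
  intros Ha. unfold hurwitz_term. rewrite Cpown_pow.
  replace (RtoC (INR n) + (a, u))%C with ((a + INR n)%R, u) by (apply injective_projections; simpl; ring).
  symmetry. apply Cpow_inv. apply Cpair_neq0. generalize (pos_INR n); lra.
Qed.

Lemma Cinv_shift_bound (a u : R) (n : nat) : 0 < a ->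
  Cmod (/ ((a + INR n)%R, u))%C <= 2 / (a + Rabs u + INR n).
Proof.
  intros Ha. replace (a + Rabs u + INR n) with (a + INR n + Rabs u) by ring.
  apply Cmod_inv_pair. generalize (pos_INR n); lra.
Qed.

Lemma Cinv_shift_bound0 (a u : R) (n : nat) : 0 < a ->
  Cmod (/ ((a + INR n)%R, u))%C <= 2 / (a + INR n).
Proof.
  intros Ha. generalize (pos_INR n) (Rabs_pos u); intros.
  apply Rle_trans with (1 := Cinv_shift_bound a u n Ha).
  apply Rmult_le_compat_l; [lra|]. apply Rinv_le_contravar; lra.
Qed.

Lemma rsum_Cinv_pow (a u : R) (k M : nat) : 0 < a ->
  rsum (fun n => (2 / (a + INR n)) ^ (k + 2)) M <= 2 ^ (k + 2) * / a ^ k * ((1 + / a) * / a).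
Proof.
  intros Ha.
  apply Rle_trans with (rsum (fun n => 2 ^ (k + 2) * / a ^ k * / (a + INR n) ^ 2) M).
  - apply rsum_le. intros n. unfold Rdiv. rewrite Rpow_mult_distr, pow_inv, Rmult_assoc.
    apply Rmult_le_compat_l; [apply pow_le; lra|]. apply inv_pow_le. generalize (pos_INR n); lra.
  - rewrite rsum_scal. apply Rmult_le_compat_l; [|now apply rsum_inv_sq].
    apply Rmult_le_pos; [apply pow_le; lra|]. apply Rlt_le, Rinv_0_lt_compat, pow_lt; lra.
Qed.

Lemma Clim_hurwitz (a u : R) (r : nat) : 0 < a ->
  Clim (csum (fun n => (/ ((a + INR n)%R, u)) ^ (r + 2))%C) (hurwitz_zeta (r + 2) (a, u)).
Proof.
  intros Ha.
  assert (HB : forall n, Cmod ((/ ((a + INR n)%R, u)) ^ (r + 2))%C <= (2 / (a + INR n)) ^ (r + 2)).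
  { intros n. rewrite Cmod_pow. apply pow_incr. split; [apply Cmod_ge_0|now apply Cinv_shift_bound0]. }
  split; unfold hurwitz_zeta; simpl Re; simpl Im.
  - apply is_lim_seq_ext with (rsum (fun n => Re (hurwitz_term (r + 2) (a, u) n))).
    + intros M. rewrite Re_csum. apply rsum_ext. intros n. now rewrite hurwitz_termE.
    + apply (rsum_abs_cvg _ (2 ^ (r + 2) * / a ^ r * ((1 + / a) * / a))). intros M.
      apply Rle_trans with (2 := rsum_Cinv_pow a u r M Ha). apply rsum_le. intros n.
      rewrite hurwitz_termE by trivial. apply Rle_trans with (1 := re_le_Cmod _), HB.
  - apply is_lim_seq_ext with (rsum (fun n => Im (hurwitz_term (r + 2) (a, u) n))).
    + intros M. rewrite Im_csum. apply rsum_ext. intros n. now rewrite hurwitz_termE.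
    + apply (rsum_abs_cvg _ (2 ^ (r + 2) * / a ^ r * ((1 + / a) * / a))). intros M.
      apply Rle_trans with (2 := rsum_Cinv_pow a u r M Ha). apply rsum_le. intros n.
      rewrite hurwitz_termE by trivial. apply Rle_trans with (1 := im_le_Cmod _), HB.
Qed.

Lemma hurwitz_lipschitz (a t u : R) (r : nat) : 0 < a ->
  Cmod (hurwitz_zeta (r + 2) (a, t) - hurwitz_zeta (r + 2) (a, u))%C
    <= 2 * (INR (r + 2) * (2 ^ (S r + 2) * / a ^ S r * ((1 + / a) * / a)) * Rabs (t - u)).
Proof.
  intros Ha.
  assert (HL : Clim (fun M => csum (fun n => (/ ((a + INR n)%R, t)) ^ (r + 2))%C M
                      + - (1) * csum (fun n => (/ ((a + INR n)%R, u)) ^ (r + 2)) M)%C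
                 (hurwitz_zeta (r + 2) (a, t) - hurwitz_zeta (r + 2) (a, u))%C).
  { replace (hurwitz_zeta (r + 2) (a, t) - hurwitz_zeta (r + 2) (a, u))%C with
      (hurwitz_zeta (r + 2) (a, t) + - (1) * hurwitz_zeta (r + 2) (a, u))%C by ring.
    apply Clim_plus; [now apply Clim_hurwitz|]. apply Clim_mult; [apply Clim_const|now apply Clim_hurwitz]. }
  refine (Clim_Cmod_le _ _ _ 0 _ HL). intros M _. clear HL.
  apply Rle_trans with (INR (r + 2) * rsum (fun n => (2 / (a + INR n)) ^ (S r + 2)) M * Rabs (t - u)).
  - induction M as [|M IH].
    + simpl. replace (0 + - (1) * 0)%C with (RtoC 0) by ring. rewrite Cmod_0. lra.
    + simpl csum. simpl rsum.
      match goal with |- Cmod ?z <= _ => replace z with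
       ((csum (fun n => (/ ((a + INR n)%R, t)) ^ (r + 2))%C M + - (1) * csum (fun n => (/ ((a + INR n)%R, u)) ^ (r + 2)) M)
         + ((/ ((a + INR M)%R, t)) ^ (r + 2) - (/ ((a + INR M)%R, u)) ^ (r + 2)))%C by ring end.
      apply Rle_trans with (1 := Cmod_triangle _ _).
      rewrite Rmult_plus_distr_l, Rmult_plus_distr_r. apply Rplus_le_compat; trivial.
      apply (Cinv_pow_lipschitz (a + INR M) t u (r + 2)). generalize (pos_INR M); lra.
  - apply Rmult_le_compat_r; [apply Rabs_pos|]. apply Rmult_le_compat_l; [apply pos_INR|].
    now apply rsum_Cinv_pow.
Qed.

(** Meant for q = 1/v and r = 1/(v+1), for which q - r = q r. It compares k v^(-k-1) with the
    increment of v^(-k), that is, one term of the zeta series with the corresponding piece of the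
    integral. *)
Lemma Cpow_diff_remainder (q r : C) (B : R) (k : nat) :
  Cmod q <= B -> Cmod r <= B -> (q - r = q * r)%C ->
  Cmod (RtoC (INR k) * q ^ S k - (q ^ k - r ^ k))%C <= INR k ^ 2 * B ^ (k + 2).
Proof.
  intros Hq Hr E. assert (HB : 0 <= B) by (generalize (Cmod_ge_0 q); lra).
  induction k as [|k IH].
  - simpl. replace (0 * (q * 1) - (1 - 1))%C with (RtoC 0) by ring. rewrite Cmod_0. lra.
  - replace (RtoC (INR (S k)) * q ^ S (S k) - (q ^ S k - r ^ S k))%C with
      (q * (RtoC (INR k) * q ^ S k - (q ^ k - r ^ k)) + q * (q ^ S k - r ^ S k))%C.
    2: { rewrite S_INR, RtoC_plus. simpl.
         assert (E2 : (q * r ^ k - q * (r * r ^ k) = r * r ^ k)%C).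
         { replace (q * r ^ k - q * (r * r ^ k))%C with (r ^ k * (q - q * r))%C by ring. rewrite <- E. ring. }
         rewrite <- E2 at 2. ring. }
    apply Rle_trans with (1 := Cmod_triangle _ _). rewrite !Cmod_mult.
    assert (H1 : Cmod (q ^ S k - r ^ S k)%C <= INR (S k) * B ^ k * (B * B)).
    { apply Rle_trans with (1 := Cpow_sub_le q r B k Hq Hr). rewrite E, Cmod_mult.
      apply Rmult_le_compat_l; [apply Rmult_le_pos; [apply pos_INR|now apply pow_le]|].
      apply Rmult_le_compat; trivial; apply Cmod_ge_0. }
    apply Rle_trans with (B * (INR k ^ 2 * B ^ (k + 2)) + B * (INR (S k) * B ^ k * (B * B))).
    + apply Rplus_le_compat; apply Rmult_le_compat; trivial; apply Cmod_ge_0.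
    + replace (S k + 2)%nat with (S (S (S k))) by lia. replace (k + 2)%nat with (S (S k)) by lia.
      rewrite S_INR. simpl pow. assert (0 <= B * (B * (B * B ^ k))) by (apply (pow_le B (S (S (S k)))); trivial).
      generalize (pos_INR k). nra.
Qed.

Lemma Cinv_succ (a u : R) (n : nat) : 0 < a ->
  (/ ((a + INR n)%R, u) - / ((a + INR (S n))%R, u) = / ((a + INR n)%R, u) * / ((a + INR (S n))%R, u))%C.
Proof.
  intros Ha. rewrite Cinv_sub.
  - replace (((a + INR (S n))%R, u) - ((a + INR n)%R, u))%C with (RtoC 1).
    + ring.
    + apply injective_projections; rewrite ?S_INR; simpl; ring.
  - apply Cpair_neq0. generalize (pos_INR n); lra.
  - apply Cpair_neq0. generalize (pos_INR (S n)); lra.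
Qed.

Lemma is_lim_seq_inv_shift (K c : R) : 0 < c -> is_lim_seq (fun n => K / (c + INR n)) 0.
Proof.
  intros Hc. replace 0 with (K * 0) by ring.
  apply (is_lim_seq_scal_l _ K 0).
  apply (is_lim_seq_inv (fun n => c + INR n) p_infty); [|discriminate].
  eapply is_lim_seq_plus; [apply is_lim_seq_const|apply is_lim_seq_INR|reflexivity].
Qed.

Lemma Clim_Cinv_pow (a u : R) (k : nat) : 0 < a -> Clim (fun n => (/ ((a + INR n)%R, u)) ^ S k)%C (RtoC 0).
Proof.
  intros Ha. apply Clim_Cmod0 with (fun n => (2 / a) ^ k * 2 / (a + INR n)).
  - intros n. rewrite Cmod_pow. generalize (Cinv_shift_bound0 a u n Ha) (Cmod_ge_0 (/ ((a + INR n)%R, u))) (pos_INR n); intros H1 H2 H3.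
    replace ((2 / a) ^ k * 2 / (a + INR n)) with (2 / (a + INR n) * (2 / a) ^ k) by (unfold Rdiv; ring).
    simpl pow. apply Rmult_le_compat; trivial; [now apply pow_le|].
    apply pow_incr. split; trivial. apply Rle_trans with (1 := H1).
    apply Rmult_le_compat_l; [lra|]. apply Rinv_le_contravar; lra.
  - now apply is_lim_seq_inv_shift.
Qed.

(** The leading term w^(1-s)/(s-1) of zeta(s,w), s = r + 2, with an error of one further order in
    1/w. It must be split off because for the slowest decay only its real part is integrable. *)
Lemma hurwitz_asymptotic (a u : R) (r : nat) : 0 < a ->
  Cmod (hurwitz_zeta (r + 2) (a, u) - RtoC (/ INR (S r)) * (/ (a, u)) ^ S r)%C
    <= 2 * (INR (S r) * 2 ^ (r + 3) * (1 + / a) ^ 2) / (a + Rabs u) ^ (r + 2).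
Proof.
  intros Ha. assert (Hi : 0 < / a) by now apply Rinv_0_lt_compat.
  generalize (Rabs_pos u); intros Hu. set (p := a + Rabs u).
  assert (Hp : 0 < a <= p) by (unfold p; lra).
  assert (Nr : 0 < INR (S r)) by (apply lt_0_INR; lia).
  (* The partial sum plus the integral of (w+t)^(-r-2) over t >= M. At M = 0 this is the leading
     term, and its limit is the zeta value. *)
  set (F := fun M => (csum (fun n => (/ ((a + INR n)%R, u)) ^ (r + 2)) M
                      + RtoC (/ INR (S r)) * (/ ((a + INR M)%R, u)) ^ S r)%C).
  set (K := INR (S r) * 2 ^ (r + 3) * / p ^ r).
  assert (HK : 0 <= K).
  { unfold K. apply Rmult_le_pos; [apply Rmult_le_pos; [lra|apply pow_le; lra]|].
    apply Rlt_le, Rinv_0_lt_compat, pow_lt; lra. }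
  assert (F0 : F 0%nat = (RtoC (/ INR (S r)) * (/ (a, u)) ^ S r)%C).
  { unfold F. simpl csum. simpl INR. rewrite Rplus_0_r. ring. }
  rewrite <- F0.
  replace (2 * (INR (S r) * 2 ^ (r + 3) * (1 + / a) ^ 2) / p ^ (r + 2)) with
    (2 * (K * ((1 + / a) ^ 2 * / (p + INR 0) ^ 2))).
  2: { unfold K. simpl INR. rewrite Rplus_0_r, (pow_add p). field.
       repeat split; try lra; apply pow_nonzero; lra. }
  apply (Clim_telescope F _ (fun n => K * ((1 + / a) ^ 2 * / (p + INR n) ^ 2)) 0).
  - intros n. apply Rmult_le_pos; trivial. apply Rmult_le_pos; [apply pow2_ge_0|].
    apply Rlt_le, Rinv_0_lt_compat, pow_lt. generalize (pos_INR n); lra.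
  - intros n. rewrite <- Rmult_minus_distr_l.
    assert (Hpn : 0 < a <= p + INR n) by (generalize (pos_INR n); lra).
    apply Rle_trans with (K * / (p + INR n) ^ 3).
    2: { apply Rmult_le_compat_l; trivial. rewrite S_INR, <- Rplus_assoc. now apply inv_cube_telescope. }
    set (q := (/ ((a + INR n)%R, u))%C). set (q' := (/ ((a + INR (S n))%R, u))%C).
    replace (F (S n) - F n)%C with (RtoC (/ INR (S r)) * (RtoC (INR (S r)) * q ^ S (S r) - (q ^ S r - q' ^ S r)))%C.
    2: { unfold F. simpl csum. fold q q'. replace (r + 2)%nat with (S (S r)) by lia.
         rewrite RtoC_inv by lra. field. intros H. apply RtoC_inj in H. lra. }
    rewrite Cmod_mult, Cmod_R, Rabs_pos_eq by (apply Rlt_le, Rinv_0_lt_compat; lra).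
    assert (Hq : Cmod q <= 2 / (p + INR n)) by (apply Cinv_shift_bound; trivial).
    assert (Hq' : Cmod q' <= 2 / (p + INR n)).
    { apply Rle_trans with (1 := Cinv_shift_bound a u (S n) Ha). fold p. rewrite S_INR.
      apply Rmult_le_compat_l; [lra|]. apply Rinv_le_contravar; lra. }
    apply Rle_trans with (/ INR (S r) * (INR (S r) ^ 2 * (2 / (p + INR n)) ^ (S r + 2))).
    + apply Rmult_le_compat_l; [apply Rlt_le, Rinv_0_lt_compat; lra|].
      apply Cpow_diff_remainder; trivial. now apply Cinv_succ.
    + replace (/ INR (S r) * (INR (S r) ^ 2 * (2 / (p + INR n)) ^ (S r + 2))) with
        (INR (S r) * 2 ^ (r + 3) * / (p + INR n) ^ (r + 3)).
      2: { replace (S r + 2)%nat with (r + 3)%nat by lia. unfold Rdiv. rewrite Rpow_mult_distr, pow_inv.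
           field. split; [apply pow_nonzero; lra|lra]. }
      unfold K. rewrite (Rmult_assoc (INR (S r) * 2 ^ (r + 3))).
      apply Rmult_le_compat_l; [apply Rmult_le_pos; [lra|apply pow_le; lra]|].
      apply inv_pow_le. generalize (pos_INR n); lra.
  - replace (hurwitz_zeta (r + 2) (a, u)) with (hurwitz_zeta (r + 2) (a, u) + RtoC (/ INR (S r)) * RtoC 0)%C by ring.
    apply Clim_plus; [now apply Clim_hurwitz|]. apply Clim_mult; [apply Clim_const|now apply Clim_Cinv_pow].
Qed.

(** * The Gamma and digamma functions *)

Definition gamma_integrand (x t : R) : R := Rpower t (x - 1) * exp (- t).

Lemma continuous_gamma_integrand x t : 0 < t -> continuous (gamma_integrand x) t.
Proof.
  intros Ht. apply (ex_derive_continuous (gamma_integrand x)).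
  unfold gamma_integrand, Rpower. auto_derive. trivial.
Qed.

Lemma gamma_integrand_pos x t : 0 < gamma_integrand x t.
Proof. unfold gamma_integrand, Rpower. apply Rmult_lt_0_compat; apply exp_pos. Qed.

Lemma exp_monotone (x y : R) : x <= y -> exp x <= exp y.
Proof. intros [H|H]; [now apply Rlt_le, exp_increasing|rewrite H; lra]. Qed.

Lemma ln_le_tangent (x k : R) : 0 < x -> 0 < k -> k * ln x <= k * ln k + x - k.
Proof.
  intros Hx Hk.
  assert (H : ln (x / k) <= x / k - 1) by (apply ln_le_sub1, Rdiv_lt_0_compat; lra).
  rewrite ln_div in H by trivial.
  apply (Rmult_le_compat_l k) in H; [|lra].
  replace (k * (x / k - 1)) with (x - k) in H by (field; lra). lra.
Qed.

Lemma filterlim_exp_m (F : (R -> Prop) -> Prop) {FF : Filter F} (f : R -> R) :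
  filterlim f F (Rbar_locally m_infty) -> filterlim (fun t => exp (f t)) F (locally 0).
Proof. intros H. exact (filterlim_comp _ _ _ _ exp _ _ _ H is_lim_exp_m). Qed.

Lemma filterlim_le_m_infty (F : (R -> Prop) -> Prop) {FF : Filter F} (f g : R -> R) :
  F (fun t => f t <= g t) -> filterlim g F (Rbar_locally m_infty) -> filterlim f F (Rbar_locally m_infty).
Proof.
  intros H Hg P [M HM].
  assert (H2 : F (fun t => g t < M)) by (apply (Hg (fun z => z < M)); now exists M).
  unfold filtermap. generalize (filter_and _ _ H H2). apply filter_imp. intros t [H3 H4]. apply HM. lra.
Qed.

Lemma filterlim_scal_ln_0 (x : R) : 0 < x -> filterlim (fun t => x * ln t) (at_right 0) (Rbar_locally m_infty).
Proof.
  intros Hx P [M HM].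
  assert (H : at_right 0 (fun t => ln t < M / x)) by (apply (is_lim_ln_0 (fun z => z < M / x)); now exists (M / x)).
  unfold filtermap. revert H. apply filter_imp. intros t Ht. apply HM.
  apply (Rmult_lt_compat_l x) in Ht; trivial. now replace (x * (M / x)) with M in Ht by (field; lra).
Qed.

(* The majorant is a multiple of the derivative of [(t / (1 + t))^x]. *)
Lemma ex_gamma (x : R) : 0 < x -> ex_RInt_gen (gamma_integrand x) (at_right 0) (Rbar_locally p_infty).
Proof.
  (* [A] is the maximum of (1+t)^(x+1) exp(-t), attained at t = x. *)
  intros Hx. set (A := exp ((x + 1) * ln (x + 1) - x)).
  apply (ex_RInt_gen_dominated _ _ (fun t => 0 < t) (gamma_integrand x)
    (fun t => A / x * (exp (x * (ln t - ln (1 + t))) * (x * (/ t - / (1 + t)))))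
    (fun t => A / x * exp (x * (ln t - ln (1 + t)))) (A / x * 0) (A / x * exp (x * 0))).
  - apply convex_gt0.
  - apply at_right_gt0.
  - apply p_infty_gt.
  - intros t Ht. auto_derive; [lra|]. unfold Rminus. field. lra.
  - intros t Ht. apply (ex_derive_continuous (fun t => A / x * (exp (x * (ln t - ln (1 + t))) * (x * (/ t - / (1 + t)))))).
    auto_derive. lra.
  - intros t Ht. now apply continuous_gamma_integrand.
  - intros t Ht. rewrite Rabs_pos_eq by apply Rlt_le, gamma_integrand_pos.
    unfold gamma_integrand, Rpower.
    replace (A / x * (exp (x * (ln t - ln (1 + t))) * (x * (/ t - / (1 + t))))) with
      (A * (exp (x * (ln t - ln (1 + t))) * (/ t * / (1 + t)))) by (field; lra).
    replace (/ t) with (exp (- ln t)) by (rewrite exp_Ropp, exp_ln; trivial).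
    replace (/ (1 + t)) with (exp (- ln (1 + t))) by (rewrite exp_Ropp, exp_ln; lra).
    unfold A. rewrite <- !exp_plus.
    apply exp_monotone. generalize (ln_le_tangent (1 + t) (x + 1)). lra.
  - eapply filterlim_comp; [|apply (filterlim_scal_r (A / x) 0)].
    apply (filterlim_exp_m (at_right 0)).
    apply (filterlim_le_m_infty (at_right 0) _ (fun t => x * ln t)); [|now apply filterlim_scal_ln_0].
    generalize at_right_gt0. apply filter_imp. intros t Ht. apply Rmult_le_compat_l; [lra|].
    assert (0 < ln (1 + t)) by (rewrite <- ln_1; apply ln_increasing; lra). lra.
  - apply (filterlim_ext_loc (fun t => A / x * exp (x * (- ln (1 + / t))))).
    + exists 0. intros t Ht. do 3 f_equal.
      replace (1 + / t) with ((1 + t) / t) by (field; lra). rewrite ln_div by lra. ring.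
    + assert (Hinv : is_lim (fun u => / u) p_infty 0).
      { apply (is_lim_inv (fun u => u) p_infty p_infty); [apply is_lim_id|discriminate]. }
      assert (Hc : continuous (fun v => A / x * exp (x * (- ln (1 + v)))) 0).
      { apply (ex_derive_continuous (fun v => A / x * exp (x * (- ln (1 + v))))). auto_derive. lra. }
      pose proof (filterlim_comp _ _ _ _ _ _ _ _ Hinv Hc) as H. cbv beta in H.
      rewrite Rplus_0_r, ln_1, Ropp_0 in H. exact H.
Qed.

Lemma is_gamma (x : R) : 0 < x ->
  is_RInt_gen (gamma_integrand x) (at_right 0) (Rbar_locally p_infty) (Gamma x).
Proof. intros Hx. apply (RInt_gen_correct (gamma_integrand x)). now apply ex_gamma. Qed.

Lemma Gamma_le (x v : R) (g : R -> R) : 0 < x ->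
  (forall t, 0 < t -> gamma_integrand x t <= g t) ->
  is_RInt_gen g (at_right 0) (Rbar_locally p_infty) v -> Gamma x <= v.
Proof.
  intros Hx Hg Hv. apply Rle_trans with (1 := Rle_abs _).
  apply (RInt_gen_norm (Fa := at_right 0) (Fb := Rbar_locally p_infty) (gamma_integrand x) g (Gamma x) v);
    trivial; [| |now apply is_gamma].
  - exists (fun a => a < 1) (fun b => 1 < b).
    + exists (mkposreal 1 Rlt_0_1). intros y Hy _. change (Rabs (y - 0) < 1) in Hy.
      apply Rabs_lt_between in Hy. lra.
    + apply p_infty_gt.
    + simpl. intros; lra.
  - exists (fun a => 0 < a) (fun _ => True).
    + apply at_right_gt0.
    + now exists 0.
    + simpl. intros a b Ha _ t Ht. change (Rabs (gamma_integrand x t) <= g t).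
      rewrite Rabs_pos_eq by apply Rlt_le, gamma_integrand_pos. apply Hg. lra.
Qed.

Lemma Gamma_ge (x v : R) (g : R -> R) : 0 < x ->
  (forall t, 0 < t -> 0 <= g t <= gamma_integrand x t) ->
  is_RInt_gen g (at_right 0) (Rbar_locally p_infty) v -> v <= Gamma x.
Proof.
  intros Hx Hg Hv. apply Rle_trans with (1 := Rle_abs _).
  apply (RInt_gen_norm (Fa := at_right 0) (Fb := Rbar_locally p_infty) g (gamma_integrand x) v (Gamma x));
    trivial; [| |now apply is_gamma].
  - exists (fun a => a < 1) (fun b => 1 < b).
    + exists (mkposreal 1 Rlt_0_1). intros y Hy _. change (Rabs (y - 0) < 1) in Hy.
      apply Rabs_lt_between in Hy. lra.
    + apply p_infty_gt.
    + simpl. intros; lra.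
  - exists (fun a => 0 < a) (fun _ => True).
    + apply at_right_gt0.
    + now exists 0.
    + simpl. intros a b Ha _ t Ht. change (Rabs (g t) <= gamma_integrand x t).
      rewrite Rabs_pos_eq; apply Hg; lra.
Qed.

(** Integration by parts without boundary terms: x t^(x-1) exp(-t) - t^x exp(-t) is the derivative
    of t^x exp(-t), which tends to 0 at both ends. The integral of this difference is evaluated in
    two ways. *)
Lemma Gamma_succ (x : R) : 0 < x -> Gamma (x + 1) = x * Gamma x.
Proof.
  intros Hx.
  assert (H0 : is_RInt_gen (fun t => minus (scal x (gamma_integrand x t)) (gamma_integrand (x + 1) t))
                 (at_right 0) (Rbar_locally p_infty) (minus (scal x (Gamma x)) (Gamma (x + 1)))).
  { apply (is_RInt_gen_minus (fun t => scal x (gamma_integrand x t))).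
    - apply (is_RInt_gen_scal (gamma_integrand x)). now apply is_gamma.
    - apply is_gamma. lra. }
  assert (H1 : is_RInt_gen (fun t => minus (scal x (gamma_integrand x t)) (gamma_integrand (x + 1) t))
                 (at_right 0) (Rbar_locally p_infty) (0 - 0)).
  { apply (is_RInt_gen_antiderivative _ _ (fun t => 0 < t) _ (fun t => exp (x * ln t - t))).
    - apply convex_gt0.
    - apply at_right_gt0.
    - apply p_infty_gt.
    - intros t Ht. auto_derive; [lra|].
      unfold minus, plus, opp, scal; simpl; unfold mult; simpl. unfold gamma_integrand, Rpower.
      replace (x + 1 - 1) with x by ring.
      replace (exp ((x - 1) * ln t)) with (exp (x * ln t) * / t).
      2: { replace ((x - 1) * ln t) with (x * ln t + - ln t) by ring.
           now rewrite exp_plus, exp_Ropp, exp_ln. }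
      unfold Rminus. rewrite exp_plus. field. lra.
    - intros t Ht. apply (continuous_minus (fun t => scal x (gamma_integrand x t))).
      + apply (continuous_scal_r x (gamma_integrand x)). now apply continuous_gamma_integrand.
      + now apply continuous_gamma_integrand.
    - apply (filterlim_exp_m (at_right 0)).
      apply (filterlim_le_m_infty (at_right 0) _ (fun t => x * ln t)); [|now apply filterlim_scal_ln_0].
      generalize at_right_gt0. apply filter_imp. intros t Ht. lra.
    - apply (filterlim_exp_m (Rbar_locally p_infty)).
      (* The tangent inequality with k = 2x gives x ln t - t <= x ln(2x) - x - t/2, hence the
         threshold. *)
      intros P [M HM]. exists (Rmax 0 (2 * (x * ln (2 * x)) - 2 * M)). intros t Ht. apply HM.
      assert (H2 : 0 < t) by (apply Rle_lt_trans with (2 := Ht), Rmax_l).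
      assert (H3 : 2 * (x * ln (2 * x)) - 2 * M < t) by (apply Rle_lt_trans with (2 := Ht), Rmax_r).
      generalize (ln_le_tangent t (2 * x)). lra. }
  pose proof (is_RInt_gen_unique _ _ H0) as E0. pose proof (is_RInt_gen_unique _ _ H1) as E1.
  rewrite E0 in E1. unfold minus, plus, opp, scal in E1; simpl in E1; unfold mult in E1; simpl in E1. lra.
Qed.

(* For [x >= 1], [(1 - exp (- t))^(x - 1) * exp (- t)] is a minorant with integral [1 / x]. *)
Lemma Gamma_pos (x : R) : 0 < x -> 0 < Gamma x.
Proof.
  assert (H1 : forall x, 1 <= x -> 0 < Gamma x).
  { clear x. intros x Hx. apply Rlt_le_trans with (/ x * (exp (x * 0) - 0)).
    { rewrite Rmult_0_r, exp_0. assert (0 < / x) by (apply Rinv_0_lt_compat; lra). lra. }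
    assert (Hp : forall t, 0 < t -> 0 < 1 - exp (- t)).
    { intros t Ht. assert (exp (- t) < exp 0) by (apply exp_increasing; lra). rewrite exp_0 in H. lra. }
    apply (Gamma_ge x _ (fun t => scal (/ x) (exp (x * ln (1 - exp (- t))) * (x * (exp (- t) / (1 - exp (- t))))))); [lra| |].
    - intros t Ht. specialize (Hp t Ht).
      unfold scal; simpl; unfold mult; simpl.
      assert (E : / x * (exp (x * ln (1 - exp (- t))) * (x * (exp (- t) / (1 - exp (- t))))) =
        exp ((x - 1) * ln (1 - exp (- t))) * exp (- t)).
      { replace ((x - 1) * ln (1 - exp (- t))) with (x * ln (1 - exp (- t)) + - ln (1 - exp (- t))) by ring.
        rewrite exp_plus, (exp_Ropp (ln _)), exp_ln by trivial. field. lra. }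
      rewrite E. split.
      + apply Rlt_le, Rmult_lt_0_compat; apply exp_pos.
      + unfold gamma_integrand, Rpower. apply Rmult_le_compat_r; [apply Rlt_le, exp_pos|].
        apply exp_monotone. apply Rmult_le_compat_l; [lra|]. apply ln_le; trivial.
        generalize (exp_ineq1_le (- t)). lra.
    - apply (is_RInt_gen_scal (fun t => exp (x * ln (1 - exp (- t))) * (x * (exp (- t) / (1 - exp (- t))))) (/ x) (exp (x * 0) - 0)).
      apply (is_RInt_gen_antiderivative _ _ (fun t => 0 < t) _ (fun t => exp (x * ln (1 - exp (- t))))).
      + apply convex_gt0.
      + apply at_right_gt0.
      + apply p_infty_gt.
      + intros t Ht. specialize (Hp t Ht). auto_derive; [lra|]. unfold Rminus. field. lra.
      + intros t Ht. specialize (Hp t Ht).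
        apply (ex_derive_continuous (fun t => exp (x * ln (1 - exp (- t))) * (x * (exp (- t) / (1 - exp (- t)))))).
        auto_derive. lra.
      + apply (filterlim_exp_m (at_right 0)).
        apply (filterlim_le_m_infty (at_right 0) _ (fun t => x * ln t)); [|apply filterlim_scal_ln_0; lra].
        generalize at_right_gt0. apply filter_imp. intros t Ht. apply Rmult_le_compat_l; [lra|].
        apply ln_le; [now apply Hp|]. generalize (exp_ineq1_le (- t)). lra.
      + assert (He : filterlim (fun t => exp (- t)) (Rbar_locally p_infty) (locally 0)).
        { apply (filterlim_exp_m (Rbar_locally p_infty)). intros P [M HM]. exists (- M).
          intros t Ht. apply HM. lra. }
        assert (Hc : continuous (fun v => exp (x * ln (1 - v))) 0).
        { apply (ex_derive_continuous (fun v => exp (x * ln (1 - v)))). auto_derive. lra. }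
        pose proof (filterlim_comp _ _ _ _ _ _ _ _ He Hc) as H. cbv beta in H.
        rewrite Rminus_0_r, ln_1 in H. exact H. }
  (* For x < 1 the exponent x - 1 is negative and the minorant is lost; the functional equation
     reduces to x + 1. *)
  intros Hx. assert (H2 := H1 (x + 1) ltac:(lra)). rewrite Gamma_succ in H2 by trivial.
  apply (Rmult_lt_reg_l x); lra.
Qed.

(** Both tangent inequalities are taken at the point h a, towards a and towards 0; with weights h
    and 1 - h the linear terms cancel. *)
Lemma exp_convex (h a : R) : 0 <= h <= 1 -> exp (h * a) <= 1 - h + h * exp a.
Proof.
  intros Hh.
  assert (H1 : exp (h * a) * (1 + (1 - h) * a) <= exp a).
  { replace (exp a) with (exp (h * a) * exp ((1 - h) * a)) by (rewrite <- exp_plus; f_equal; ring).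
    apply Rmult_le_compat_l; [apply Rlt_le, exp_pos|apply exp_ineq1_le]. }
  assert (H2 : exp (h * a) * (1 + - (h * a)) <= 1).
  { rewrite <- exp_0 at 2. replace 0 with (h * a + - (h * a)) by ring. rewrite exp_plus.
    apply Rmult_le_compat_l; [apply Rlt_le, exp_pos|apply exp_ineq1_le]. }
  apply (Rmult_le_compat_l h) in H1; [|lra]. apply (Rmult_le_compat_l (1 - h)) in H2; [|lra]. lra.
Qed.

(** Convexity of exp gives (t/z)^h <= 1 - h + h t/z pointwise. Integrating against the integrand of
    Gamma(z), the right side becomes (1 - h + h) Gamma(z), because Gamma(z+1) = z Gamma(z). *)
Lemma Gamma_wendel (z h : R) : 0 < z -> 0 <= h <= 1 -> Gamma (z + h) <= Rpower z h * Gamma z.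
Proof.
  intros Hz Hh.
  replace (Rpower z h * Gamma z) with
    (plus (scal (Rpower z h * (1 - h)) (Gamma z)) (scal (Rpower z h * (h / z)) (Gamma (z + 1)))).
  2: { rewrite Gamma_succ by trivial. unfold plus, scal; simpl; unfold mult; simpl. field. lra. }
  apply (Gamma_le (z + h) _ (fun t => plus (scal (Rpower z h * (1 - h)) (gamma_integrand z t))
     (scal (Rpower z h * (h / z)) (gamma_integrand (z + 1) t)))); [lra| |].
  - intros t Ht. unfold plus, scal; simpl; unfold mult; simpl. unfold gamma_integrand.
    replace (z + h - 1) with (h + (z - 1)) by ring. replace (z + 1 - 1) with (1 + (z - 1)) by ring.
    rewrite !Rpower_plus, Rpower_1 by trivial.
    replace (Rpower z h * (1 - h) * (Rpower t (z - 1) * exp (- t)) +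
      Rpower z h * (h / z) * (t * Rpower t (z - 1) * exp (- t))) with
      (Rpower z h * (1 - h + h * (t / z)) * Rpower t (z - 1) * exp (- t)) by (field; lra).
    apply Rmult_le_compat_r; [apply Rlt_le, exp_pos|].
    apply Rmult_le_compat_r; [apply Rlt_le, exp_pos|].
    assert (Htz : 0 < t / z) by now apply Rdiv_lt_0_compat.
    generalize (exp_convex h (ln (t / z)) Hh). rewrite exp_ln by trivial. intros H.
    apply Rle_trans with (Rpower z h * exp (h * ln (t / z))).
    + unfold Rpower. rewrite <- exp_plus. apply exp_monotone. rewrite ln_div by trivial. lra.
    + apply Rmult_le_compat_l; [apply Rlt_le, exp_pos|trivial].
  - apply (is_RInt_gen_plus (fun t => scal (Rpower z h * (1 - h)) (gamma_integrand z t))).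
    + apply (is_RInt_gen_scal (gamma_integrand z)). now apply is_gamma.
    + apply (is_RInt_gen_scal (gamma_integrand (z + 1))). apply is_gamma. lra.
Qed.

Definition lnGamma (x : R) : R := ln (Gamma x).

Lemma lnGamma_succ (x : R) : 0 < x -> lnGamma (x + 1) = lnGamma x + ln x.
Proof.
  intros Hx. unfold lnGamma. rewrite Gamma_succ, ln_mult by (trivial; now apply Gamma_pos). ring.
Qed.

(** The lower bound is the upper bound for the step 1 - h starting at z + h, combined with the
    functional equation; replacing ln(z+h) by ln z costs at most 1/z. *)
Lemma lnGamma_wendel (z h : R) : 0 < z -> 0 <= h <= 1 ->
  h * ln z - / z <= lnGamma (z + h) - lnGamma z <= h * ln z.
Proof.
  assert (U : forall z h, 0 < z -> 0 <= h <= 1 -> lnGamma (z + h) - lnGamma z <= h * ln z).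
  { clear z h. intros z h Hz Hh. unfold lnGamma.
    assert (H := ln_le _ _ (Gamma_pos (z + h) ltac:(lra)) (Gamma_wendel z h Hz Hh)).
    rewrite ln_mult in H; [|apply exp_pos|now apply Gamma_pos].
    unfold Rpower in H. rewrite ln_exp in H. lra. }
  intros Hz Hh. split; [|now apply U].
  assert (H := U (z + h) (1 - h) ltac:(lra) ltac:(lra)).
  replace (z + h + (1 - h)) with (z + 1) in H by ring. rewrite lnGamma_succ in H by trivial.
  assert (H2 : ln (z + h) - ln z <= / z).
  { rewrite <- ln_div by lra. apply Rle_trans with (1 := ln_le_sub1 _ (Rdiv_lt_0_compat (z + h) z ltac:(lra) Hz)).
    replace ((z + h) / z - 1) with (h * / z) by (field; lra).
    generalize (Rinv_0_lt_compat _ Hz). nra. }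
  assert (H3 : 0 <= ln (z + h) - ln z) by (generalize (ln_le z (z + h)); lra).
  nra.
Qed.

(** The analogue of [is_derive_int0] for sequences: second derivatives bounded uniformly in [M] give
    a quadratic remainder that passes to the limit, so convergence of [F1] is needed only at [x]. *)
Lemma is_derive_pointwise_limit (F F1 F2 : nat -> R -> R) (f : R -> R) (x v B d : R) :
  0 < d ->
  (forall M t, Rabs (t - x) <= d -> is_derive (F M) t (F1 M t)) ->
  (forall M t, Rabs (t - x) <= d -> is_derive (F1 M) t (F2 M t)) ->
  (forall M t, Rabs (t - x) <= d -> Rabs (F2 M t) <= B) ->
  (forall t, Rabs (t - x) <= d -> is_lim_seq (fun M => F M t) (f t)) ->
  is_lim_seq (fun M => F1 M x) v ->
  is_derive f x v.
Proof.
  intros Hd H1 H2 HB Hf Hv. apply (is_derive_quadratic f x v B d Hd). intros h Hh.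
  apply (is_lim_seq_Rabs_le (fun M => F M (x + h) - F M x - h * F1 M x) _ _ 0).
  - intros M _. apply quadratic_remainder with (F2 M); intros t Ht; [apply H1|apply H2|apply HB]; lra.
  - apply is_lim_seq_minus'; [apply is_lim_seq_minus'|].
    + apply Hf. now replace (x + h - x) with h by ring.
    + apply Hf. rewrite Rminus_diag, Rabs_R0. lra.
    + exact (is_lim_seq_scal_l _ h v Hv).
Qed.

Lemma is_derive_rsum (f df : nat -> R -> R) (M : nat) (x : R) :
  (forall n, is_derive (f n) x (df n x)) ->
  is_derive (fun t => rsum (fun n => f n t) M) x (rsum (fun n => df n x) M).
Proof.
  intros H. induction M as [|M IH]; simpl.
  - apply @is_derive_const.
  - apply (is_derive_plus (fun t => rsum (fun n => f n t) M) (f M)); trivial.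
Qed.

Lemma rsum_S f M : rsum f (S M) = rsum f M + f M.
Proof. reflexivity. Qed.

(** The k-th derivative in [y] of ln M - sum_(n<M) 1/(y+n); the logarithm survives only for k =
    0. *)
Definition psi_seq (k M : nat) (y : R) : R :=
  (match k with O => ln (INR M) | S _ => 0 end)
  + (-1) ^ (k + 1) * INR (fact k) * rsum (fun n => / (y + INR n) ^ (k + 1)) M.

Lemma is_derive_psi_seq (k M : nat) (y : R) : 0 < y -> is_derive (psi_seq k M) y (psi_seq (S k) M y).
Proof.
  intros Hy.
  assert (D : is_derive (fun t => rsum (fun n => / (t + INR n) ^ (k + 1)) M) y
               (rsum (fun n => - INR (S k) * / (y + INR n) ^ (S k + 1)) M)).
  { apply (is_derive_rsum (fun n t => / (t + INR n) ^ (k + 1)) (fun n t => - INR (S k) * / (t + INR n) ^ (S k + 1))).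
    intros n. assert (Hn : 0 < y + INR n) by (generalize (pos_INR n); lra).
    replace (- INR (S k) * / (y + INR n) ^ (S k + 1)) with
      (- (INR (S k) * (1 * (y + INR n) ^ k)) / ((y + INR n) ^ (k + 1)) ^ 2).
    2: { rewrite !pow_add. simpl pow. field. repeat split; try lra; apply pow_nonzero; lra. }
    apply (is_derive_inv (fun t => (t + INR n) ^ (k + 1))).
    - replace (k + 1)%nat with (S k) by lia.
      replace (INR (S k) * (1 * (y + INR n) ^ k)) with (INR (S k) * 1 * (y + INR n) ^ pred (S k)) by (simpl pred; ring).
      apply (is_derive_pow (fun t => t + INR n) (S k) y 1).
      auto_derive; trivial.
    - apply pow_nonzero. lra. }
  unfold psi_seq at 1.
  replace (psi_seq (S k) M y) with (0 + (-1) ^ (k + 1) * INR (fact k) * rsum (fun n => - INR (S k) * / (y + INR n) ^ (S k + 1)) M).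
  2: { unfold psi_seq. rewrite rsum_scal. rewrite fact_simpl, mult_INR.
       replace (S k + 1)%nat with (S (k + 1)) by lia. simpl ((-1) ^ S _). ring. }
  apply (is_derive_plus (fun _ => match k with O => ln (INR M) | S _ => 0 end)
    (fun y => (-1) ^ (k + 1) * INR (fact k) * rsum (fun n => / (y + INR n) ^ (k + 1)) M)).
  - apply @is_derive_const.
  - now apply (is_derive_scal (fun t => rsum (fun n => / (t + INR n) ^ (k + 1)) M)).
Qed.

Lemma rsum_inv_pow (d y : R) (k M : nat) : 0 < d <= y ->
  rsum (fun n => / (y + INR n) ^ (k + 2)) M <= / d ^ k * ((1 + / d) * / d).
Proof.
  intros Hd. apply Rle_trans with (rsum (fun n => / d ^ k * / (d + INR n) ^ 2) M).
  - apply rsum_le. intros n. generalize (pos_INR n); intros Hn.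
    apply Rle_trans with (/ d ^ k * / (y + INR n) ^ 2); [apply inv_pow_le; lra|].
    apply Rmult_le_compat_l; [apply Rlt_le, Rinv_0_lt_compat, pow_lt; lra|].
    apply Rinv_le_contravar; [apply pow_lt; lra|]. apply pow_incr; lra.
  - rewrite rsum_scal. apply Rmult_le_compat_l; [apply Rlt_le, Rinv_0_lt_compat, pow_lt; lra|].
    apply rsum_inv_sq. lra.
Qed.

Lemma Rabs_sign (k : nat) : Rabs ((-1) ^ k) = 1.
Proof. rewrite <- RPow_abs, (Rabs_left (-1)) by lra. replace (- -1) with 1 by ring. apply pow1. Qed.

Lemma rsum_nonneg f M : (forall n, 0 <= f n) -> 0 <= rsum f M.
Proof. intros H. induction M as [|M IH]; simpl; [lra|]. generalize (H M); lra. Qed.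

Lemma psi_seq_bound (d y : R) (k M : nat) : 0 < d <= y ->
  Rabs (psi_seq (S k) M y) <= INR (fact (S k)) * (/ d ^ k * ((1 + / d) * / d)).
Proof.
  intros Hd. unfold psi_seq. rewrite Rplus_0_l, !Rabs_mult, Rabs_sign, Rmult_1_l, Rabs_pos_eq by apply pos_INR.
  apply Rmult_le_compat_l; [apply pos_INR|].
  replace (S k + 1)%nat with (k + 2)%nat by lia.
  rewrite Rabs_pos_eq.
  - now apply rsum_inv_pow.
  - apply rsum_nonneg. intros n. apply Rlt_le, Rinv_0_lt_compat, pow_lt. generalize (pos_INR n); lra.
Qed.

Lemma ln_shift_lim (y : R) : 0 <= y -> is_lim_seq (fun M => ln (y + INR M) - ln (INR M)) 0.
Proof.
  intros Hy. apply is_lim_seq_incr_1.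
  apply (is_lim_seq_le_le (fun _ => 0) _ (fun M => y / (1 + INR M))).
  - intros M. assert (HM : 0 < INR (S M)) by (apply lt_0_INR; lia). split.
    + generalize (ln_le (INR (S M)) (y + INR (S M))). lra.
    + rewrite <- ln_div by lra.
      apply Rle_trans with (1 := ln_le_sub1 _ (Rdiv_lt_0_compat (y + INR (S M)) (INR (S M)) ltac:(lra) HM)).
      apply Req_le. replace (1 + INR M) with (INR (S M)) by (rewrite S_INR; ring). field. lra.
  - apply is_lim_seq_const.
  - apply is_lim_seq_inv_shift. lra.
Qed.

Lemma psi_seq_cvg (k : nat) (y : R) : 0 < y -> ex_finite_lim_seq (fun M => psi_seq k M y).
Proof.
  intros Hy. destruct k as [|k].
  (* The summands compare 1/(y+n) with the increment of the logarithm. They are bounded by 1/(y+n) -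
     1/(y+n+1), which telescopes; ln(y+M) is then exchanged for ln M. *)
  - set (x := fun n => ln (y + INR (S n)) - ln (y + INR n) - / (y + INR n)).
    assert (Hx : forall n, Rabs (x n) <= / (y + INR n) - / (y + INR (S n))).
    { intros n. unfold x. rewrite S_INR. generalize (pos_INR n); intros Hn.
      assert (H1 : 0 < (y + (INR n + 1)) / (y + INR n)) by (apply Rdiv_lt_0_compat; lra).
      rewrite <- ln_div by lra.
      generalize (ln_le_sub1 _ H1) (ln_ge_1_sub_inv _ H1).
      replace ((y + (INR n + 1)) / (y + INR n) - 1) with (/ (y + INR n)) by (field; lra).
      replace (1 - / ((y + (INR n + 1)) / (y + INR n))) with (/ (y + (INR n + 1))) by (field; lra).
      intros. apply Rabs_le_between. lra. }
    assert (HL : is_lim_seq (rsum x) (Series x)).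
    { apply (rsum_abs_cvg x (/ y)). intros M.
      apply Rle_trans with (/ (y + INR 0) - / (y + INR M)).
      - apply (rsum_telescope _ (fun n => / (y + INR n))). exact Hx.
      - simpl INR. rewrite Rplus_0_r. assert (0 < / (y + INR M)) by (apply Rinv_0_lt_compat; generalize (pos_INR M); lra). lra. }
    exists (ln y - 0 + Series x).
    apply is_lim_seq_ext with (fun M => ln y - (ln (y + INR M) - ln (INR M)) + rsum x M).
    + intros M. unfold psi_seq.
      assert (E : rsum x M = ln (y + INR M) - ln y - rsum (fun n => / (y + INR n) ^ (0 + 1)) M).
      { induction M as [|M IH]; [simpl; rewrite Rplus_0_r; ring|].
        change (rsum x (S M)) with (rsum x M + x M). rewrite IH. unfold x.
        change (rsum (fun n => / (y + INR n) ^ (0 + 1)) (S M)) with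
          (rsum (fun n => / (y + INR n) ^ (0 + 1)) M + / (y + INR M) ^ (0 + 1)).
        simpl (_ ^ (0 + 1)). rewrite Rmult_1_r. ring. }
      rewrite E. simpl. ring.
    + apply is_lim_seq_plus'; [|exact HL]. apply is_lim_seq_minus'; [apply is_lim_seq_const|].
      apply ln_shift_lim. lra.
  - assert (H : ex_finite_lim_seq (rsum (fun n => / (y + INR n) ^ (k + 2)))).
    { apply (rsum_nonneg_cvg _ (/ y ^ k * ((1 + / y) * / y))).
      - intros n. apply Rlt_le, Rinv_0_lt_compat, pow_lt. generalize (pos_INR n); lra.
      - intros M. apply rsum_inv_pow. lra. }
    destruct H as [v Hv]. exists (0 + (-1) ^ (S k + 1) * INR (fact (S k)) * v).
    unfold psi_seq. replace (S k + 1)%nat with (k + 2)%nat by lia.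
    apply is_lim_seq_plus'; [apply is_lim_seq_const|].
    exact (is_lim_seq_scal_l _ ((-1) ^ (k + 2) * INR (fact (S k))) v Hv).
Qed.

(** For y > 0 these are the polygamma functions; the link with [digamma] is made through ln
    Gamma. *)
Definition psi (k : nat) (y : R) : R := real (Lim_seq (fun M => psi_seq k M y)).

Lemma is_lim_psi (k : nat) (y : R) : 0 < y -> is_lim_seq (fun M => psi_seq k M y) (psi k y).
Proof. intros Hy. apply Lim_seq_correct'. now apply psi_seq_cvg. Qed.

Lemma is_derive_psi (k : nat) (y : R) : 0 < y -> is_derive (psi k) y (psi (S k) y).
Proof.
  intros Hy.
  apply (is_derive_pointwise_limit (psi_seq k) (psi_seq (S k)) (psi_seq (S (S k))) (psi k) y _
    (INR (fact (S (S k))) * (/ (y / 2) ^ S k * ((1 + / (y / 2)) * / (y / 2)))) (y / 2)); try lra.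
  - intros M t Ht. apply Rabs_le_between in Ht. apply is_derive_psi_seq. lra.
  - intros M t Ht. apply Rabs_le_between in Ht. apply is_derive_psi_seq. lra.
  - intros M t Ht. apply Rabs_le_between in Ht. apply psi_seq_bound. lra.
  - intros t Ht. apply Rabs_le_between in Ht. apply is_lim_psi. lra.
  - now apply is_lim_psi.
Qed.

Lemma lnGamma_sub_shift (x h : R) (M : nat) : 0 < x -> 0 <= h ->
  lnGamma (x + h) - lnGamma x = lnGamma (x + INR M + h) - lnGamma (x + INR M)
    - rsum (fun n => ln (x + h + INR n) - ln (x + INR n)) M.
Proof.
  intros Hx Hh. induction M as [|M IH].
  - simpl. rewrite Rplus_0_r. ring.
  - rewrite IH. simpl rsum. rewrite S_INR. generalize (pos_INR M); intros HM.
    replace (x + (INR M + 1) + h) with (x + INR M + h + 1) by ring.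
    replace (x + (INR M + 1)) with (x + INR M + 1) by ring.
    rewrite !lnGamma_succ by lra. replace (x + h + INR M) with (x + INR M + h) by ring. ring.
Qed.

(** Euler's limit for Gamma in logarithmic form. The functional equation moves the increment from x
    to x + M, where Wendel's bounds determine it up to 1/(x+M). *)
Lemma lnGamma_euler (x h : R) : 0 < x -> 0 <= h <= 1 ->
  is_lim_seq (fun M => h * ln (INR M) - rsum (fun n => ln (x + h + INR n) - ln (x + INR n)) M)
    (lnGamma (x + h) - lnGamma x).
Proof.
  intros Hx Hh.
  assert (H0 : is_lim_seq (fun M => h * ln (INR M) - rsum (fun n => ln (x + h + INR n) - ln (x + INR n)) M
                 - (lnGamma (x + h) - lnGamma x)) 0).
  { apply (is_lim_seq_le_le (fun M => - (h * (ln (x + INR M) - ln (INR M)))) _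
      (fun M => 1 / (x + INR M) - h * (ln (x + INR M) - ln (INR M)))).
    - intros M. rewrite (lnGamma_sub_shift x h M) by lra.
      generalize (lnGamma_wendel (x + INR M) h ltac:(generalize (pos_INR M); lra) Hh).
      unfold Rdiv. lra.
    - replace 0 with (- (h * 0)) by ring. apply (is_lim_seq_opp _ (h * 0)).
      apply (is_lim_seq_scal_l _ h 0). apply ln_shift_lim. lra.
    - replace 0 with (0 - h * 0) by ring. apply is_lim_seq_minus'.
      + now apply is_lim_seq_inv_shift.
      + apply (is_lim_seq_scal_l _ h 0). apply ln_shift_lim. lra. }
  apply is_lim_seq_ext with (fun M => (h * ln (INR M) - rsum (fun n => ln (x + h + INR n) - ln (x + INR n)) M
                 - (lnGamma (x + h) - lnGamma x)) + (lnGamma (x + h) - lnGamma x)).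
  { intros M. ring. }
  replace (Finite (lnGamma (x + h) - lnGamma x)) with (Finite (0 + (lnGamma (x + h) - lnGamma x))) by (f_equal; ring).
  apply is_lim_seq_plus'; [exact H0|apply is_lim_seq_const].
Qed.

Lemma is_derive_lnGamma (x : R) : 0 < x -> is_derive lnGamma x (psi 0 x).
Proof.
  (* Euler's limit is available only for steps h in [0,1], so the base point is moved to x - d: for
     |t - x| <= d the step t - (x - d) lies in [0, 2d], and 2d <= 1. Also d <= x/2 keeps t and x - d
     at least x/2. *)
  intros Hx. set (d := Rmin x 1 / 2).
  assert (Hd : 0 < d) by (unfold d; assert (0 < Rmin x 1) by (apply Rmin_glb_lt; lra); lra).
  assert (Hd1 : d <= x / 2) by (unfold d; generalize (Rmin_l x 1); lra).
  assert (Hd2 : d <= 1 / 2) by (unfold d; generalize (Rmin_r x 1); lra).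
  apply (is_derive_ext (fun t => lnGamma t - lnGamma (x - d) + lnGamma (x - d))).
  { intros t. match goal with |- @eq _ ?a ?b => change (@eq R a b) end. ring. }
  rewrite <- (Rplus_0_r (psi 0 x)).
  apply (is_derive_plus (fun t => lnGamma t - lnGamma (x - d)) (fun _ => lnGamma (x - d))); [|apply @is_derive_const].
  apply (is_derive_pointwise_limit
     (fun M t => (t - (x - d)) * ln (INR M) - rsum (fun n => ln (t + INR n) - ln ((x - d) + INR n)) M)
     (psi_seq 0) (psi_seq 1) _ x _
     (INR (fact 1) * (/ (x / 2) ^ 0 * ((1 + / (x / 2)) * / (x / 2)))) d); trivial.
  - intros M t Ht. apply Rabs_le_between in Ht.
    replace (psi_seq 0 M t) with (1 * ln (INR M) - rsum (fun n => / (t + INR n)) M).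
    2: { unfold psi_seq. simpl. rewrite (rsum_ext (fun n => / ((t + INR n) * 1)) (fun n => / (t + INR n))).
         - ring.
         - intros n. now rewrite Rmult_1_r. }
    apply (is_derive_minus (fun t => (t - (x - d)) * ln (INR M)) (fun t => rsum (fun n => ln (t + INR n) - ln ((x - d) + INR n)) M)).
    + auto_derive; trivial.
    + apply (is_derive_rsum (fun n t => ln (t + INR n) - ln ((x - d) + INR n)) (fun n t => / (t + INR n))).
      intros n. generalize (pos_INR n); intros Hn. auto_derive; [lra|]. field. lra.
  - intros M t Ht. apply Rabs_le_between in Ht. apply is_derive_psi_seq. lra.
  - intros M t Ht. apply Rabs_le_between in Ht. apply psi_seq_bound. lra.
  - intros t Ht. apply Rabs_le_between in Ht.
    assert (L := lnGamma_euler (x - d) (t - (x - d)) ltac:(lra) ltac:(lra)).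
    replace (x - d + (t - (x - d))) with t in L by ring. exact L.
  - now apply is_lim_psi.
Qed.

Lemma digammaE (x : R) : 0 < x -> digamma x = psi 0 x.
Proof.
  intros Hx. unfold digamma.
  assert (D : is_derive Gamma x (psi 0 x * exp (lnGamma x))).
  { apply (is_derive_ext_loc (fun t => exp (lnGamma t))).
    - exists (mkposreal x Hx). intros t Ht. change (Rabs (t - x) < x) in Ht. apply Rabs_lt_between in Ht.
      unfold lnGamma. apply exp_ln, Gamma_pos. lra.
    - apply (is_derive_comp exp lnGamma); [apply is_derive_exp|now apply is_derive_lnGamma]. }
  rewrite (is_derive_unique _ _ _ D). unfold lnGamma.
  assert (G := Gamma_pos x Hx). rewrite exp_ln by trivial. field. lra.
Qed.

(** * Derivatives of a split polynomial times the digamma function *)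

Fixpoint split_poly (cs : list R) (y : R) : R :=
  match cs with nil => 1 | c :: cs => (y - c) * split_poly cs y end.

(** The K-th derivative of P(v) (ln M - sum_(n<M) 1/(v+n)) for P = [split_poly cs] and K >= deg P.
    Indeed P(v)/(v+n) is P(-n)/(v+n) plus a polynomial of degree below deg P, which the derivative
    kills, and P ln M leaves K! ln M exactly when K = deg P. *)
Definition psi_poly_seq (cs : list R) (K M : nat) (v : R) : R :=
  (if Nat.eqb K (length cs) then INR (fact K) * ln (INR M) else 0)
  + (-1) ^ (K + 1) * INR (fact K) * rsum (fun n => split_poly cs (- INR n) / (v + INR n) ^ (K + 1)) M.

(** The tower of derivatives is built one root at a time by the Leibniz rule for a linear factor:
    the k-th derivative of (v-c) f is (v-c) times the k-th of f plus k times the (k-1)-st. *)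
Lemma psi_poly_derivatives (cs : list R) :
  exists d : nat -> R -> R,
    (forall v, d 0%nat v = split_poly cs v * psi 0 v) /\
    (forall k v, 0 < v -> is_derive (d k) v (d (S k) v)) /\
    (forall K v, (length cs <= K)%nat -> 0 < v -> is_lim_seq (fun M => psi_poly_seq cs K M v) (d K v)).
Proof.
  induction cs as [|c cs [d [H0 [H1 H2]]]].
  - exists psi. split; [intros; simpl; ring|]. split; [intros; now apply is_derive_psi|].
    intros K v _ Hv. apply is_lim_seq_ext with (2 := is_lim_psi K v Hv).
    intros M. unfold psi_seq, psi_poly_seq. f_equal.
    + destruct K; simpl; ring.
    + f_equal. apply rsum_ext. intros n. simpl split_poly. unfold Rdiv. now rewrite Rmult_1_l.
  - exists (fun k v => match k with O => (v - c) * d 0%nat v | S j => (v - c) * d (S j) v + INR (S j) * d j v end).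
    split; [|split].
    + intros v. simpl. rewrite H0. ring.
    + intros [|k] v Hv.
      * replace ((v - c) * d 1%nat v + INR 1 * d 0%nat v) with (1 * d 0%nat v + (v - c) * d 1%nat v) by (simpl; ring).
        apply (is_derive_mult (fun v => v - c) (d 0%nat)); [auto_derive; trivial; ring|now apply H1|exact Rmult_comm].
      * replace ((v - c) * d (S (S k)) v + INR (S (S k)) * d (S k) v) with
          ((1 * d (S k) v + (v - c) * d (S (S k)) v) + INR (S k) * d (S k) v) by (rewrite (S_INR (S k)); ring).
        apply (is_derive_plus (fun v => (v - c) * d (S k) v) (fun v => INR (S k) * d k v)).
        -- apply (is_derive_mult (fun v => v - c) (d (S k))); [auto_derive; trivial; ring|now apply H1|exact Rmult_comm].
        -- apply (is_derive_scal (d k)). now apply H1.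
    + intros [|K] v HK Hv; [simpl in HK; lia|]. simpl in HK.
      assert (L1 : is_lim_seq (fun M => psi_poly_seq cs (S K) M v) (d (S K) v)) by (apply H2; trivial; lia).
      assert (L2 : is_lim_seq (fun M => psi_poly_seq cs K M v) (d K v)) by (apply H2; trivial; lia).
      apply is_lim_seq_ext with (fun M => (v - c) * psi_poly_seq cs (S K) M v + INR (S K) * psi_poly_seq cs K M v).
      2: { apply is_lim_seq_plus'; [exact (is_lim_seq_scal_l _ (v - c) (d (S K) v) L1)|exact (is_lim_seq_scal_l _ (INR (S K)) (d K v) L2)]. }
      intros M. unfold psi_poly_seq.
      replace (Nat.eqb (S K) (length cs)) with false by (symmetry; apply Nat.eqb_neq; lia).
      simpl (length (c :: cs)). simpl (Nat.eqb (S K) (S _)).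
      replace (if Nat.eqb K (length cs) then INR (fact (S K)) * ln (INR M) else 0) with
        (INR (S K) * (if Nat.eqb K (length cs) then INR (fact K) * ln (INR M) else 0)).
      2: { destruct (Nat.eqb K (length cs)); rewrite ?fact_simpl, ?mult_INR; ring. }
      (* Since (v - c) - (v + n) = -n - c, the two sums combine into the factor of the new root
         evaluated at -n. *)
      assert (E : forall N, (v - c) * rsum (fun n => split_poly cs (- INR n) / (v + INR n) ^ (S K + 1)) N
          - rsum (fun n => split_poly cs (- INR n) / (v + INR n) ^ (K + 1)) N =
          rsum (fun n => split_poly (c :: cs) (- INR n) / (v + INR n) ^ (S K + 1)) N).
      { induction N as [|N IH]; [simpl; ring|]. rewrite !rsum_S, <- IH. simpl split_poly.
        assert (Hn : 0 < v + INR N) by (generalize (pos_INR N); lra).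
        replace ((v + INR N) ^ (S K + 1)) with ((v + INR N) * (v + INR N) ^ (K + 1)) by (simpl; ring).
        field. split; [apply pow_nonzero|]; lra. }
      rewrite <- E. rewrite (fact_simpl K), mult_INR. replace (S K + 1)%nat with (S (K + 1)) by lia.
      simpl ((-1) ^ S _). ring.
Qed.

Lemma Derive_n_tower (f : R -> R) (d : nat -> R -> R) (a : R) :
  (forall v, a < v -> f v = d 0%nat v) ->
  (forall k v, a < v -> is_derive (d k) v (d (S k) v)) ->
  forall K v, a < v -> Derive_n f K v = d K v.
Proof.
  intros H0 H1 K. induction K as [|K IH]; intros v Hv; [now apply H0|].
  simpl. rewrite <- (is_derive_unique _ _ _ (H1 K v Hv)). apply Derive_ext_loc.
  assert (Hp : 0 < v - a) by lra.
  exists (mkposreal _ Hp). intros t Ht. change (Rabs (t - v) < v - a) in Ht. apply Rabs_lt_between in Ht.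
  apply IH. lra.
Qed.

(** The roots 1, ..., n of (x-1)...(x-n), expressed in the variable v = x - l in which psi is
    evaluated. *)
Fixpoint shifted_roots (l n : nat) : list R :=
  match n with O => nil | S k => (INR k + 1 - INR l) :: shifted_roots l k end.

Lemma length_shifted_roots l n : length (shifted_roots l n) = n.
Proof. induction n; simpl; congruence. Qed.

Lemma split_poly_shifted_roots l n v : split_poly (shifted_roots l n) v = falling (v + INR l - 1) n.
Proof. induction n as [|n IH]; simpl; [reflexivity|]. rewrite IH. ring. Qed.

Fixpoint rising (x : R) (n : nat) : R :=
  match n with O => 1 | S k => rising x k * (x + 1 + INR k) end.

Lemma falling_opp (x : R) (n : nat) : falling (- x - 1) n = (-1) ^ n * rising x n.
Proof. induction n as [|n IH]; simpl; [ring|]. rewrite IH. ring. Qed.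

Lemma falling_nat (m n : nat) : (m < n)%nat -> falling (INR m) n = 0.
Proof.
  induction n as [|n IH]; intros H; [lia|]. simpl.
  destruct (Nat.eq_dec m n) as [->|Hne]; [ring|]. rewrite IH by lia. ring.
Qed.

Lemma rsum_split f l M : rsum f (l + M) = rsum f l + rsum (fun n => f (l + n)%nat) M.
Proof.
  induction M as [|M IH]; [rewrite Nat.add_0_r; simpl; ring|].
  rewrite Nat.add_succ_r. simpl. rewrite IH. ring.
Qed.

Lemma rsum_zero f M : (forall n, (n < M)%nat -> f n = 0) -> rsum f M = 0.
Proof. intros H. induction M as [|M IH]; simpl; [reflexivity|]. rewrite IH, H; [ring|lia|intros; apply H; lia]. Qed.

Lemma is_lim_Derive_gbinom_digamma (l n : nat) (x : R) : (l <= n)%nat -> INR l < x ->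
  is_lim_seq (fun M => ln (INR (l + M)) - rsum (fun k => rising (INR k) n / (x + INR k) ^ (n + 1)) M)
    (Derive_n (fun y => gbinom (y - 1) n * digamma (y - INR l)) n x).
Proof.
  intros Hln Hx.
  assert (Nf : INR (fact n) <> 0) by apply INR_fact_neq_0.
  destruct (psi_poly_derivatives (shifted_roots l n)) as [d [H0 [H1 H2]]].
  rewrite (Derive_n_tower _ (fun k y => / INR (fact n) * d k (y - INR l)) (INR l)); trivial.
  - assert (L := H2 n (x - INR l) ltac:(now rewrite length_shifted_roots) ltac:(lra)).
    apply (is_lim_seq_scal_l _ (/ INR (fact n)) (d n (x - INR l))) in L.
    apply (is_lim_seq_incr_n _ l) in L.
    apply is_lim_seq_ext with (2 := L). intros M. unfold psi_poly_seq.
    (* The first [l] summands drop out: their numerator is the falling factorial of the natural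
       number l - k - 1 < n. *)
    rewrite length_shifted_roots, Nat.eqb_refl, (Nat.add_comm M l), rsum_split, rsum_zero, Rplus_0_l.
    2: { intros k Hk. rewrite split_poly_shifted_roots.
         replace (- INR k + INR l - 1) with (INR (l - k - 1)).
         - rewrite falling_nat by lia. unfold Rdiv. ring.
         - rewrite !minus_INR by lia. simpl. ring. }
    rewrite (rsum_ext _ (fun k => (-1) ^ n * (rising (INR k) n / (x + INR k) ^ (n + 1)))).
    + rewrite rsum_scal. field_simplify_eq; trivial.
      replace ((-1) ^ (n + 1)) with (- (-1) ^ n) by (rewrite pow_add; simpl; ring).
      assert (Hs : (-1) ^ n * (-1) ^ n = 1) by (rewrite <- Rpow_mult_distr; replace (-1 * -1) with 1 by ring; apply pow1).
      generalize dependent ((-1) ^ n). intros s Hs.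
      match goal with |- ?A + ?B * - s * s * ?D = _ => transitivity (A - s * s * (B * D)); [ring|rewrite Hs; ring] end.
    + intros k. rewrite split_poly_shifted_roots, plus_INR.
      replace (- (INR l + INR k) + INR l - 1) with (- INR k - 1) by ring.
      rewrite falling_opp. replace (x - INR l + (INR l + INR k)) with (x + INR k) by ring.
      unfold Rdiv. ring.
  - intros v Hv. rewrite H0, split_poly_shifted_roots, digammaE by lra.
    unfold gbinom. replace (v - INR l + INR l - 1) with (v - 1) by ring. field. trivial.
  - intros k v Hv. apply (is_derive_scal (fun y => d k (y - INR l))).
    rewrite <- (Rmult_1_l (d (S k) (v - INR l))).
    apply (is_derive_comp (d k) (fun y => y - INR l)); [apply H1; lra|].
    auto_derive; trivial; ring.
Qed.

(** * Stirling numbers as coefficients, and the binomial theorem over C *)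

Fixpoint leval (p : list Z) (x : R) : R :=
  match p with nil => 0 | c :: q => IZR c + x * leval q x end.

Lemma leval_add p q x : leval (add_list p q) x = leval p x + leval q x.
Proof.
  revert q. induction p as [|c p IH]; intros [|d q]; simpl; try ring.
  rewrite IH, plus_IZR. ring.
Qed.

Lemma leval_scal c p x : leval (scal_list c p) x = IZR c * leval p x.
Proof. induction p as [|d p IH]; simpl; [ring|]. rewrite IH, mult_IZR. ring. Qed.

Lemma rsum_succ_l f M : rsum f (S M) = f 0%nat + rsum (fun n => f (S n)) M.
Proof. change (S M) with (1 + M)%nat. rewrite rsum_split. simpl. ring. Qed.

Lemma leval_nth p x M : (length p <= M)%nat -> rsum (fun m => IZR (nth m p 0%Z) * x ^ m) M = leval p x.
Proof.
  revert M. induction p as [|c p IH]; intros M HM.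
  - simpl. apply rsum_zero. intros [|n] _; ring.
  - simpl in HM. destruct M as [|M]; [lia|].
    rewrite rsum_succ_l. simpl. rewrite <- (IH M) by lia. rewrite Rmult_1_r, <- rsum_scal.
    f_equal. apply rsum_ext. intros n. ring.
Qed.

Lemma length_add_list p q : (length (add_list p q) <= Nat.max (length p) (length q))%nat.
Proof. revert q. induction p as [|c p IH]; intros [|d q]; simpl; try lia. generalize (IH q). lia. Qed.

Lemma length_scal_list c p : length (scal_list c p) = length p.
Proof. induction p; simpl; congruence. Qed.

(** The factor x of x(x-1)...(x-k) is the vanishing constant term; dropping it divides by x and
    accounts for the index m + 1 in s(N, m+1). *)
Lemma ff_coeffs_succ k : exists t, ff_coeffs (S k) = 0%Z :: t /\ (length t <= S k)%nat /\
  forall x, leval t x = falling (x - 1) k.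
Proof.
  induction k as [|k [t [E [HL HE]]]].
  - exists (1%Z :: nil). split; [reflexivity|]. split; [simpl; lia|]. intros x. simpl. ring.
  - exists (mul_x_minus (Z.of_nat (S k)) t). split; [|split].
    + change (ff_coeffs (S (S k))) with (mul_x_minus (Z.of_nat (S k)) (ff_coeffs (S k))).
      rewrite E. unfold mul_x_minus. cbn [add_list scal_list]. now rewrite Z.mul_0_r.
    + unfold mul_x_minus. generalize (length_add_list (0%Z :: t) (scal_list (- Z.of_nat (S k)) t)).
      rewrite length_scal_list. cbn [length]. lia.
    + intros x. unfold mul_x_minus. rewrite leval_add, leval_scal. cbn [leval]. rewrite HE, opp_IZR, <- INR_IZR_INZ, S_INR.
      simpl falling. ring.
Qed.

Lemma stirling1_generating (K : nat) (x : R) :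
  rsum (fun m => stirling1 (S K) (m + 1) * x ^ m) (S K) = falling (x - 1) K.
Proof.
  destruct (ff_coeffs_succ K) as [t [E [HL HE]]].
  rewrite <- HE, <- (leval_nth t x (S K) HL). apply rsum_ext. intros m.
  unfold stirling1. rewrite E, Nat.add_1_r. reflexivity.
Qed.

Lemma csum_scal c f M : csum (fun n => c * f n)%C M = (c * csum f M)%C.
Proof. induction M as [|M IH]; simpl; [ring|]. rewrite IH; ring. Qed.

Lemma csum_plus f g M : csum (fun n => f n + g n)%C M = (csum f M + csum g M)%C.
Proof. induction M as [|M IH]; simpl; [ring|]. rewrite IH; ring. Qed.

Lemma csum_ext_lt f g M : (forall n, (n < M)%nat -> f n = g n) -> csum f M = csum g M.
Proof.
  intros H. induction M as [|M IH]; simpl; [reflexivity|]. rewrite IH, H; auto.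
Qed.

Lemma csum_succ_l f M : csum f (S M) = (f 0%nat + csum (fun n => f (S n)) M)%C.
Proof.
  induction M as [|M IH]; [simpl; ring|].
  change (csum f (S (S M))) with (csum f (S M) + f (S M))%C. rewrite IH. simpl. ring.
Qed.

Lemma csum_RtoC f M : csum (fun n => RtoC (f n)) M = RtoC (rsum f M).
Proof. induction M as [|M IH]; simpl; [reflexivity|]. rewrite IH. now rewrite RtoC_plus. Qed.

Lemma binomial_n_n n : Binomial.C n n = 1.
Proof. unfold Binomial.C. rewrite Nat.sub_diag. simpl fact. simpl INR. field. apply INR_fact_neq_0. Qed.

Lemma binomial_n_0 n : Binomial.C n 0 = 1.
Proof. unfold Binomial.C. rewrite Nat.sub_0_r. simpl fact. simpl INR. field. apply INR_fact_neq_0. Qed.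

Lemma Cbinomial (x y : C) (m : nat) :
  csum (fun j => RtoC (Binomial.C m j) * (x ^ (m - j) * y ^ j))%C (S m) = ((x + y) ^ m)%C.
Proof.
  induction m as [|m IH].
  - simpl csum. rewrite binomial_n_0. simpl. ring.
  - assert (E : ((x + y) ^ S m = x * csum (fun j => RtoC (Binomial.C m j) * (x ^ (m - j) * y ^ j)) (S m)
       + y * csum (fun j => RtoC (Binomial.C m j) * (x ^ (m - j) * y ^ j)) (S m))%C).
    { rewrite IH. simpl. ring. }
    rewrite E. clear E IH.
    rewrite csum_succ_l. cbn [csum]. rewrite !binomial_n_0, binomial_n_n, !Nat.sub_0_r, Nat.sub_diag.
    rewrite (csum_ext_lt _ (fun j => x * (RtoC (Binomial.C m (S j)) * (x ^ (m - S j) * y ^ S j))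
        + y * (RtoC (Binomial.C m j) * (x ^ (m - j) * y ^ j)))%C).
    2: { intros j Hj. rewrite <- pascal by trivial. rewrite RtoC_plus.
         replace (S m - S j)%nat with (S (m - S j)) by lia.
         replace (m - j)%nat with (S (m - S j)) by lia. simpl. ring. }
    rewrite csum_plus, !csum_scal.
    assert (E2 : (csum (fun j => RtoC (Binomial.C m j) * (x ^ (m - j) * y ^ j)) m + RtoC (Binomial.C m m) * (x ^ (m - m) * y ^ m)
       = RtoC (Binomial.C m 0) * (x ^ (m - 0) * y ^ 0) + csum (fun j => RtoC (Binomial.C m (S j)) * (x ^ (m - S j) * y ^ S j)) m)%C).
    { exact (csum_succ_l (fun j => RtoC (Binomial.C m j) * (x ^ (m - j) * y ^ j))%C m). }
    rewrite E2 at 1. rewrite binomial_n_0, binomial_n_n, Nat.sub_0_r, Nat.sub_diag. simpl. ring.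
Qed.

Lemma triangular_swap (f : nat -> nat -> R) (K : nat) :
  sum_n_m (fun j => sum_n_m (fun m => f j m) j K) 0 K = rsum (fun m => rsum (fun j => f j m) (S m)) (S K).
Proof.
  assert (R0 : forall g k, sum_n_m g 0 k = rsum g (S k)) by (intros g k; symmetry; apply rsum_sum_n).
  induction K as [|K IH].
  - rewrite !sum_n_n. simpl. ring.
  - rewrite sum_n_Sm by lia. rewrite sum_n_n.
    rewrite (sum_n_m_ext_loc _ (fun j => plus (sum_n_m (fun m => f j m) j K) (f j (S K)))).
    2: { intros j Hj. apply sum_n_Sm. lia. }
    rewrite sum_n_m_plus, IH, R0. unfold plus; simpl. ring.
Qed.

(** * The Stirling combination of Hurwitz zeta values *)

(** The double sum as a linear functional of the array [X], so that it commutes with finite sums and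
    limits. The sum over [j] is innermost, ready for the binomial theorem. *)
Definition stirling_sum (K : nat) (X : nat -> nat -> C) : C :=
  csum (fun m => csum (fun j =>
    RtoC ((-1) ^ j * (Binomial.C m j * stirling1 (S K) (m + 1))) * X m j)%C (S m)) (S K).

Lemma stirling_sum_powers (K : nat) (a u : R) (n : nat) : 0 < a ->
  stirling_sum K (fun m j => (a, u) ^ (m - j) * (/ ((a + INR n)%R, u)) ^ ((K - j) + 2))%C
  = (RtoC ((-1) ^ K * rising (INR n) K) * (/ ((a + INR n)%R, u)) ^ (K + 2))%C.
Proof.
  intros Ha. set (w := (a, u)). set (v := ((a + INR n)%R, u)). set (q := (/ v)%C).
  assert (Nv : v <> RtoC 0) by (apply Cpair_neq0; generalize (pos_INR n); lra).
  assert (Ew : (w * q - 1 = - (RtoC (INR n)) * q)%C).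
  { replace w with (v - RtoC (INR n))%C by (unfold v, w; apply injective_projections; simpl; ring).
    unfold q. field. exact Nv. }
  replace ((-1) ^ K * rising (INR n) K) with (falling (- INR n - 1) K) by apply falling_opp.
  rewrite <- stirling1_generating, <- csum_RtoC, Cmult_comm, <- csum_scal.
  apply csum_ext_lt. intros m Hm.
  (* Splitting K - j + 2 as (K + 2 - m) + (m - j) pairs each w with a q. The inner sum is then (wq -
     1)^m = (-n q)^m, and the Stirling generating polynomial is evaluated at -n. *)
  rewrite (csum_ext_lt _ (fun j => (RtoC (stirling1 (S K) (m + 1)) * q ^ (K + 2 - m)) *
     (RtoC (Binomial.C m j) * ((w * q) ^ (m - j) * (- (1)) ^ j)))%C).
  2: { intros j Hj. rewrite !RtoC_mult, RtoC_pow, Cpow_mult_l.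
       replace (RtoC (-1)) with (- (1))%C by (apply injective_projections; simpl; ring).
       replace (K - j + 2)%nat with ((K + 2 - m) + (m - j))%nat by lia.
       rewrite Cpow_add_r. ring. }
  rewrite csum_scal, Cbinomial.
  replace (w * q + - (1))%C with (RtoC (- INR n) * q)%C by (rewrite RtoC_opp, <- Ew; ring).
  rewrite Cpow_mult_l, <- RtoC_pow, RtoC_mult.
  replace (K + 2)%nat with ((K + 2 - m) + m)%nat at 2 by lia. rewrite Cpow_add_r. ring.
Qed.

Lemma csum_Clim (F : nat -> nat -> C) (z : nat -> C) (M : nat) :
  (forall n, (n < M)%nat -> Clim (fun k => F k n) (z n)) -> Clim (fun k => csum (F k) M) (csum z M).
Proof.
  intros H. induction M as [|M IH]; simpl.
  - apply Clim_const.
  - apply Clim_plus; [apply IH; intros; apply H; lia|apply H; lia].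
Qed.

Lemma stirling_sum_Clim K (F : nat -> nat -> nat -> C) (X : nat -> nat -> C) :
  (forall m j, (j <= m)%nat -> (m <= K)%nat -> Clim (fun k => F k m j) (X m j)) ->
  Clim (fun k => stirling_sum K (F k)) (stirling_sum K X).
Proof.
  intros H. unfold stirling_sum.
  apply (csum_Clim (fun k m => csum (fun j => RtoC ((-1) ^ j * (Binomial.C m j * stirling1 (S K) (m + 1))) * F k m j)%C (S m))).
  intros m Hm.
  apply (csum_Clim (fun k j => RtoC ((-1) ^ j * (Binomial.C m j * stirling1 (S K) (m + 1))) * F k m j)%C).
  intros j Hj. apply Clim_mult; [apply Clim_const|apply H; lia].
Qed.

Lemma stirling_sum_ext K X Y :
  (forall m j, (j <= m)%nat -> (m <= K)%nat -> X m j = Y m j) -> stirling_sum K X = stirling_sum K Y.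
Proof.
  intros H. apply csum_ext_lt. intros m Hm. apply csum_ext_lt. intros j Hj. rewrite H by lia. reflexivity.
Qed.

Lemma stirling_sum_csum K (F : nat -> nat -> nat -> C) (M : nat) :
  stirling_sum K (fun m j => csum (F m j) M) = csum (fun n => stirling_sum K (fun m j => F m j n)) M.
Proof.
  induction M as [|M IH].
  - change (stirling_sum K (fun _ _ => RtoC 0) = RtoC 0). unfold stirling_sum.
    rewrite (csum_ext_lt _ (fun _ => RtoC 0 * RtoC 0)%C).
    + rewrite csum_scal. ring.
    + intros m _. rewrite (csum_ext_lt _ (fun _ => RtoC 0 * RtoC 0)%C).
      * rewrite csum_scal. ring.
      * intros j _. simpl. ring.
  - change (stirling_sum K (fun m j => csum (F m j) (S M)) =
      (csum (fun n => stirling_sum K (fun m j => F m j n)) M + stirling_sum K (fun m j => F m j M))%C).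
    rewrite <- IH. unfold stirling_sum. rewrite <- csum_plus. apply csum_ext. intros m.
    rewrite <- csum_plus. apply csum_ext. intros j. simpl. ring.
Qed.

Definition zeta_comb (K : nat) (a u : R) : C :=
  stirling_sum K (fun m j => (a, u) ^ (m - j) * hurwitz_zeta ((K - j) + 2) (a, u))%C.

Lemma Clim_zeta_comb (K : nat) (a u : R) : 0 < a ->
  Clim (csum (fun n => RtoC ((-1) ^ K * rising (INR n) K) * (/ ((a + INR n)%R, u)) ^ (K + 2))%C)
    (zeta_comb K a u).
Proof.
  intros Ha.
  apply Clim_ext with (fun M => stirling_sum K (fun m j =>
     (a, u) ^ (m - j) * csum (fun n => (/ ((a + INR n)%R, u)) ^ ((K - j) + 2)) M)%C).
  - intros M. rewrite <- (csum_ext _ _ _ (fun n => stirling_sum_powers K a u n Ha)).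
    rewrite <- stirling_sum_csum. apply stirling_sum_ext. intros m j _ _. now rewrite csum_scal.
  - apply (stirling_sum_Clim K (fun M m j => (a, u) ^ (m - j) * csum (fun n => (/ ((a + INR n)%R, u)) ^ ((K - j) + 2)) M)%C).
    intros m j _ _. apply Clim_mult; [apply Clim_const|now apply Clim_hurwitz].
Qed.

(** Both polynomials are monic of degree r + 1. This is the error in replacing q_n by n^K, the
    discrete counterpart of t^K in the tail integral. *)
Lemma rising_sub_pow (r : nat) :
  exists c, 0 <= c /\ forall x, 0 <= x -> Rabs (rising x (S r) - x ^ S r) <= c * (x + 1) ^ r.
Proof.
  induction r as [|r [c [Hc IH]]].
  - exists 1. split; [lra|]. intros x Hx. simpl. replace (1 * (x + 1 + 0) - x * 1) with 1 by ring. rewrite Rabs_R1. lra.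
  - exists (c * (2 + INR r) + (2 + INR r)). generalize (pos_INR r); intros Hr. split; [nra|].
    intros x Hx. specialize (IH x Hx).
    change (rising x (S (S r))) with (rising x (S r) * (x + 1 + INR (S r))). rewrite S_INR.
    replace (rising x (S r) * (x + 1 + (INR r + 1)) - x ^ S (S r)) with
      ((rising x (S r) - x ^ S r) * (x + 1 + (INR r + 1)) + x ^ S r * (2 + INR r)) by (simpl; ring).
    assert (Hp : 0 <= (x + 1) ^ r) by (apply pow_le; lra).
    apply Rle_trans with (1 := Rabs_triang _ _). rewrite !Rabs_mult.
    rewrite (Rabs_pos_eq (x + 1 + (INR r + 1))), (Rabs_pos_eq (2 + INR r)), (Rabs_pos_eq (x ^ S r)) by (try apply pow_le; lra).
    apply Rle_trans with (c * (x + 1) ^ r * ((x + 1) * (2 + INR r)) + (x + 1) ^ S r * (2 + INR r)).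
    + apply Rplus_le_compat.
      * apply Rmult_le_compat; try apply Rabs_pos; trivial; nra.
      * apply Rmult_le_compat_r; [lra|]. apply pow_incr; lra.
    + simpl. apply Req_le. ring.
Qed.

Lemma Cpow_quadratic (B : R) (j : nat) : 0 <= B ->
  exists c, 0 <= c /\ forall x y : C, Cmod x <= B -> Cmod y <= B ->
    Cmod (x ^ S j - y ^ S j - RtoC (INR (S j)) * (y ^ j * (x - y)))%C <= c * Cmod (x - y)%C ^ 2.
Proof.
  intros HB. induction j as [|j [c [Hc IH]]].
  - exists 0. split; [lra|]. intros x y _ _.
    replace (x ^ 1 - y ^ 1 - RtoC (INR 1) * (y ^ 0 * (x - y)))%C with (RtoC 0) by (simpl; ring).
    rewrite Cmod_0. lra.
  - exists (B * c + INR (S j) * B ^ j). generalize (pos_INR (S j)) (pow_le B j HB); intros H1 H2. split; [nra|].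
    intros x y Hx Hy. specialize (IH x y Hx Hy).
    replace (x ^ S (S j) - y ^ S (S j) - RtoC (INR (S (S j))) * (y ^ S j * (x - y)))%C with
      (x * (x ^ S j - y ^ S j - RtoC (INR (S j)) * (y ^ j * (x - y)))
        + RtoC (INR (S j)) * y ^ j * ((x - y) * (x - y)))%C.
    2: { rewrite (S_INR (S j)), RtoC_plus. simpl Cpow. ring. }
    apply Rle_trans with (1 := Cmod_triangle _ _). rewrite !Cmod_mult, Cmod_R, Cmod_pow, (Rabs_pos_eq (INR (S j))) by trivial.
    rewrite Rmult_plus_distr_r. apply Rplus_le_compat.
    + rewrite Rmult_assoc. apply Rmult_le_compat; trivial; apply Cmod_ge_0.
    + simpl (Cmod (x - y) ^ 2). rewrite Rmult_1_r. apply Rmult_le_compat_r; [apply Rmult_le_pos; apply Cmod_ge_0|].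
      apply Rmult_le_compat_l; trivial. apply pow_incr. split; [apply Cmod_ge_0|trivial].
Qed.

(* The tail [int_M^oo t^(N-1) / (t + w)^(N+1) dt] in closed form, [w = (a, u)]. *)
Definition tail_term (N : nat) (a u : R) (M : nat) : C :=
  (RtoC (/ INR N) * csum (fun k => RtoC (INR M ^ k) * (/ ((a + INR M)%R, u)) ^ S k) N)%C.

(** A geometric sum in M/(M+w), whose complement to 1 is w/(M+w). It reflects that (t/(t+w))^N / (N
    w) is an antiderivative of t^(N-1)/(t+w)^(N+1). The expanded sum used in [tail_term] contains
    only inverse powers of M + w, whose logarithmic integrals are known. *)
Lemma tail_term_closed (N : nat) (a u : R) (M : nat) : 0 < a ->
  ((a, u) * csum (fun k => RtoC (INR M ^ k) * (/ ((a + INR M)%R, u)) ^ S k) N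
    = 1 - (RtoC (INR M) * / ((a + INR M)%R, u)) ^ N)%C.
Proof.
  intros Ha. set (v := ((a + INR M)%R, u)).
  assert (Nv : v <> RtoC 0) by (apply Cpair_neq0; generalize (pos_INR M); lra).
  assert (Ew : ((a, u) * / v = 1 - RtoC (INR M) * / v)%C).
  { replace (a, u) with (v - RtoC (INR M))%C by (unfold v; apply injective_projections; simpl; ring).
    field. exact Nv. }
  induction N as [|N IH].
  - simpl. ring.
  - cbn [csum]. rewrite Cmult_plus_distr_l, IH. rewrite RtoC_pow. simpl Cpow.
    replace ((a, u) * (RtoC (INR M) ^ N * (/ v * (/ v) ^ N)))%C with ((a, u) * / v * (RtoC (INR M) ^ N * (/ v) ^ N))%C by ring.
    rewrite Ew, <- Cpow_mult_l. ring.
Qed.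

(** One summand against the integral over [n, n+1]. With al = n/(n+w) and be = (n+1)/(n+1+w), be -
    al is w q q', so the first-order expansion of be^N - al^N produces the summand up to errors of
    third order, uniformly in [u]. *)
Lemma tail_telescope (r : nat) (a : R) : 0 < a ->
  exists c, 0 <= c /\ forall u n,
    Cmod (RtoC (rising (INR n) (S r)) * (/ ((a + INR n)%R, u)) ^ (S r + 2)
          + (tail_term (S (S r)) a u (S n) - tail_term (S (S r)) a u n))%C <= c / (a + Rabs u + INR n) ^ 3.
Proof.
  intros Ha. set (N := S (S r)).
  destruct (rising_sub_pow r) as [c1 [Hc1 H1]].
  destruct (Cpow_quadratic 2 (S r) ltac:(lra)) as [c2 [Hc2 H2]].
  assert (Hia : 0 < / a) by now apply Rinv_0_lt_compat.
  set (k0 := 2 * (1 + / a)).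
  assert (Hk0 : 0 <= k0) by (unfold k0; lra).
  exists (8 * (c1 * k0 ^ r + 2 ^ S r + 2 * c2)).
  split. { assert (0 <= k0 ^ r) by now apply pow_le. assert (0 <= 2 ^ S r) by (apply pow_le; lra). nra. }
  intros u n. generalize (pos_INR n) (Rabs_pos u); intros Hn Hu.
  set (p := a + Rabs u + INR n). assert (Hp : 0 < p) by (unfold p; lra).
  set (w := (a, u)). set (v := ((a + INR n)%R, u)). set (v' := ((a + INR (S n))%R, u)).
  set (q := (/ v)%C). set (q' := (/ v')%C).
  assert (Nw : w <> RtoC 0) by (apply Cpair_neq0; lra).
  assert (Hq : Cmod q <= 2 / p) by (apply Cinv_shift_bound; trivial).
  assert (Hq' : Cmod q' <= 2 / p).
  { apply Rle_trans with (1 := Cinv_shift_bound a u (S n) Ha). rewrite S_INR. unfold p.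
    apply Rmult_le_compat_l; [lra|]. apply Rinv_le_contravar; lra. }
  assert (Eq : (q - q' = q * q')%C) by (apply Cinv_succ; trivial).
  assert (Q0 := Cmod_ge_0 q). assert (Q0' := Cmod_ge_0 q').
  set (al := (RtoC (INR n) * q)%C). set (be := (RtoC (INR (S n)) * q')%C).
  assert (Hal : Cmod al <= 2).
  { unfold al. rewrite Cmod_mult, Cmod_R, Rabs_pos_eq by trivial.
    apply Rle_trans with (INR n * (2 / p)); [now apply Rmult_le_compat_l|].
    apply (Rmult_le_reg_r p); trivial. replace (INR n * (2 / p) * p) with (2 * INR n) by (field; lra). unfold p; lra. }
  assert (Hbe : Cmod be <= 2).
  { unfold be. rewrite Cmod_mult, Cmod_R, Rabs_pos_eq by apply pos_INR.
    assert (Hs := Cinv_shift_bound a u (S n) Ha). change (Cmod q' <= 2 / (a + Rabs u + INR (S n))) in Hs.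
    apply Rle_trans with (INR (S n) * (2 / (a + Rabs u + INR (S n)))); [apply Rmult_le_compat_l; trivial; apply pos_INR|].
    generalize (pos_INR (S n)); intros.
    apply (Rmult_le_reg_r (a + Rabs u + INR (S n))); [lra|].
    replace (INR (S n) * (2 / (a + Rabs u + INR (S n))) * (a + Rabs u + INR (S n))) with (2 * INR (S n)) by (field; lra). lra. }
  (* This makes the bound uniform in [u]: the quadratic remainder divided by w still carries one
     factor w, which one factor q absorbs. *)
  assert (Hwq : Cmod w * Cmod q <= 2).
  { apply Rle_trans with (p * (2 / p)).
    - apply Rmult_le_compat; trivial; [apply Cmod_ge_0|].
      apply Rle_trans with (1 := Cmod_pair_upper a u Ha). unfold p; lra.
    - apply Req_le. field. lra. }
  assert (Nv : v <> RtoC 0) by (apply Cpair_neq0; lra).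
  assert (Nv' : v' <> RtoC 0) by (apply Cpair_neq0; generalize (pos_INR (S n)); lra).
  assert (Ebe : (be - al = w * (q * q'))%C).
  { assert (E1 : (w * q = 1 - al)%C).
    { unfold al. replace w with (v - RtoC (INR n))%C by (unfold v, w; apply injective_projections; simpl; ring).
      unfold q. field. exact Nv. }
    unfold be. rewrite S_INR, RtoC_plus.
    replace ((RtoC (INR n) + 1) * q' - al)%C with (q' - RtoC (INR n) * (q - q'))%C by (unfold al; ring).
    rewrite Eq. replace (w * (q * q'))%C with (w * q * q')%C by ring. rewrite E1. unfold al. ring. }
  set (rem := (be ^ S (S r) - al ^ S (S r) - RtoC (INR (S (S r))) * (al ^ S r * (be - al)))%C).
  assert (Hrem : Cmod rem <= c2 * Cmod (w * (q * q'))%C ^ 2).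
  { unfold rem. rewrite <- Ebe. now apply H2. }
  assert (NN : INR N <> 0) by (apply not_0_INR; unfold N; lia).
  assert (NC : RtoC (INR N) <> RtoC 0) by (intros H; apply RtoC_inj in H; contradiction).
  assert (Etail : (tail_term N a u (S n) - tail_term N a u n
     = - (al ^ S r * (q * q') + RtoC (/ INR N) * (/ w * rem)))%C).
  { unfold tail_term. generalize (tail_term_closed N a u n Ha) (tail_term_closed N a u (S n) Ha).
    fold w. fold v v'. fold q q'. fold al be.
    generalize (csum (fun k => RtoC (INR n ^ k) * q ^ S k)%C N) (csum (fun k => RtoC (INR (S n) ^ k) * q' ^ S k)%C N).
    intros s s' E1 E2.
    assert (E3 : (al ^ S r * (q * q') = / w * (al ^ S r * (be - al)))%C) by (rewrite Ebe; field; exact Nw).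
    assert (Es : (s = / w * (1 - al ^ N))%C) by (rewrite <- E1; field; exact Nw).
    assert (Es' : (s' = / w * (1 - be ^ N))%C) by (rewrite <- E2; field; exact Nw).
    rewrite E3, Es, Es', RtoC_inv by exact NN. unfold rem. fold N.
    generalize (al ^ N)%C (be ^ N)%C (al ^ S r)%C (be - al)%C. intros c3 c4 c5 c6. field. split; trivial. }
  rewrite Etail.
  (* Three errors remain: q_n against n^K, q against q' in the linear term, and the quadratic
     remainder. They give the three parts of the constant. *)
  replace (RtoC (rising (INR n) (S r)) * q ^ (S r + 2) + - (al ^ S r * (q * q') + RtoC (/ INR N) * (/ w * rem)))%C with
    (RtoC (rising (INR n) (S r) - INR n ^ S r) * q ^ (S r + 2) + (al ^ S r * (q * (q - q')) - RtoC (/ INR N) * (/ w * rem)))%C.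
  2: { unfold al. rewrite Cpow_mult_l, RtoC_minus, RtoC_pow, Cpow_add_r. simpl Cpow. ring. }
  rewrite Eq.
  assert (Hq3 : Cmod q ^ 3 <= 8 / p ^ 3).
  { replace (8 / p ^ 3) with ((2 / p) ^ 3) by (field; lra). apply pow_incr. lra. }
  assert (Hqqq : Cmod q * (Cmod q * Cmod q') <= 8 / p ^ 3).
  { replace (8 / p ^ 3) with (2 / p * (2 / p * (2 / p))) by (field; lra).
    apply Rmult_le_compat; trivial; [now apply Rmult_le_pos|]. now apply Rmult_le_compat. }
  assert (Hqqq' : Cmod q * Cmod q' ^ 2 <= 8 / p ^ 3).
  { replace (8 / p ^ 3) with (2 / p * (2 / p) ^ 2) by (field; lra).
    apply Rmult_le_compat; trivial; [apply pow2_ge_0|]. now apply pow_incr. }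
  replace (8 * (c1 * k0 ^ r + 2 ^ S r + 2 * c2) / p ^ 3) with
    (c1 * k0 ^ r * (8 / p ^ 3) + (2 ^ S r * (8 / p ^ 3) + 2 * c2 * (8 / p ^ 3))) by (field; lra).
  apply Rle_trans with (1 := Cmod_triangle _ _). apply Rplus_le_compat.
  { rewrite Cmod_mult, Cmod_R, Cmod_pow.
    apply Rle_trans with (c1 * (INR n + 1) ^ r * Cmod q ^ (S r + 2)).
    - apply Rmult_le_compat_r; [now apply pow_le|]. now apply H1.
    - replace (S r + 2)%nat with (r + 3)%nat by lia. rewrite pow_add.
      replace (c1 * (INR n + 1) ^ r * (Cmod q ^ r * Cmod q ^ 3)) with (c1 * (((INR n + 1) * Cmod q) ^ r * Cmod q ^ 3)).
      2: { rewrite Rpow_mult_distr. ring. }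
      rewrite (Rmult_assoc c1). apply Rmult_le_compat_l; trivial.
      apply Rmult_le_compat; trivial; try (apply pow_le); trivial.
      + apply Rmult_le_pos; lra.
      + apply pow_incr. split; [apply Rmult_le_pos; lra|].
        apply Rle_trans with ((INR n + 1) * (2 / p)); [apply Rmult_le_compat_l; lra|].
        apply (Rmult_le_reg_r p); trivial.
        replace ((INR n + 1) * (2 / p) * p) with (2 * (1 + INR n)) by (field; lra).
        (* [k0] bounds (n+1)|q|, because n + 1 <= (1 + 1/a)(a + n). *)
        unfold k0. rewrite Rmult_assoc. apply Rmult_le_compat_l; [lra|].
        apply Rle_trans with (1 := one_plus_le a (INR n) Ha Hn). apply Rmult_le_compat_l; [lra|]. unfold p; lra. }
  apply Rle_trans with (1 := Cmod_triangle _ _). apply Rplus_le_compat.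
  { rewrite !Cmod_mult, Cmod_pow. apply Rmult_le_compat; trivial.
    - apply pow_le, Cmod_ge_0.
    - apply Rmult_le_pos; trivial. now apply Rmult_le_pos.
    - apply pow_incr. split; [apply Cmod_ge_0|trivial]. }
  rewrite Cmod_opp, !Cmod_mult, Cmod_R.
  assert (HN1 : Rabs (/ INR N) <= 1).
  { assert (1 <= INR N) by (change 1 with (INR 1); apply le_INR; unfold N; lia).
    rewrite Rabs_pos_eq by (apply Rlt_le, Rinv_0_lt_compat; lra).
    rewrite <- Rinv_1. apply Rinv_le_contravar; lra. }
  assert (Hw0 : 0 < Cmod w) by now apply Cmod_gt_0.
  assert (Hi0 : 0 <= Cmod (/ w)%C * Cmod rem) by (apply Rmult_le_pos; apply Cmod_ge_0).
  apply Rle_trans with (1 * (Cmod (/ w)%C * Cmod rem)); [now apply Rmult_le_compat_r|].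
  rewrite Rmult_1_l, Cmod_inv by trivial.
  apply Rle_trans with (/ Cmod w * (c2 * Cmod (w * (q * q'))%C ^ 2)).
  { apply Rmult_le_compat_l; trivial. apply Rlt_le, Rinv_0_lt_compat; trivial. }
  rewrite !Cmod_mult.
  replace (/ Cmod w * (c2 * (Cmod w * (Cmod q * Cmod q')) ^ 2)) with
    (c2 * ((Cmod w * Cmod q) * (Cmod q * Cmod q' ^ 2))) by (field; lra).
  replace (2 * c2 * (8 / p ^ 3)) with (c2 * (2 * (8 / p ^ 3))) by ring.
  apply Rmult_le_compat_l; trivial. apply Rmult_le_compat; trivial.
  - apply Rmult_le_pos; lra.
  - apply Rmult_le_pos; trivial. apply pow2_ge_0.
Qed.

Lemma csum_scal_zero_lim (F : nat -> nat -> C) (M : nat) :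
  (forall n, Clim (fun k => F k n) (RtoC 0)) -> Clim (fun k => csum (F k) M) (RtoC 0).
Proof.
  intros H. replace (RtoC 0) with (csum (fun _ => RtoC 0) M).
  - apply csum_Clim. intros n _. apply H.
  - clear. induction M as [|M IH]; simpl; [reflexivity|]. rewrite IH. ring.
Qed.

Lemma tail_term_lim (N : nat) (a u : R) : 0 < a -> Clim (tail_term N a u) (RtoC 0).
Proof.
  intros Ha. unfold tail_term.
  replace (RtoC 0) with (RtoC (/ INR N) * RtoC 0)%C by ring.
  apply (Clim_mult (fun _ => RtoC (/ INR N))); [apply Clim_const|].
  apply (csum_scal_zero_lim (fun M k => RtoC (INR M ^ k) * (/ ((a + INR M)%R, u)) ^ S k)%C).
  intros k. apply Clim_Cmod0 with (fun M => 2 ^ k * 2 / (a + INR M)).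
  - intros M. generalize (pos_INR M); intros HM.
    assert (Hq := Cinv_shift_bound0 a u M Ha). assert (Q0 := Cmod_ge_0 (/ ((a + INR M)%R, u))%C).
    rewrite Cmod_mult, Cmod_R, Cmod_pow, <- RPow_abs, (Rabs_pos_eq (INR M)) by trivial.
    simpl pow.
    replace (INR M ^ k * (Cmod (/ ((a + INR M)%R, u))%C * Cmod (/ ((a + INR M)%R, u))%C ^ k)) with
      ((INR M * Cmod (/ ((a + INR M)%R, u))%C) ^ k * Cmod (/ ((a + INR M)%R, u))%C) by (rewrite Rpow_mult_distr; ring).
    replace (2 ^ k * 2 / (a + INR M)) with (2 ^ k * (2 / (a + INR M))) by (field; lra).
    apply Rmult_le_compat; trivial.
    + apply pow_le. now apply Rmult_le_pos.
    + apply pow_incr. split; [now apply Rmult_le_pos|].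
      apply Rle_trans with (INR M * (2 / (a + INR M))); [now apply Rmult_le_compat_l|].
      apply (Rmult_le_reg_r (a + INR M)); [lra|].
      replace (INR M * (2 / (a + INR M)) * (a + INR M)) with (2 * INR M) by (field; lra). lra.
  - now apply is_lim_seq_inv_shift.
Qed.

Definition approximant (K : nat) (a u : R) (M : nat) : C :=
  (csum (fun n => RtoC (rising (INR n) K) * (/ ((a + INR n)%R, u)) ^ (K + 2)) M + tail_term (S K) a u M)%C.

(** The cubic errors of consecutive approximants sum to a quadratic one. The sign (-1)^K cancels the
    one left by the falling factorial at -n - 1. *)
Lemma zeta_comb_approximant (r : nat) (a : R) : 0 < a ->
  exists c, 0 <= c /\ forall u M,
    Cmod (RtoC ((-1) ^ S r) * zeta_comb (S r) a u - approximant (S r) a u M)%C <= c / (a + Rabs u + INR M) ^ 2.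
Proof.
  intros Ha. destruct (tail_telescope r a Ha) as [c [Hc H]].
  set (k := (1 + / a) ^ 2). assert (Hk : 0 <= k) by apply pow2_ge_0.
  exists (2 * (c * k)). split; [apply Rmult_le_pos; [lra|now apply Rmult_le_pos]|].
  intros u M. generalize (Rabs_pos u); intros Hu.
  replace (2 * (c * k) / (a + Rabs u + INR M) ^ 2) with (2 * (c * (k * / (a + Rabs u + INR M) ^ 2))) by (unfold Rdiv; ring).
  apply (Clim_telescope (approximant (S r) a u) _ (fun n => c * (k * / (a + Rabs u + INR n) ^ 2))).
  - intros n. apply Rmult_le_pos; trivial. apply Rmult_le_pos; trivial.
    apply Rlt_le, Rinv_0_lt_compat, pow_lt. generalize (pos_INR n); lra.
  - intros n. unfold approximant. cbn [csum].
    match goal with |- Cmod ?z <= _ => replace z with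
      (RtoC (rising (INR n) (S r)) * (/ ((a + INR n)%R, u)) ^ (S r + 2)
          + (tail_term (S (S r)) a u (S n) - tail_term (S (S r)) a u n))%C by ring end.
    apply Rle_trans with (1 := H u n). rewrite <- Rmult_minus_distr_l. unfold Rdiv.
    apply Rmult_le_compat_l; trivial. rewrite S_INR, <- Rplus_assoc. apply inv_cube_telescope.
    generalize (pos_INR n); lra.
  - replace (RtoC ((-1) ^ S r) * zeta_comb (S r) a u)%C with (RtoC ((-1) ^ S r) * zeta_comb (S r) a u + RtoC 0)%C by ring.
    apply Clim_plus; [|now apply tail_term_lim].
    apply Clim_ext with (fun M => RtoC ((-1) ^ S r) * csum (fun n => RtoC ((-1) ^ S r * rising (INR n) (S r)) * (/ ((a + INR n)%R, u)) ^ (S r + 2)) M)%C.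
    + intros N. rewrite <- csum_scal. apply csum_ext. intros n.
      rewrite RtoC_mult.
      assert (E : (RtoC ((-1) ^ S r) * RtoC ((-1) ^ S r) = 1)%C).
      { rewrite <- RtoC_mult, <- Rpow_mult_distr. replace (-1 * -1) with 1 by ring. now rewrite pow1. }
      transitivity ((RtoC ((-1) ^ S r) * RtoC ((-1) ^ S r)) * (RtoC (rising (INR n) (S r)) * (/ ((a + INR n)%R, u)) ^ (S r + 2)))%C; [ring|rewrite E; ring].
    + apply Clim_mult; [apply Clim_const|now apply Clim_zeta_comb].
Qed.

(** * Integration of the zeta combination against the logarithm *)

Lemma Re_plus (x y : C) : Re (x + y)%C = Re x + Re y.
Proof. reflexivity. Qed.

Lemma Re_minus (x y : C) : Re (x - y)%C = Re x - Re y.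
Proof. reflexivity. Qed.

Lemma Re_RtoC_mult (k : R) (y : C) : Re (RtoC k * y)%C = k * Re y.
Proof. destruct y as [p q]. unfold Re; simpl. ring. Qed.

Lemma continuous_Cpow_line (a u : R) (d : nat) :
  continuous (fun u => Re ((a, u) ^ d)%C) u /\ continuous (fun u => Im ((a, u) ^ d)%C) u.
Proof.
  induction d as [|d [IH1 IH2]].
  - simpl. split; apply continuous_const.
  - split.
    + apply (continuous_minus (fun u => a * Re ((a, u) ^ d)%C) (fun u => u * Im ((a, u) ^ d)%C)).
      * now apply (continuous_mult (fun _ => a) (fun u => Re ((a, u) ^ d)%C)); [apply continuous_const|].
      * now apply (continuous_mult (fun u => u) (fun u => Im ((a, u) ^ d)%C)); [apply continuous_id|].
    + apply (continuous_plus (fun u => a * Im ((a, u) ^ d)%C) (fun u => u * Re ((a, u) ^ d)%C)).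
      * now apply (continuous_mult (fun _ => a) (fun u => Im ((a, u) ^ d)%C)); [apply continuous_const|].
      * now apply (continuous_mult (fun u => u) (fun u => Re ((a, u) ^ d)%C)); [apply continuous_id|].
Qed.

Lemma continuous_hurwitz_line (a u : R) (r : nat) : 0 < a ->
  continuous (fun u => Re (hurwitz_zeta (r + 2) (a, u))) u /\
  continuous (fun u => Im (hurwitz_zeta (r + 2) (a, u))) u.
Proof.
  intros Ha. split;
  apply (lipschitz_continuous _ u (2 * (INR (r + 2) * (2 ^ (S r + 2) * / a ^ S r * ((1 + / a) * / a)))));
  intros t; rewrite Rmult_assoc, (Rmult_assoc (INR (r + 2)));
  (apply Rle_trans with (Cmod (hurwitz_zeta (r + 2) (a, t) - hurwitz_zeta (r + 2) (a, u))%C);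
    [|apply Rle_trans with (1 := hurwitz_lipschitz a t u r Ha); apply Req_le; ring]).
  - apply Rle_trans with (2 := re_le_Cmod _). apply Req_le. reflexivity.
  - apply Rle_trans with (2 := im_le_Cmod _). apply Req_le. reflexivity.
Qed.

(** For e = 0 the modulus decays only like 1/u and the real part must be used; for e >= 1 the
    modulus suffices. The constant adds the bounds of both cases. *)
Lemma Re_Cinv_pow_bound (a u : R) (e : nat) : 0 < a -> 0 <= u ->
  Rabs (Re ((/ (a, u)) ^ S e)%C)
    <= (a * (2 * (1 + / a) ^ 2) + (2 / a) ^ pred e * (4 * (1 + / a) ^ 2)) / (1 + u) ^ 2.
Proof.
  intros Ha Hu. assert (Hu2 : 0 < (1 + u) ^ 2) by (apply pow_lt; lra).
  assert (Hi := Rinv_0_lt_compat _ Hu2).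
  assert (Hk : 0 <= (1 + / a) ^ 2) by apply pow2_ge_0.
  assert (H2a : 0 <= 2 / a) by (apply Rlt_le, Rdiv_lt_0_compat; lra).
  rewrite Rdiv_plus_distr.
  destruct e as [|e].
  - rewrite Re_Cinv_pair, Rabs_pos_eq by (apply Rlt_le, Rdiv_lt_0_compat; nra).
    apply Rle_trans with (a * (2 * (1 + / a) ^ 2) / (1 + u) ^ 2).
    + unfold Rdiv at 1. apply Rle_trans with (a * (2 * (1 + / a) ^ 2 / (1 + u) ^ 2)).
      * apply Rmult_le_compat_l; [lra|]. now apply lorentz_bound.
      * apply Req_le. unfold Rdiv. ring.
    + assert (0 <= (2 / a) ^ pred 0 * (4 * (1 + / a) ^ 2) / (1 + u) ^ 2).
      { apply Rmult_le_pos; [|lra]. simpl pow at 1. lra. }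
      lra.
  - apply Rle_trans with (1 := re_le_Cmod _).
    assert (H := Cinv_pow_bound a a u e ltac:(lra) Hu). simpl pred.
    change (S (S e)) with (2 + e)%nat.
    assert (0 <= a * (2 * (1 + / a) ^ 2) / (1 + u) ^ 2).
    { apply Rmult_le_pos; [|lra]. apply Rmult_le_pos; lra. }
    lra.
Qed.

(** By the asymptotics of zeta, w^d zeta(r+2, w) is w^(-(e+1))/(r+1) plus O(|w|^(-(e+2))) with e = r
    - d >= 0. The error decays quadratically in modulus, the leading term at least in its real
    part. *)
Lemma zeta_integrand_bound (a : R) (r d : nat) : 0 < a -> (d <= r)%nat ->
  exists A, forall u, 0 <= u ->
    Rabs (Re ((a, u) ^ d * hurwitz_zeta (r + 2) (a, u))%C) <= A / (1 + u) ^ 2.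
Proof.
  intros Ha Hd. set (e := (r - d)%nat).
  assert (Hia : 0 < / a) by now apply Rinv_0_lt_compat.
  set (c := 2 * (INR (S r) * 2 ^ (r + 3) * (1 + / a) ^ 2)).
  assert (Hc : 0 <= c).
  { unfold c. apply Rmult_le_pos; [lra|]. apply Rmult_le_pos; [|apply pow2_ge_0].
    apply Rmult_le_pos; [apply pos_INR|apply pow_le; lra]. }
  set (b := a * (2 * (1 + / a) ^ 2) + (2 / a) ^ pred e * (4 * (1 + / a) ^ 2)).
  exists (c * (/ a ^ e * (1 + / a) ^ 2) + / INR (S r) * b). intros u Hu.
  set (w := (a, u)). set (q := (/ w)%C). set (z := hurwitz_zeta (r + 2) w).
  assert (Nw : w <> RtoC 0) by now apply Cpair_neq0.
  assert (Nr : 0 < INR (S r)) by (apply lt_0_INR; lia).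
  assert (Ez : (w ^ d * z = w ^ d * (z - RtoC (/ INR (S r)) * q ^ S r) + RtoC (/ INR (S r)) * q ^ S e)%C).
  { replace (q ^ S e)%C with (w ^ d * q ^ S r)%C; [ring|].
    replace (S r) with (d + S e)%nat by (unfold e; lia). rewrite Cpow_add_r, Cmult_assoc, <- Cpow_mult_l.
    replace (w * q)%C with (RtoC 1) by (unfold q; field; exact Nw). rewrite Cpow_1_l. ring. }
  rewrite Ez.
  rewrite Re_plus, Re_RtoC_mult, Rdiv_plus_distr.
  apply Rle_trans with (1 := Rabs_triang _ _). apply Rplus_le_compat.
  - apply Rle_trans with (1 := re_le_Cmod _). rewrite Cmod_mult, Cmod_pow.
    assert (Has := hurwitz_asymptotic a u r Ha). rewrite (Rabs_pos_eq u Hu) in Has. fold c in Has.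
    assert (Hw : Cmod w <= a + u).
    { apply Rle_trans with (1 := Cmod_pair_upper a u Ha). rewrite Rabs_pos_eq by trivial. lra. }
    apply Rle_trans with ((a + u) ^ d * (c / (a + u) ^ (r + 2))).
    + apply Rmult_le_compat; trivial; [apply pow_le, Cmod_ge_0|apply Cmod_ge_0|].
      apply pow_incr. split; [apply Cmod_ge_0|trivial].
    + replace (r + 2)%nat with (d + (e + 2))%nat by (unfold e; lia).
      rewrite pow_add.
      replace ((a + u) ^ d * (c / ((a + u) ^ d * (a + u) ^ (e + 2)))) with (c * / (a + u) ^ (e + 2)).
      2: { field. split; apply pow_nonzero; lra. }
      unfold Rdiv. rewrite Rmult_assoc. apply Rmult_le_compat_l; trivial.
      apply Rle_trans with (1 := inv_pow_le a (a + u) e 2 ltac:(lra)). rewrite Rmult_assoc.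
      apply Rmult_le_compat_l; [apply Rlt_le, Rinv_0_lt_compat, pow_lt; lra|].
      assert (H1 := one_plus_le a u Ha Hu).
      apply (Rmult_le_reg_r ((a + u) ^ 2 * (1 + u) ^ 2)); [apply Rmult_lt_0_compat; apply pow_lt; lra|].
      replace (/ (a + u) ^ 2 * ((a + u) ^ 2 * (1 + u) ^ 2)) with ((1 + u) ^ 2) by (field; lra).
      replace ((1 + / a) ^ 2 * / (1 + u) ^ 2 * ((a + u) ^ 2 * (1 + u) ^ 2)) with (((1 + / a) * (a + u)) ^ 2) by (field; lra).
      apply pow_incr; lra.
  - rewrite Rabs_mult, Rabs_pos_eq by (apply Rlt_le, Rinv_0_lt_compat; lra).
    unfold Rdiv. rewrite Rmult_assoc. apply Rmult_le_compat_l; [apply Rlt_le, Rinv_0_lt_compat; lra|].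
    now apply Re_Cinv_pow_bound.
Qed.

Lemma ex_zeta_integral (a s : R) (r d : nat) : 0 < a -> 0 <= s -> (d <= r)%nat ->
  ex_int0 (fun u => Re ((a, u) ^ d * hurwitz_zeta (r + 2) (a, u))%C * logk s u).
Proof.
  intros Ha Hs Hd. destruct (zeta_integrand_bound a r d Ha Hd) as [A HA].
  apply (ex_int0_mul_logk _ s A); trivial.
  intros u _. destruct (continuous_Cpow_line a u d) as [C1 C2].
  destruct (continuous_hurwitz_line a u r Ha) as [C3 C4].
  apply (continuous_minus (fun u => Re ((a, u) ^ d)%C * Re (hurwitz_zeta (r + 2) (a, u)))
           (fun u => Im ((a, u) ^ d)%C * Im (hurwitz_zeta (r + 2) (a, u)))).
  - now apply (continuous_mult (fun u => Re ((a, u) ^ d)%C) (fun u => Re (hurwitz_zeta (r + 2) (a, u)))).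
  - now apply (continuous_mult (fun u => Im ((a, u) ^ d)%C) (fun u => Im (hurwitz_zeta (r + 2) (a, u)))).
Qed.

Lemma is_int0_rsum (F : nat -> R -> R) (v : nat -> R) (M : nat) :
  (forall n, (n < M)%nat -> is_int0 (F n) (v n)) ->
  is_int0 (fun u => rsum (fun n => F n u) M) (rsum v M).
Proof.
  intros H. induction M as [|M IH]; simpl.
  - apply is_int0_zero.
  - apply is_int0_plus; [apply IH; intros; apply H; lia|apply H; lia].
Qed.

Lemma Re_scal_csum (f : nat -> R) (g : nat -> C) (M : nat) :
  Re (csum (fun n => RtoC (f n) * g n)%C M) = rsum (fun n => f n * Re (g n)) M.
Proof. rewrite Re_csum. apply rsum_ext. intros n. apply Re_RtoC_mult. Qed.

Lemma rsum_mul_r f c M : rsum (fun n => f n * c) M = rsum f M * c.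
Proof. induction M as [|M IH]; simpl; [ring|]. rewrite IH; ring. Qed.

Lemma is_int0_approximant (K M : nat) (a s : R) : 0 < a -> 0 <= s ->
  is_int0 (fun u => Re (approximant K a u M) * logk s u)
    (rsum (fun n => rising (INR n) K * power_log (S K) (a + INR n) s) M
     + / INR (S K) * rsum (fun k => INR M ^ k * power_log k (a + INR M) s) (S K)).
Proof.
  intros Ha Hs.
  apply (is_int0_ext (fun u => rsum (fun n => rising (INR n) K * (Re ((/ ((a + INR n)%R, u)) ^ (S (S K)))%C * logk s u)) M
     + / INR (S K) * rsum (fun k => INR M ^ k * (Re ((/ ((a + INR M)%R, u)) ^ S k)%C * logk s u)) (S K))).
  - intros u _. unfold approximant, tail_term.
    rewrite Re_plus, Re_RtoC_mult, !Re_scal_csum, Rmult_plus_distr_r, Rmult_assoc, <- !rsum_mul_r.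
    replace (K + 2)%nat with (S (S K)) by lia.
    f_equal; [|f_equal]; apply rsum_ext; intros n; ring.
  - apply is_int0_plus.
    + apply (is_int0_rsum (fun n u => rising (INR n) K * (Re ((/ ((a + INR n)%R, u)) ^ (S (S K)))%C * logk s u))).
      intros n _. apply is_int0_scal, is_power_log; trivial. generalize (pos_INR n); lra.
    + apply is_int0_scal. apply (is_int0_rsum (fun k u => INR M ^ k * (Re ((/ ((a + INR M)%R, u)) ^ S k)%C * logk s u))).
      intros n _. apply is_int0_scal, is_power_log; trivial. generalize (pos_INR M); lra.
Qed.

Lemma ln_linear_div_lim (a s : R) : 0 < a -> 0 < s ->
  is_lim_seq (fun M => / (a + INR M) * ln (1 + (a + INR M) * s)) 0.
Proof.
  intros Ha Hs.
  assert (Hinf : is_lim_seq (fun M => 1 + (a + INR M) * s) p_infty).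
  { apply is_lim_seq_ext with (fun M => (1 + a * s) + s * INR M); [intros; ring|].
    eapply is_lim_seq_plus; [apply is_lim_seq_const|apply is_lim_seq_scal_l, is_lim_seq_INR|].
    simpl. destruct (Rle_dec 0 s) as [H|H]; [|lra]. destruct (Rle_lt_or_eq_dec 0 s H); [reflexivity|lra]. }
  assert (H1 : is_lim_seq (fun M => ln (1 + (a + INR M) * s) / (1 + (a + INR M) * s)) 0).
  { exact (filterlim_comp _ _ _ _ _ _ _ _ Hinf is_lim_div_ln_p). }
  assert (H2 : is_lim_seq (fun M => 1 / (a + INR M) + s) (0 + s)).
  { apply is_lim_seq_plus'; [now apply is_lim_seq_inv_shift|apply is_lim_seq_const]. }
  replace 0 with (0 * (0 + s)) by ring.
  apply is_lim_seq_ext with (2 := is_lim_seq_mult' _ _ _ _ H1 H2).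
  intros M. generalize (pos_INR M); intros HM. assert (0 < (a + INR M) * s) by (apply Rmult_lt_0_compat; lra).
  field. lra.
Qed.

(** With b = a + M the approximation error is at most c/(b^2+u^2), that is c/b times the Lorentz
    kernel, so its logarithmic integral is at most c PI ln(1+bs)/b, which tends to 0. *)
Lemma int0_zeta_comb_lim (r : nat) (a s v : R) : 0 < a -> 0 < s ->
  is_int0 (fun u => Re (zeta_comb (S r) a u) * logk s u) v ->
  is_lim_seq (fun M => rsum (fun n => rising (INR n) (S r) * power_log (S (S r)) (a + INR n) s) M
     + / INR (S (S r)) * rsum (fun k => INR M ^ k * power_log k (a + INR M) s) (S (S r))) ((-1) ^ S r * v).
Proof.
  intros Ha Hs Hv. destruct (zeta_comb_approximant r a Ha) as [c [Hc H]].
  set (V := fun M => rsum (fun n => rising (INR n) (S r) * power_log (S (S r)) (a + INR n) s) M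
     + / INR (S (S r)) * rsum (fun k => INR M ^ k * power_log k (a + INR M) s) (S (S r))).
  assert (HB : forall M, Rabs ((-1) ^ S r * v - V M) <= c * PI * (/ (a + INR M) * ln (1 + (a + INR M) * s))).
  { intros M. generalize (pos_INR M); intros HM. set (b := a + INR M). assert (Hb : 0 < b) by (unfold b; lra).
    replace (c * PI * (/ b * ln (1 + b * s))) with (c / b * lorentz_log b s).
    2: { rewrite lorentz_logE by trivial. field. lra. }
    apply (is_int0_Rabs_le (fun u => (-1) ^ S r * (Re (zeta_comb (S r) a u) * logk s u) - Re (approximant (S r) a u M) * logk s u)
      (fun u => c / b * (b / (b ^ 2 + u ^ 2) * logk s u))).
    - intros u Hu.
      replace ((-1) ^ S r * (Re (zeta_comb (S r) a u) * logk s u) - Re (approximant (S r) a u M) * logk s u) with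
        (Re (RtoC ((-1) ^ S r) * zeta_comb (S r) a u - approximant (S r) a u M)%C * logk s u).
      2: { rewrite Re_minus, Re_RtoC_mult. ring. }
      rewrite Rabs_mult, (Rabs_pos_eq (logk s u)) by apply logk_pos. rewrite <- Rmult_assoc.
      apply Rmult_le_compat_r; [apply logk_pos|].
      apply Rle_trans with (1 := re_le_Cmod _). apply Rle_trans with (1 := H u M).
      rewrite (Rabs_pos_eq u Hu). replace (a + u + INR M) with (b + u) by (unfold b; ring).
      replace (c / b * (b / (b ^ 2 + u ^ 2))) with (c * / (b ^ 2 + u ^ 2)) by (field; nra).
      apply Rmult_le_compat_l; trivial. apply Rinv_le_contravar; nra.
    - apply is_int0_minus; [now apply is_int0_scal|]. apply is_int0_approximant; lra.
    - apply is_int0_scal. apply int0_correct, ex_lorentz_logk; lra. }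
  assert (H0 : is_lim_seq (fun M => (-1) ^ S r * v - V M) 0).
  { apply is_lim_seq_abs_0.
    apply (is_lim_seq_le_le (fun _ => 0) _ (fun M => c * PI * (/ (a + INR M) * ln (1 + (a + INR M) * s)))).
    - intros M. split; [apply Rabs_pos|apply HB].
    - apply is_lim_seq_const.
    - replace 0 with (c * PI * 0) by ring. apply (is_lim_seq_scal_l _ (c * PI) 0). now apply ln_linear_div_lim. }
  replace ((-1) ^ S r * v) with ((-1) ^ S r * v - 0) by ring.
  apply is_lim_seq_ext with (fun M => (-1) ^ S r * v - ((-1) ^ S r * v - V M)); [intros; unfold V; ring|].
  apply is_lim_seq_minus'; [apply is_lim_seq_const|exact H0].
Qed.

Lemma harmonic_rsum n : harmonic n = rsum (fun k => / INR (S k)) n.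
Proof. induction n as [|n IH]; [reflexivity|]. cbn [harmonic rsum]. now rewrite IH. Qed.

Lemma int0_zeta_comb (l r : nat) (a y v : R) : 0 < a -> 0 < y -> (l <= S r)%nat -> INR l < a + y ->
  is_int0 (fun u => Re (zeta_comb (S r) a u) * logk (/ y) u) v ->
  (-1) ^ S r * v = PI / INR (S (S r)) *
    (Derive_n (fun x => gbinom (x - 1) (S r) * digamma (x - INR l)) (S r) (a + y) - ln y - harmonic (S r)).
Proof.
  intros Ha Hy Hl Hx Hv. set (K := S r). set (x := a + y).
  assert (Hs : 0 < / y) by now apply Rinv_0_lt_compat.
  assert (L1 := int0_zeta_comb_lim r a (/ y) v Ha Hs Hv). fold K in L1.
  assert (L2 := is_lim_Derive_gbinom_digamma l K x Hl Hx).
  set (Dn := Derive_n (fun x => gbinom (x - 1) K * digamma (x - INR l)) K x) in *.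
  assert (NN : INR (S K) <> 0) by (apply not_0_INR; lia).
  assert (Hx0 : 0 < x) by (unfold x; lra).
  (* The sequence of [L2] plus correction terms with known limits, arranged to coincide with the
     sequence of [L1]: ln(l+M) is exchanged for ln((x+M)/y), and the powers of M/(M+x), written 1 -
     x/(x+M), tend to 1 and leave the harmonic number. *)
  assert (L3 : is_lim_seq (fun M => PI / INR (S K) *
      ((ln (INR (l + M)) - rsum (fun k => rising (INR k) K / (x + INR k) ^ (K + 1)) M)
       + ((ln (x + INR M) - ln (INR M)) - (ln (INR l + INR M) - ln (INR M)) - ln y)
       - rsum (fun k => / INR (S k) * (1 - x / (x + INR M)) ^ S k) K))
      (PI / INR (S K) * (Dn + (0 - 0 - ln y) - harmonic K))).
  { apply (is_lim_seq_scal_l _ (PI / INR (S K)) (Dn + (0 - 0 - ln y) - harmonic K)).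
    apply is_lim_seq_minus'; [apply is_lim_seq_plus'; [exact L2|]|].
    - apply is_lim_seq_minus'; [apply is_lim_seq_minus'|apply is_lim_seq_const].
      + apply ln_shift_lim. lra.
      + apply ln_shift_lim, pos_INR.
    - rewrite harmonic_rsum. clear -Hx0. induction K as [|K IH]; [apply is_lim_seq_const|].
      cbn [rsum]. apply is_lim_seq_plus'; [exact IH|].
      replace (Finite (/ INR (S K))) with (Finite (/ INR (S K) * (1 - 0) ^ S K)) by (rewrite Rminus_0_r, pow1; f_equal; ring).
      apply (is_lim_seq_scal_l _ (/ INR (S K)) ((1 - 0) ^ S K)).
      assert (Hb : is_lim_seq (fun M => 1 - x / (x + INR M)) (1 - 0)).
      { apply is_lim_seq_minus'; [apply is_lim_seq_const|now apply is_lim_seq_inv_shift]. }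
      generalize (S K). intros j. induction j as [|j IHj]; [apply is_lim_seq_const|].
      simpl pow. now apply is_lim_seq_mult'. }
  replace (Dn - ln y - harmonic K) with (Dn + (0 - 0 - ln y) - harmonic K) by ring.
  apply is_lim_seq_unique in L1. apply is_lim_seq_unique in L3.
  enough (E : Finite ((-1) ^ K * v) = Finite (PI / INR (S K) * (Dn + (0 - 0 - ln y) - harmonic K))) by now injection E.
  rewrite <- L1, <- L3. apply Lim_seq_ext_loc. exists 1%nat. intros M HM.
  assert (HM0 : 0 < INR M) by (apply lt_0_INR; lia).
  rewrite (rsum_ext _ (fun n => - (PI / INR (S K)) * (rising (INR n) K / (x + INR n) ^ (K + 1)))).
  2: { intros n. rewrite power_logE by (trivial; generalize (pos_INR n); lra).
       replace (a + INR n + y) with (x + INR n) by (unfold x; ring). rewrite Nat.add_1_r. unfold Rdiv. ring. }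
  rewrite rsum_scal, rsum_succ_l, power_log0 by lra.
  rewrite (rsum_ext (fun k => INR M ^ S k * power_log (S k) (a + INR M) (/ y))
     (fun k => - PI * (/ INR (S k) * (1 - x / (x + INR M)) ^ S k))).
  2: { intros k. rewrite power_logE by lra.
       replace (a + INR M + y) with (x + INR M) by (unfold x; ring).
       replace (1 - x / (x + INR M)) with (INR M * / (x + INR M)) by (field; lra).
       rewrite Rpow_mult_distr, pow_inv. unfold Rdiv. ring. }
  rewrite rsum_scal.
  replace (1 + (a + INR M) * / y) with ((x + INR M) / y) by (unfold x; field; lra).
  rewrite ln_div by lra. rewrite plus_INR. simpl (INR M ^ 0). field. trivial.
Qed.

(** * The two identities *)

Definition zeta_log_integral (K : nat) (a y : R) (m j : nat) : R :=
  2 * int0 (fun u => Re (Cmult (Cpown (a, u) (m - j)) (hurwitz_zeta (S K + 1 - j) (a, u)))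
                     * ln (1 + u ^ 2 / y ^ 2)).

(** Both identities at once, with K = [S r]: a = l and K = 2l - 1, or a = l + 1/2 and K = 2l. The
    global sign (-1)^K separates the two cases. *)
Lemma stirling_zeta_log_sum (l r : nat) (a y : R) : 0 < a -> 0 < y -> (l <= S r)%nat -> INR l < a + y ->
  sum_range 0 (S r) (fun j => (-1) ^ j *
     sum_range j (S r) (fun m => Binomial.C m j * stirling1 (S (S r)) (m + 1) * zeta_log_integral (S r) a y m j))
  = (-1) ^ S r * (2 * PI / INR (S (S r)) *
    (Derive_n (fun x => gbinom (x - 1) (S r) * digamma (x - INR l)) (S r) (a + y) - ln y - harmonic (S r))).
Proof.
  intros Ha Hy Hl Hx. set (K := S r).
  assert (Hs : 0 < / y) by now apply Rinv_0_lt_compat.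
  set (J := fun m j => int0 (fun u => Re ((a, u) ^ (m - j) * hurwitz_zeta ((K - j) + 2) (a, u))%C * logk (/ y) u)).
  assert (HJ : forall m j, (j <= m)%nat -> (m <= K)%nat ->
     is_int0 (fun u => Re ((a, u) ^ (m - j) * hurwitz_zeta ((K - j) + 2) (a, u))%C * logk (/ y) u) (J m j)).
  { intros m j Hj Hm. apply int0_correct, ex_zeta_integral; trivial; [lra|lia]. }
  assert (EJ : forall m j, (j <= m)%nat -> (m <= K)%nat -> zeta_log_integral K a y m j = 2 * J m j).
  { intros m j Hj Hm. unfold zeta_log_integral. f_equal. apply is_int0_unique.
    apply is_int0_ext with (2 := HJ m j Hj Hm). intros u _.
    rewrite <- (Cpown_pow (a, u)). replace (S K + 1 - j)%nat with (K - j + 2)%nat by lia.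
    unfold logk. replace ((/ y * u) ^ 2) with (u ^ 2 / y ^ 2) by (field; lra). reflexivity. }
  set (v := rsum (fun m => rsum (fun j => (-1) ^ j * (Binomial.C m j * stirling1 (S K) (m + 1)) * J m j) (S m)) (S K)).
  assert (Hv : is_int0 (fun u => Re (zeta_comb K a u) * logk (/ y) u) v).
  { apply (is_int0_ext (fun u => rsum (fun m => rsum (fun j => (-1) ^ j * (Binomial.C m j * stirling1 (S K) (m + 1))
         * (Re ((a, u) ^ (m - j) * hurwitz_zeta ((K - j) + 2) (a, u))%C * logk (/ y) u)) (S m)) (S K))).
    - intros u _. unfold zeta_comb, stirling_sum. rewrite Re_csum, <- rsum_mul_r. apply rsum_ext. intros m.
      rewrite Re_scal_csum, <- rsum_mul_r. apply rsum_ext. intros j. ring.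
    - apply (is_int0_rsum (fun m u => rsum (fun j => (-1) ^ j * (Binomial.C m j * stirling1 (S K) (m + 1))
         * (Re ((a, u) ^ (m - j) * hurwitz_zeta ((K - j) + 2) (a, u))%C * logk (/ y) u)) (S m))).
      intros m Hm.
      apply (is_int0_rsum (fun j u => (-1) ^ j * (Binomial.C m j * stirling1 (S K) (m + 1))
         * (Re ((a, u) ^ (m - j) * hurwitz_zeta ((K - j) + 2) (a, u))%C * logk (/ y) u))).
      intros j Hj. apply is_int0_scal, HJ; lia. }
  assert (E := int0_zeta_comb l r a y v Ha Hy Hl Hx Hv). fold K in E.
  assert (ES : sum_range 0 K (fun j => (-1) ^ j *
     sum_range j K (fun m => Binomial.C m j * stirling1 (S K) (m + 1) * zeta_log_integral K a y m j)) = 2 * v).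
  { unfold sum_range.
    rewrite (sum_n_m_ext_loc _ (fun j => sum_n_m (fun m => 2 * ((-1) ^ j * (Binomial.C m j * stirling1 (S K) (m + 1)) * J m j)) j K)).
    2: { intros j Hj. rewrite <- (sum_n_m_mult_l ((-1) ^ j)). apply sum_n_m_ext_loc. intros m Hm.
         rewrite EJ by lia. unfold mult; simpl. ring. }
    rewrite (triangular_swap (fun j m => 2 * ((-1) ^ j * (Binomial.C m j * stirling1 (S K) (m + 1)) * J m j))).
    unfold v. rewrite <- rsum_scal. apply rsum_ext. intros m. now rewrite <- rsum_scal. }
  rewrite ES.
  assert (Hsq : (-1) ^ K * (-1) ^ K = 1).
  { rewrite <- Rpow_mult_distr. replace (-1 * -1) with 1 by ring. apply pow1. }
  replace (2 * v) with ((-1) ^ K * (2 * ((-1) ^ K * v))).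
  2: { replace ((-1) ^ K * (2 * ((-1) ^ K * v))) with ((-1) ^ K * (-1) ^ K * (2 * v)) by ring. rewrite Hsq. ring. }
  rewrite E. f_equal. unfold Rdiv. ring.
Qed.

Theorem theorem7p3 (l : nat) (hl : (1 <= l)%nat) :
  (forall x : R, INR l < x ->
     sum_range 0 (2 * l - 1) (fun j =>
       (-1) ^ (j + 1) *
       sum_range j (2 * l - 1) (fun m =>
         Binomial.C m j * stirling1 (2 * l) (m + 1) * z_int l m j x))
     = - (PI / INR l) *
       (ln (x - INR l) + harmonic (2 * l - 1)
        - Derive_n (fun y => gbinom (y - 1) (2 * l - 1) * digamma (y - INR l))
                   (2 * l - 1) x))
  /\
  (forall x : R, INR l + / 2 < x ->
     sum_range 0 (2 * l) (fun j =>
       (-1) ^ j *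
       sum_range j (2 * l) (fun m =>
         Binomial.C m j * stirling1 (2 * l + 1) (m + 1) * Z_int l m j x))
     = - (2 * PI / INR (2 * l + 1)) *
       (ln (x - INR l - / 2) + harmonic (2 * l)
        - Derive_n (fun y => gbinom (y - 1) (2 * l) * digamma (y - INR l))
                   (2 * l) x)).
Proof.
  assert (Hl : 0 < INR l) by (apply lt_0_INR; lia).
  split; intros x Hx.
  - set (r := (2 * l - 2)%nat).
    assert (E := stirling_zeta_log_sum l r (INR l) (x - INR l) Hl ltac:(lra) ltac:(lia) ltac:(lra)).
    replace (INR l + (x - INR l)) with x in E by ring.
    replace (S (S r)) with (2 * l)%nat in E by lia.
    replace (S r) with (2 * l - 1)%nat in E by lia.
    (* Here K is odd, and the resulting factor -1 is matched by the sign (-1)^(j+1) of the first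
       identity. *)
    assert (Hodd : (-1) ^ (2 * l - 1) = -1).
    { replace (2 * l - 1)%nat with (S (2 * (l - 1))) by lia. apply pow_1_odd. }
    rewrite Hodd in E. unfold sum_range in *.
    match type of E with sum_n_m ?f _ _ = _ =>
      transitivity (-1 * sum_n_m f 0 (2 * l - 1));
      [transitivity (sum_n_m (fun j => mult (-1) (f j)) 0 (2 * l - 1)); [|exact (sum_n_m_mult_l (-1) f 0 (2 * l - 1))]|] end.
    + apply sum_n_m_ext_loc. intros j Hj.
      replace (zeta_log_integral (2 * l - 1) (INR l) (x - INR l)) with (fun m j => z_int l m j x).
      * rewrite pow_add, pow_1. cbv beta. match goal with |- _ = mult _ ?z => change (mult (-1) z) with (-1 * z) end.
        match goal with |- @eq _ ?p ?q => change (@eq R p q) end. ring.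
      * unfold zeta_log_integral. replace (S (2 * l - 1)) with (2 * l)%nat by lia. reflexivity.
    + rewrite E, mult_INR. simpl (INR 2). field. lra.
  - set (r := (2 * l - 1)%nat).
    assert (E := stirling_zeta_log_sum l r (INR l + / 2) (x - INR l - / 2) ltac:(lra) ltac:(lra) ltac:(lia) ltac:(lra)).
    replace (INR l + / 2 + (x - INR l - / 2)) with x in E by ring.
    replace (S r) with (2 * l)%nat in E by lia.
    rewrite pow_1_even in E. rewrite (Nat.add_1_r (2 * l)).
    transitivity (1 * (2 * PI / INR (S (2 * l)) *
      (Derive_n (fun x => gbinom (x - 1) (2 * l) * digamma (x - INR l)) (2 * l) x - ln (x - INR l - / 2) - harmonic (2 * l)))).
    + rewrite <- E. unfold zeta_log_integral.
      replace (S (2 * l) + 1)%nat with (2 * l + 2)%nat by lia. reflexivity.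
    + field. apply not_0_INR. lia.
Qed.
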